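(* Let $T\in\mathcal{K}(V)$ be injective and bisectorial of angle $\omega\in(0,\frac{\pi}{2})$. Then for every $f\in\mathcal{N}^{\mathrm{poly}}(S_{2\theta})$, $\theta\in(\omega,\frac{\pi}{2})$, the function $\widehat{f}(s):=f(s^2)$, $s\in D_\theta$, belongs to $\mathcal{N}^{\mathrm{poly}}(D_\theta)$, and there holds $$f(T^2)=\widehat{f}(T).$$ Here the left hand side is understood as the sectorial $H^\infty$-functional calculus of the operator $T^2$ (which is injective and sectorial of angle $2\omega$), and the right hand side as the bisectorial $H^\infty$-functional calculus of the operator $T$.
   Context: **Clifford algebra and modules.** Let $n\in\mathbb{N}$ and let $\mathbb{R}_n$ be the real Clifford algebra generated by $e_1,\dots,e_n$ with $e_i^2=-1$, $e_ie_j=-e_je_i$ for $i\neq j$. $\overline{\,\cdot\,}$ is Clifford conjugation (the real-linear anti-automorphism with $\overline{e_i}=-e_i$), $\operatorname{Sc}$ is the scalar part, $|\cdot|$ is the Euclidean norm. Paravectors: $\mathbb{R}^{n+1}=\{x_0+x_1e_1+\dots+x_ne_n\mid x_i\in\mathbb{R}\}$, with $s_0=\operatorname{Sc}(s)$. $\mathbb{S}=\{x_1e_1+\dots+x_ne_n\mid x_1^2+\dots+x_n^2=1\}$; for $J\in\mathbb{S}$, $\mathbb{C}_J=\{x+Jy\mid x,y\in\mathbb{R}\}$. $V$ is a right Hilbert module: a real vector space which is a right $\mathbb{R}_n$-module (extending real scalar multiplication), with an $\mathbb{R}$-bilinear form $\langle\cdot,\cdot\rangle:V\times V\to\mathbb{R}_n$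 satisfying $\langle vs,w\rangle=\overline{s}\langle v,w\rangle$, $\langle v,ws\rangle=\langle v,w\rangle s$, $\overline{\langle v,w\rangle}=\langle w,v\rangle$, and such that $(V,\operatorname{Sc}\langle\cdot,\cdot\rangle)$ is a real Hilbert space; $\|v\|^2=\operatorname{Sc}\langle v,v\rangle$. **Operators and $S$-spectrum.** $T:\operatorname{dom}T\to V$ is right linear if $\operatorname{dom}T$ is a right submodule, $T$ is additive and $T(vs)=(Tv)s$ for $s\in\mathbb{R}_n$. $\mathcal{K}(V)$ is the set of closed right linear operators, $\mathcal{B}(V)$ the set of everywhere defined bounded right linear operators. For $s\in\mathbb{R}^{n+1}$: $Q_s[T]=T^2-2s_0T+|s|^2$ with domain $\operatorname{dom}T^2$; $\rho_S(T)=\{s\in\mathbb{R}^{n+1}\mid Q_s[T]^{-1}\in\mathcal{B}(V)\}$, $\sigma_S(T)=\mathbb{R}^{n+1}\setminus\rho_S(T)$. $\mathcal{I}^Rs:V\to V$ is right multiplication $v\mapsto vs$. One has $s\in\rho_S(T)$ iff $\mathcal{I}^Rs-T$ is bijective from $\operatorname{dom}T$ onto $V$. **Sectorial and bisectorial operators.** $S_\omega=\{s\in\mathbb{R}^{n+1}\setminus\{0\}\mid|\operatorname{Arg}(s)|<\omega\}$ for $\omega\in(0,\pi)$, where $\operatorname{Arg}(s)=\arccos(s_0/|s|)$; $D_\omega=S_\omega\cup(-S_\omega)$ for $\omega\in(0,\frac{\pi}{2})$. $T\in\mathcal{K}(V)$ is sectorial of angle $\omega\in(0,\pi)$ (resp.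 bisectorial of angle $\omega\in(0,\frac{\pi}{2})$) if $\sigma_S(T)\subseteq\overline{S_\omega}$ (resp. $\overline{D_\omega}$) and for every $\varphi\in(\omega,\pi)$ (resp. $(\omega,\frac{\pi}{2})$) there is $C_\varphi\ge0$ with $\|(\mathcal{I}^Rs-T)^{-1}\|\le C_\varphi/|s|$ for all $s\in\mathbb{R}^{n+1}\setminus(S_\varphi\cup\{0\})$ (resp. $s\in\mathbb{R}^{n+1}\setminus(D_\varphi\cup\{0\})$). The square of a bisectorial operator of angle $\omega$ is sectorial of angle $2\omega$. **Functions.** For $U\subseteq\mathbb{R}^{n+1}$ open and axially symmetric ($x+Jy\in U$ implies $x+Iy\in U$ for all $I\in\mathbb{S}$), $f:U\to\mathbb{R}^{n+1}$ is intrinsic if $f(x+Jy)=\alpha(x,y)+J\beta(x,y)$ with real-valued $\alpha,\beta$ independent of $J$, satisfying the Cauchy–Riemann equations, $\alpha$ even and $\beta$ odd in $y$ (so $f$ is holomorphic on each $U\cap\mathbb{C}_J$ and $\overline{f(s)}=f(\overline{s})$). $\mathcal{N}^0(U)$: intrinsic $f$ with $|f(s)|\le C|s|^\alpha/(1+|s|^{2\alpha})$ for some $\alpha>0$, $C\ge0$. $\mathcal{N}^{\mathrm{poly}}(U)$: intrinsic $f$ with $|f(s)|\le C(|s|^k+|s|^{-k})$ for some $k,C\ge0$. **Functional calculus.** Let $T$ be injective and sectorial of angle $\omega$ (resp. bisectorial). For $f\in\mathcal{N}^0(S_\theta)$, $\theta\in(\omega,\pi)$ (resp. $f\in\mathcal{N}^0(D_\theta)$,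 $\theta\in(\omega,\frac{\pi}{2})$), $$f(T)v=\frac{1}{2\pi}\int_{\partial S_\varphi\cap\mathbb{C}_J}(\mathcal{I}^Rs-T)^{-1}vf(s)\,ds_J\quad\Big(\text{resp. }\int_{\partial D_\varphi\cap\mathbb{C}_J}\Big),$$ with $\varphi\in(\omega,\theta)$ and $J\in\mathbb{S}$ arbitrary, $ds_J=ds/J$, and the boundary oriented so that the (double) sector lies to its left. For $f\in\mathcal{N}^{\mathrm{poly}}$ on $S_\theta$ (resp. $D_\theta$), $f(T)=e(T)^{-1}(ef)(T)$ (with natural domain), where $e\in\mathcal{N}^0$ is any function with $ef\in\mathcal{N}^0$ and $e(T)$ injective, e.g. $e(s)=\frac{s^{k+1}}{(1+s)^{2k+2}}$ in the sectorial and $e(s)=\frac{s^{k+1}}{(1+s^2)^{k+1}}$ in the bisectorial case, $k\in\mathbb{N}_0$ large enough; $f(T)$ is independent of the choice of $e$. This is called the $H^\infty$-functional calculus. *)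

(* Defs.v *)
From Stdlib Require Import Reals.
From HB Require Import structures.
From mathcomp Require Import all_boot all_algebra.
From mathcomp Require Import Rstruct.
From Coquelicot Require Import Coquelicot.

Set Implicit Arguments.
Unset Strict Implicit.
Unset Printing Implicit Defensive.

(* R_scope is the ambient scope (real numbers); "%R" delimits ring_scope, which
   is used for the Clifford algebra. *)
Open Scope R_scope.
Import GRing.Theory.

(** * The Clifford algebra R_n *)

(* An element of R_n is the family of its coordinates in the basis (e_A), where
   A ranges over the subsets of {0, ..., n-1} and e_A is the product of the e_i,
   i in A, taken in increasing order. *)
Definition clifford (n : nat) : Type := {ffun {set 'I_n} -> R^o}.

HB.instance Definition _ n :=
  GRing.Lmodule.copy (clifford n) {ffun {set 'I_n} -> R^o}.

Section Clifford.
Variable n : nat.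
Implicit Types (A B C : {set 'I_n}) (x y z : clifford n).

Definition coef x A : R := (x : {ffun {set 'I_n} -> R^o}) A.

Definition blade A : clifford n :=
  [ffun B => (if B == A then 1 else 0)%R : R^o].

Definition symdiff A B : {set 'I_n} := [set i | (i \in A) (+) (i \in B)].

(* Sorting e_A e_B costs one sign for each pair (a, b) with b < a, since
   e_a e_b = - e_b e_a, and one for each pair with b = a, since e_a ^ 2 = -1. *)
Definition blade_sign A B : R :=
  ((-1) ^+ (\sum_(a in A) \sum_(b in B) (b <= a)%N)%N)%R.

Definition cl_mul x y : clifford n :=
  (\sum_A \sum_B (coef x A * coef y B * blade_sign A B)
                   *: blade (symdiff A B))%R.

Definition cl_one : clifford n := blade set0.

Lemma coefE x y : (forall A, coef x A = coef y A) -> x = y.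
Proof. by move=> h; apply/ffunP. Qed.

Lemma coef_blade A B : coef (blade A) B = (if B == A then 1 else 0)%R.
Proof. by rewrite /coef ffunE. Qed.

Lemma coefD x y A : coef (x + y)%R A = (coef x A + coef y A)%R.
Proof. by rewrite /coef ffunE. Qed.

Lemma coefZ (a : R) x A : coef (a *: x)%R A = (a * coef x A)%R.
Proof. by rewrite /coef ffunE. Qed.

Lemma coefN x A : coef (- x)%R A = (- coef x A)%R.
Proof. by rewrite /coef ffunE. Qed.

Lemma coef_sum (I : Type) (r : seq I) (P : pred I) (F : I -> clifford n) A :
  coef (\sum_(i <- r | P i) F i)%R A = (\sum_(i <- r | P i) coef (F i) A)%R.
Proof. by rewrite /coef sum_ffunE. Qed.

Lemma cl_decomp x : x = (\sum_A coef x A *: blade A)%R.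
Proof.
apply: coefE => B; rewrite coef_sum (bigD1 B) //= coefZ coef_blade eqxx.
rewrite mulr1 big1 ?addr0 // => A /negbTE nA.
by rewrite coefZ coef_blade eq_sym nA mulr0.
Qed.

Lemma cl_mulDl : left_distributive cl_mul +%R.
Proof.
move=> x y z; rewrite /cl_mul -big_split; apply: eq_bigr => A _ /=.
by rewrite -big_split; apply: eq_bigr => B _ /=; rewrite coefD !mulrDl scalerDl.
Qed.

Lemma cl_mulDr : right_distributive cl_mul +%R.
Proof.
move=> x y z; rewrite /cl_mul -big_split; apply: eq_bigr => A _ /=.
rewrite -big_split; apply: eq_bigr => B _ /=.
by rewrite coefD mulrDr mulrDl scalerDl.
Qed.

Lemma cl_mulZl (a : R) x y : cl_mul (a *: x)%R y = (a *: cl_mul x y)%R.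
Proof.
rewrite /cl_mul scaler_sumr; apply: eq_bigr => A _ /=.
by rewrite scaler_sumr; apply: eq_bigr => B _ /=; rewrite coefZ scalerA !mulrA.
Qed.

Lemma cl_mulZr (a : R) x y : cl_mul x (a *: y)%R = (a *: cl_mul x y)%R.
Proof.
rewrite /cl_mul scaler_sumr; apply: eq_bigr => A _ /=.
rewrite scaler_sumr; apply: eq_bigr => B _ /=.
by rewrite coefZ scalerA !mulrA (mulrC _ a).
Qed.

Lemma cl_mul_blade A B :
  cl_mul (blade A) (blade B) = (blade_sign A B *: blade (symdiff A B))%R.
Proof.
rewrite /cl_mul (bigD1 A) //= (bigD1 B) //= !coef_blade !eqxx !mul1r.
rewrite big1 ?addr0 => [|C /negbTE nC]; last by rewrite coef_blade nC mulr0 mul0r scale0r.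
rewrite big1 ?addr0 // => C /negbTE nC.
by apply: big1 => D _; rewrite coef_blade nC !mul0r scale0r.
Qed.

Lemma cl_mul_suml (I : Type) (r : seq I) (F : I -> clifford n) y :
  cl_mul (\sum_(i <- r) F i)%R y = (\sum_(i <- r) cl_mul (F i) y)%R.
Proof.
elim: r => [|i r IH]; last by rewrite !big_cons cl_mulDl IH.
by rewrite !big_nil -(scale0r (0%R : clifford n)) cl_mulZl !scale0r.
Qed.

Lemma cl_mul_sumr (I : Type) (r : seq I) (F : I -> clifford n) y :
  cl_mul y (\sum_(i <- r) F i)%R = (\sum_(i <- r) cl_mul y (F i))%R.
Proof.
elim: r => [|i r IH]; last by rewrite !big_cons cl_mulDr IH.
by rewrite !big_nil -(scale0r (0%R : clifford n)) cl_mulZr !scale0r.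
Qed.

Lemma symdiffA : associative symdiff.
Proof. by move=> A B C; apply/setP => i; rewrite !inE addbA. Qed.

Lemma symdiffC : commutative symdiff.
Proof. by move=> A B; apply/setP => i; rewrite !inE addbC. Qed.

Lemma symdiff0 : right_id set0 symdiff.
Proof. by move=> A; apply/setP => i; rewrite !inE addbF. Qed.

Lemma symdiffxx A : symdiff A A = set0.
Proof. by apply/setP => i; rewrite !inE addbb. Qed.

Lemma odd_symdiff_sum A B (F : 'I_n -> nat) :
  odd (\sum_(i in symdiff A B) F i) =
  odd (\sum_(i in A) F i) (+) odd (\sum_(i in B) F i).
Proof.
have oddS C : odd (\sum_(i in C) F i) = \big[addb/false]_i ((i \in C) && odd (F i)).
  rewrite (big_morph odd oddD (erefl (odd 0))) big_mkcond /=.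
  by apply: eq_bigr => i _; case: (i \in C).
rewrite !oddS -big_split /=; apply: eq_bigr => i _; rewrite inE.
by case: (i \in A); case: (i \in B); case: (odd (F i)).
Qed.

Lemma blade_sign_odd A B :
  blade_sign A B =
  ((-1) ^+ odd (\sum_(a in A) \sum_(b in B) (b <= a)%N))%R.
Proof. by rewrite signr_odd. Qed.

Lemma blade_signDl A B C :
  blade_sign (symdiff A B) C = (blade_sign A C * blade_sign B C)%R.
Proof. by rewrite !blade_sign_odd odd_symdiff_sum signr_addb. Qed.

Lemma blade_signDr A B C :
  blade_sign C (symdiff A B) = (blade_sign C A * blade_sign C B)%R.
Proof.
rewrite !blade_sign_odd -signr_addb; congr (_ ^+ nat_of_bool _)%R.
have sumC (D : {set 'I_n}) : (\sum_(c in C) \sum_(d in D) (d <= c) =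
    \sum_(d in D) \sum_(c in C) (d <= c))%N by rewrite exchange_big.
by rewrite !sumC odd_symdiff_sum.
Qed.

Lemma blade_sign0l A : blade_sign set0 A = 1%R.
Proof. by rewrite /blade_sign big_set0 expr0. Qed.

Lemma blade_sign0r A : blade_sign A set0 = 1%R.
Proof.
by rewrite /blade_sign big1 ?expr0 // => i _; rewrite big_set0.
Qed.

Lemma cl_mul1l : left_id cl_one cl_mul.
Proof.
move=> x; rewrite {1}(cl_decomp x) cl_mul_sumr {2}(cl_decomp x).
apply: eq_bigr => A _.
by rewrite cl_mulZr cl_mul_blade blade_sign0l scale1r symdiffC symdiff0.
Qed.

Lemma cl_mul1r : right_id cl_one cl_mul.
Proof.
move=> x; rewrite {1}(cl_decomp x) cl_mul_suml {2}(cl_decomp x).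
apply: eq_bigr => A _.
by rewrite cl_mulZl cl_mul_blade blade_sign0r scale1r symdiff0.
Qed.

Lemma cl_mulA : associative cl_mul.
Proof.
move=> x y z; rewrite (cl_decomp x) !cl_mul_suml; apply: eq_bigr => A _.
rewrite (cl_decomp y) !(cl_mul_suml, cl_mul_sumr); apply: eq_bigr => B _.
rewrite (cl_decomp z) !(cl_mul_suml, cl_mul_sumr); apply: eq_bigr => C _.
rewrite !(cl_mulZl, cl_mulZr, cl_mul_blade) !scalerA symdiffA.
congr (_ *: _)%R; rewrite blade_signDl blade_signDr.
by rewrite -!cl_decomp /GRing.mul /=; ring.
Qed.

Lemma cl_one_neq0 : cl_one != 0%R.
Proof.
apply/eqP => /(congr1 (coef ^~ set0)); rewrite coef_blade eqxx /coef ffunE.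
exact: R1_neq_R0.
Qed.

End Clifford.

HB.instance Definition _ n :=
  GRing.Zmodule_isNzRing.Build (clifford n)
    (@cl_mulA n) (@cl_mul1l n) (@cl_mul1r n) (@cl_mulDl n) (@cl_mulDr n)
    (cl_one_neq0 n).
HB.instance Definition _ n :=
  GRing.Lmodule_isLalgebra.Build R (clifford n) (fun a x y => esym (cl_mulZl a x y)).
HB.instance Definition _ n :=
  GRing.Lalgebra_isAlgebra.Build R (clifford n) (fun a x y => esym (cl_mulZr a x y)).

Section CliffordOperations.
Variable n : nat.
Implicit Types (x y s J : clifford n) (A B : {set 'I_n}).

Definition gen (i : 'I_n) : clifford n := blade [set i].

Definition Sc x : R := coef x set0.

(* conj e_A = blade_sign A A * e_A because e_A * conj e_A = 1; the exponent in
   blade_sign A A is |A| (|A| + 1) / 2.  See conj_mul and conj_gen. *)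
Definition conj x : clifford n :=
  (\sum_A (coef x A * blade_sign A A) *: blade A)%R.

Definition cl_norm x : R := sqrt (\sum_A coef x A ^+ 2)%R.

Lemma gen_sqr i : (gen i * gen i = -1)%R.
Proof.
rewrite /GRing.mul /= cl_mul_blade symdiffxx /blade_sign.
by rewrite !big_set1 leqnn expr1 scaleN1r.
Qed.

Lemma gen_anticomm i j : i != j -> (gen i * gen j = - (gen j * gen i))%R.
Proof.
move=> nij; rewrite /GRing.mul /= !cl_mul_blade symdiffC -scaleNr.
congr (_ *: _)%R; rewrite /blade_sign !big_set1.
have [ij|ji|/val_inj eij] := ltngtP i j; last by rewrite eij eqxx in nij.
  by rewrite expr0 expr1 opprK.
by rewrite expr0 expr1.
Qed.

Lemma coef_conj x A : coef (conj x) A = (coef x A * blade_sign A A)%R.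
Proof.
rewrite coef_sum (bigD1 A) //= coefZ coef_blade eqxx mulr1 big1 ?addr0 //.
by move=> B /negbTE nB; rewrite coefZ coef_blade eq_sym nB mulr0.
Qed.

Lemma conjD x y : (conj (x + y) = conj x + conj y)%R.
Proof. by apply: coefE => A; rewrite !(coefD, coef_conj) mulrDl. Qed.

Lemma conjZ (a : R) x : (conj (a *: x) = a *: conj x)%R.
Proof. by apply: coefE => A; rewrite !(coefZ, coef_conj) mulrA. Qed.

Lemma conj_gen i : (conj (gen i) = - gen i)%R.
Proof.
apply: coefE => A; rewrite coef_conj coefN coef_blade.
case: eqP => [->|_]; last by rewrite mul0r oppr0.
by rewrite /blade_sign !big_set1 leqnn expr1 mul1r.
Qed.

Lemma conj_blade A : conj (blade A) = (blade_sign A A *: blade A)%R.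
Proof.
apply: coefE => B; rewrite coef_conj coefZ coef_blade.
by case: eqP => [->|_]; rewrite ?mul0r ?mulr0 // mulrC.
Qed.

Lemma conj_sum (I : Type) (r : seq I) (F : I -> clifford n) :
  (conj (\sum_(i <- r) F i) = \sum_(i <- r) conj (F i))%R.
Proof.
elim: r => [|i r IH]; last by rewrite !big_cons conjD IH.
by rewrite !big_nil -(scale0r (0%R : clifford n)) conjZ !scale0r.
Qed.

Lemma conj_mul x y : (conj (x * y) = conj y * conj x)%R.
Proof.
have conjMb A B : (conj (blade A * blade B) = conj (blade B) * conj (blade A))%R.
  rewrite !conj_blade -scalerAl -scalerAr.
  rewrite [(blade A * _)%R]cl_mul_blade [(blade B * _)%R]cl_mul_blade.
  rewrite conjZ conj_blade !scalerA symdiffC; congr (_ *: _)%R.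
  rewrite !(blade_signDl, blade_signDr).
  have sgnK : (blade_sign A B * blade_sign A B = 1)%R.
    by rewrite /blade_sign -expr2 sqrr_sign.
  rewrite -[RHS]mulr1 -sgnK /GRing.mul /=; ring.
rewrite (cl_decomp x) mulr_suml !conj_sum mulr_sumr; apply: eq_bigr => A _.
rewrite -scalerAl !conjZ -scalerAr; congr (_ *: _)%R.
rewrite (cl_decomp y) mulr_sumr !conj_sum mulr_suml; apply: eq_bigr => B _.
by rewrite -scalerAr !conjZ -scalerAl conjMb.
Qed.

End CliffordOperations.

(** * Paravectors *)

Section Paravectors.
Variable n : nat.
Implicit Types (s t J : clifford n) (U : clifford n -> Prop).

Definition paravector s : Prop :=
  exists (x0 : R) (x : 'I_n -> R), s = (x0%:A + \sum_i x i *: gen i)%R.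

Definition sphere J : Prop :=
  exists x : 'I_n -> R, J = (\sum_i x i *: gen i)%R /\ (\sum_i x i ^+ 2 = 1)%R.

(* The point x + J y of the complex plane C_J. *)
Definition slice J (x y : R) : clifford n := (x%:A + y *: J)%R.

Definition Arg s : R := acos (Sc s / cl_norm s).

Definition sector (omega : R) s : Prop :=
  paravector s /\ s <> 0%R /\ Arg s < omega.

Definition bisector (omega : R) s : Prop :=
  sector omega s \/ sector omega (- s)%R.

(* Closure in the space of paravectors. *)
Definition cl_closure U s : Prop :=
  paravector s /\
  forall eps, 0 < eps -> exists t, U t /\ cl_norm (s - t)%R < eps.

(** * Intrinsic functions *)

(* A function U -> R^{n+1} is a total function of which only the values on U
   matter; U is meant to be open and axially symmetric.  "alpha, beta satisfy
   the Cauchy-Riemann equations" means that they are continuously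
   differentiable, with partial derivatives
   alpha_x = beta_y = a and alpha_y = - beta_x = b. *)
Definition intrinsic U (f : clifford n -> clifford n) : Prop :=
  exists alpha beta a b : R -> R -> R,
    forall x y J, sphere J -> U (slice J x y) ->
      [/\ f (slice J x y) = slice J (alpha x y) (beta x y),
          alpha x (- y) = alpha x y /\ beta x (- y) = - beta x y,
          differentiable_pt_lim alpha x y (a x y) (b x y),
          differentiable_pt_lim beta x y (- b x y) (a x y) &
          continuity_2d_pt a x y /\ continuity_2d_pt b x y].

(* U is meant not to contain 0, where Rpower (cl_norm s) has no meaning. *)
Definition N0 U (f : clifford n -> clifford n) : Prop :=
  intrinsic U f /\
  exists alpha C : R, 0 < alpha /\ 0 <= C /\
    forall s, U s ->
      cl_norm (f s) <=
        C * (Rpower (cl_norm s) alpha / (1 + Rpower (cl_norm s) (2 * alpha))).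

Definition Npoly U (f : clifford n -> clifford n) : Prop :=
  intrinsic U f /\
  exists k C : R, 0 <= k /\ 0 <= C /\
    forall s, U s ->
      cl_norm (f s) <= C * (Rpower (cl_norm s) k + Rpower (cl_norm s) (- k)).

End Paravectors.

(** * Right Hilbert modules *)

(* The carrier is a real Banach space; its norm is the one of the scalar
   product Sc <v, w>, so that it is a real Hilbert space.  Bilinearity of ip over
   R follows from additivity and the two homogeneity axioms, as rmul extends the
   scalar multiplication by reals. *)
Record rightHilbertModule (n : nat) : Type := RightHilbertModule {
  rhm_car :> CompleteNormedModule R_AbsRing;
  rmul : rhm_car -> clifford n -> rhm_car;
  ip : rhm_car -> rhm_car -> clifford n;
  rmulDl : forall v w s, rmul (plus v w) s = plus (rmul v s) (rmul w s);
  rmulDr : forall v s t, rmul v (s + t)%R = plus (rmul v s) (rmul v t);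
  rmulM : forall v s t, rmul v (s * t)%R = rmul (rmul v s) t;
  rmul_real : forall v (a : R), rmul v (a%:A)%R = scal a v;
  ipDl : forall u v w, ip (plus u v) w = (ip u w + ip v w)%R;
  ipDr : forall u v w, ip u (plus v w) = (ip u v + ip u w)%R;
  ip_rmull : forall v w s, ip (rmul v s) w = (conj s * ip v w)%R;
  ip_rmulr : forall v w s, ip v (rmul w s) = (ip v w * s)%R;
  ip_conj : forall v w, conj (ip v w) = ip w v;
  ip_norm : forall v, norm v ^ 2 = Sc (ip v v)
}.

Section Operators.
Variables (n : nat) (V : rightHilbertModule n).

(** * Operators and the S-spectrum *)

(* An operator is given by its graph: T v w means v \in dom T and T v = w. *)
Definition operator : Type := V -> V -> Prop.

Implicit Types (T A B : operator) (s J : clifford n).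

Definition right_linear T : Prop :=
  [/\ forall v w w', T v w -> T v w' -> w = w',
      T zero zero,
      forall v v' w w', T v w -> T v' w' -> T (plus v v') (plus w w') &
      forall v w s, T v w -> T (rmul v s) (rmul w s)].

(* T belongs to K(V). *)
Definition closed_operator T : Prop :=
  right_linear T /\ closed (fun p : V * V => T p.1 p.2).

Definition op_bound A (c : R) : Prop := forall v w, A v w -> norm w <= c * norm v.

(* A belongs to B(V). *)
Definition bounded_operator A : Prop :=
  [/\ right_linear A, forall v, exists w, A v w & exists c, op_bound A c].

Definition op_injective A : Prop := forall v v' w, A v w -> A v' w -> v = v'.

Definition op_inv A : operator := fun v w => A w v.

Definition op_sq T : operator := fun v w => exists u, T v u /\ T u w.

Definition Q s T : operator := fun v w => exists u z, T v u /\ T u z /\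
  w = plus (minus z (scal (2 * Sc s) u)) (scal (cl_norm s ^ 2) v).

Definition S_resolvent_set T s : Prop :=
  paravector s /\ bounded_operator (op_inv (Q s T)).

Definition S_spectrum T s : Prop := paravector s /\ ~ S_resolvent_set T s.

(* The operator I^R s - T, with domain dom T. *)
Definition pencil s T : operator := fun v w =>
  exists u, T v u /\ w = minus (rmul v s) u.

Definition sectorial (omega : R) T : Prop :=
  [/\ closed_operator T, 0 < omega < PI,
      forall s, S_spectrum T s -> cl_closure (@sector n omega) s &
      forall phi, omega < phi < PI -> exists C, 0 <= C /\
        forall s, paravector s -> s <> 0%R -> ~ sector phi s ->
          op_bound (op_inv (pencil s T)) (C / cl_norm s)].

Definition bisectorial (omega : R) T : Prop :=
  [/\ closed_operator T, 0 < omega < PI / 2,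
      forall s, S_spectrum T s -> cl_closure (@bisector n omega) s &
      forall phi, omega < phi < PI / 2 -> exists C, 0 <= C /\
        forall s, paravector s -> s <> 0%R -> ~ bisector phi s ->
          op_bound (op_inv (pencil s T)) (C / cl_norm s)].

(** * The H^oo functional calculus *)

(* The vector (I^R s - T)^{-1} v; only meaningful if I^R s - T is bijective. *)
Definition resolvent s T (v : V) : V := iota (fun w => pencil s T w v).

Definition cl_exp J (phi : R) : clifford n := slice J (cos phi) (sin phi).

(* I is the (improper) integral of (I^R s - T)^{-1} v f(s) ds_J along the ray
   s = r u, 0 < r < +oo, with u in C_J of modulus 1 : here
   ds_J = ds / J = (u / J) dr = - (u J) dr. *)
Definition is_ray_integral T (f : clifford n -> clifford n) J u (v I : V) : Prop :=
  is_RInt_gen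
    (fun r : R => rmul (rmul (resolvent (r *: u)%R T v) (f (r *: u)%R))
                       (- (u * J))%R)
    (at_right 0) (Rbar_locally p_infty) I.

(* The boundary of S_phi in C_J comes in from oo along exp(J phi) and leaves
   along exp(- J phi). *)
Definition is_sector_integral T f (phi : R) J (v I : V) : Prop :=
  exists I1 I2 : V,
    [/\ is_ray_integral T f J (cl_exp J (- phi)) v I1,
        is_ray_integral T f J (cl_exp J phi) v I2 &
        I = minus I1 I2].

(* The boundary of D_phi is the one of S_phi together with its image under
   s |-> -s, which preserves the orientation. *)
Definition is_bisector_integral T f (phi : R) J (v I : V) : Prop :=
  exists I1 I2 I3 : V,
    [/\ is_sector_integral T f phi J v I1,
        is_ray_integral T f J (- cl_exp J (- phi))%R v I2,
        is_ray_integral T f J (- cl_exp J phi)%R v I3 &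
        I = plus I1 (minus I2 I3)].

(* f(T) for f in N^0 of S_theta, resp. of D_theta; the integral does not depend
   on the choice of phi and J. *)
Definition calc_N0_sector (omega theta : R) T f : operator := fun v w =>
  exists phi J I, [/\ omega < phi < theta, sphere J,
    is_sector_integral T f phi J v I & w = scal (/ (2 * PI)) I].

Definition calc_N0_bisector (omega theta : R) T f : operator := fun v w =>
  exists phi J I, [/\ omega < phi < theta, sphere J,
    is_bisector_integral T f phi J v I & w = scal (/ (2 * PI)) I].

(* f(T) = e(T)^{-1} (e f)(T), where e(T) and (e f)(T) are given by calc; the
   operator does not depend on the choice of e. *)
Definition regularized (U : clifford n -> Prop)
    (calc : (clifford n -> clifford n) -> operator)
    (f : clifford n -> clifford n) : operator := fun v w =>
  exists e : clifford n -> clifford n,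
    [/\ N0 U e, N0 U (fun s => e s * f s)%R, op_injective (calc e) &
        exists u, calc (fun s => e s * f s)%R v u /\ calc e w u].

(* The graphs of f(T), T sectorial resp. bisectorial of angle omega, for f in
   N^poly of S_theta resp. D_theta. *)
Definition Hinf_sector (omega theta : R) T f : operator :=
  regularized (@sector n theta) (calc_N0_sector omega theta T) f.

Definition Hinf_bisector (omega theta : R) T f : operator :=
  regularized (@bisector n theta) (calc_N0_bisector omega theta T) f.

End Operators.

(* Main.v *)
(* Substituting s = t^2 in the contour integral of f(T^2), and splitting
   2 t (t^2 - T^2)^{-1} = (t - T)^{-1} - (- t - T)^{-1}, turns the two rays bounding S_{2 phi} into
   the four rays bounding D_phi; hence e(T^2) = e(s^2)(T) for every e in N^0. A regularizer e of f
   thus gives the regularizer e(s^2) of f(s^2). Conversely, an arbitrary regularizer e of f(s^2) is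
   compared with the regularizer e'(s^2), e'(s) = (s / (1 + s)^2)^m, by means of multiplicativity
   of the bisectorial calculus on N^0: with g = f(s^2) both sides of
   e(T) (e'(s^2) g)(T) = e'(T^2) (e g)(T) are products, and e(T) is injective. The operator
   e'(T^2) is injective since e'(s^2) is a power of s / (1 + s^2), whose value at T is
   T (1 + T^2)^{-1}. Identities between vectors are tested against functionals with values in a
   slice C_J, which reduces contour integrals to complex ones. *)

Require Import Defs.
From Stdlib Require Import Reals Lra.
From mathcomp Require Import all_boot all_algebra.
From mathcomp Require Import Rstruct.
From Coquelicot Require Import Coquelicot.

Set Implicit Arguments.
Unset Strict Implicit.
Unset Printing Implicit Defensive.

Open Scope R_scope.

(** * Improper integrals over (0, oo) *)

(** A regularizer on the double sector need not be even, hence need not be a function of [s^2]; this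
    is why the converse inclusion needs multiplicativity, while the direct one only needs a
    substitution. The contours run into 0 and oo and are never closed. Cauchy's theorem therefore
    appears as invariance of ray integrals under rotation of the ray, the arcs near 0 and oo
    contributing nothing, and residues are computed on well chosen rays. Convergence always comes
    from one dominating function, the bound of N^0 divided by [r], where [1/r] is the resolvent
    estimate. The definition of the calculus leaves the angle and the slice free. Independence of
    the angle is a rotation of rays; independence of the slice holds already for the integrand, once
    the contributions of [s] and of its conjugate are added, because both resolvents are built from
    the vectors [y] and [T y] with [y = Q_s[T]^{-1} v]. The value of [s / (1 + s^2)] at [T] is a
    residue computation at [i] and [- i]. These poles lie outside the double sector, so the contour
    is read as the boundary of the complementary double sector around the imaginary axis. *)

Definition Ipos (V : NormedModule R_AbsRing) (f : R -> V) (l : V) : Prop :=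
  is_RInt_gen f (at_right 0) (Rbar_locally p_infty) l.

(** The thresholds are ordered, so that every integral taken beyond them runs over a proper interval
    [a < b]. *)
Lemma Ipos_filter (P : R * R -> Prop) :
  filter_prod (at_right 0) (Rbar_locally p_infty) P <->
  exists a0 b0, 0 < a0 < b0 /\ forall a b, 0 < a < a0 -> b0 < b -> P (a, b).
Proof.
split.
- case=> Q1 Q2 [d hd] [M hM] h.
  exists (Rmin d 1), (Rmax M 2); have hd0 := cond_pos d.
  split.
    split; first by apply: Rmin_pos; lra.
    have := Rmin_r d 1; have := Rmax_r M 2; lra.
  move=> a b ha hb; apply: h.
    apply: hd; last lra.
    rewrite /ball /= /AbsRing_ball /abs /= /minus /plus /opp /= Rabs_pos_eq; last lra.
    have := Rmin_l d 1; lra.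
  by apply: hM; have := Rmax_l M 2; lra.
- move=> [a0 [b0 [hab h]]].
  exists (fun a => 0 < a < a0) (fun b => b0 < b).
  + have ha0 : 0 < a0 by lra.
    exists (mkposreal a0 ha0) => y /= hy hy0; split=> //.
    move: hy; rewrite /ball /= /AbsRing_ball /abs /= /minus /plus /opp /= Rabs_pos_eq; lra.
  + by exists b0.
  + by move=> a b ha hb; exact: h.
Qed.

Definition cont_pos (W : UniformSpace) (f : R -> W) :=
  forall x, 0 < x -> continuous f x.

Lemma ex_RInt_pos (W : CompleteNormedModule R_AbsRing) (f : R -> W) a b :
  cont_pos f -> 0 < a -> 0 < b -> ex_RInt f a b.
Proof.
move=> hf ha hb; apply: ex_RInt_continuous => z hz; apply: hf.
by have := Rmin_pos _ _ ha hb; lra.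
Qed.

Lemma minus_norm_sym (W : CompleteNormedModule R_AbsRing) (x y : W) :
  norm (minus x y) = norm (minus y x).
Proof. by rewrite -norm_opp opp_minus. Qed.

Section PositiveHalfLine.
Variable V : CompleteNormedModule R_AbsRing.
Implicit Types (f g : R -> V) (l : V).

(** Continuity on the open half line makes [RInt f a b] exist for all positive bounds, so
    convergence along the filter becomes a two-sided limit of values. *)
Lemma IposP f l : cont_pos f ->
  Ipos f l <-> forall eps, 0 < eps -> exists a0 b0, 0 < a0 < b0 /\
    forall a b, 0 < a < a0 -> b0 < b -> norm (minus (RInt f a b) l) < eps.
Proof.
move=> hf; split.
- move=> h eps heps.
  have [a0 [b0 [h0 h1]]] :=
    proj1 (Ipos_filter _) (h _ (locally_ball_norm l (mkposreal eps heps))).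
  exists a0, b0; split=> // a b ha hb.
  case: (h1 a b ha hb) => y [/= hy hb'].
  by rewrite (is_RInt_unique _ _ _ _ hy).
- move=> h P hP; apply/Ipos_filter.
  have [eps heps] := locally_norm_le_locally _ _ hP.
  case: (h eps (cond_pos eps)) => a0 [b0 [h0 h1]].
  exists a0, b0; split=> // a b ha hb.
  exists (RInt f a b); split; last by apply: heps; exact: h1.
  by apply: RInt_correct; apply: ex_RInt_pos => //=; lra.
Qed.

Lemma Ipos_ext f g l : (forall x, 0 < x -> f x = g x) -> Ipos f l -> Ipos g l.
Proof.
move=> h; apply: is_RInt_gen_ext; apply/Ipos_filter.
exists 1, 2; split; first lra.
move=> a b ha hb x /= hx; apply: h.
have hb0 : 0 < b by lra.
by have := Rmin_pos _ _ (proj1 ha) hb0; lra.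
Qed.

Lemma Ipos_unique f l l' : Ipos f l -> Ipos f l' -> l = l'.
Proof. by move=> /is_RInt_gen_unique <- /is_RInt_gen_unique <-. Qed.

End PositiveHalfLine.

Lemma IposRP (g : R -> R) (L : R) : cont_pos g ->
  Ipos g L <-> forall eps, 0 < eps -> exists a0 b0, 0 < a0 < b0 /\
    forall a b, 0 < a < a0 -> b0 < b -> Rabs (RInt g a b - L) < eps.
Proof. exact: (@IposP R_CompleteNormedModule). Qed.

Section Domination.
Variable V : CompleteNormedModule R_AbsRing.
Implicit Types (f : R -> V) (l : V).

(** Only the two end pieces survive in the difference, and each is bounded by the integral of [g]
    over the same piece. *)
Lemma norm_RInt_nested f (g : R -> R) m a b M :
  cont_pos f -> cont_pos g ->
  (forall x, 0 < x -> norm (f x) <= g x) ->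
  0 < m <= a -> a <= b <= M ->
  norm (minus (RInt f m M) (RInt f a b)) <= RInt g m M - RInt g a b.
Proof.
move=> hf hg h hm hb.
have E (W : CompleteNormedModule R_AbsRing) (k : R -> W) :
    cont_pos k ->
    RInt k m M = plus (RInt k m a) (plus (RInt k a b) (RInt k b M)).
  move=> hk; rewrite !RInt_Chasles //; apply: ex_RInt_pos => //; lra.
rewrite (E _ f hf) (E _ g hg).
rewrite /plus /=.
have -> : RInt g m a + (RInt g a b + RInt g b M) - RInt g a b =
          RInt g m a + RInt g b M by ring.
have -> : minus (plus (RInt f m a) (plus (RInt f a b) (RInt f b M))) (RInt f a b) =
          plus (RInt f m a) (RInt f b M).
  rewrite /minus (plus_comm (RInt f a b) (RInt f b M)) plus_assoc -[LHS]plus_assoc.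
  by rewrite plus_opp_r plus_zero_r.
have le1 p q : 0 < p <= q -> norm (RInt f p q) <= RInt g p q.
  move=> hpq; apply: (norm_RInt_le f g p q) => //; first lra.
  - by move=> x hx; apply: h; lra.
  - by apply: RInt_correct; apply: ex_RInt_pos => //; lra.
  - by apply: RInt_correct; apply: ex_RInt_pos => //; lra.
apply: Rle_trans (norm_triangle _ _) _.
by apply: Rplus_le_compat; apply: le1; lra.
Qed.

(** Limit of the nested estimate as the outer interval exhausts [(0, oo)]; it controls the
    truncation errors in Fubini's theorem. *)
Lemma Ipos_tail f (g : R -> R) l L a b :
  cont_pos f -> cont_pos g -> (forall x, 0 < x -> norm (f x) <= g x) ->
  Ipos f l -> Ipos g L -> 0 < a <= b ->
  norm (minus l (RInt f a b)) <= L - RInt g a b.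
Proof.
move=> hf hg hfg hl hL hab; apply: le_epsilon => eps heps.
have heps2 : 0 < eps / 2 by lra.
case: (proj1 (IposP _ hf) hl _ heps2) => a1 [b1 [h1 H1]].
case: (proj1 (IposRP _ hg) hL _ heps2) => a2 [b2 [h2 H2]].
pose m := Rmin a (Rmin a1 a2) / 2; pose M := Rmax b (Rmax b1 b2) + 1.
have hm0 : 0 < Rmin a (Rmin a1 a2) by apply: Rmin_pos; [lra|apply: Rmin_pos; lra].
have hm : 0 < m < a1 /\ m < a2 /\ m <= a.
  rewrite /m; have := Rmin_l a (Rmin a1 a2); have := Rmin_r a (Rmin a1 a2).
  have := Rmin_l a1 a2; have := Rmin_r a1 a2; lra.
have hM : b1 < M /\ b2 < M /\ b <= M.
  rewrite /M; have := Rmax_l b (Rmax b1 b2); have := Rmax_r b (Rmax b1 b2).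
  have := Rmax_l b1 b2; have := Rmax_r b1 b2; lra.
have e1 : norm (minus (RInt f m M) l) < eps / 2 by apply: H1; lra.
have e2 : Rabs (RInt g m M - L) < eps / 2 by apply: H2; lra.
have e3 : norm (minus (RInt f m M) (RInt f a b)) <= RInt g m M - RInt g a b.
  by apply: norm_RInt_nested => //; lra.
rewrite (minus_trans (RInt f m M)).
apply: Rle_trans (norm_triangle _ _) _.
rewrite minus_norm_sym; move/Rabs_def2: e2 => e2; lra.
Qed.

Lemma Ipos_dominated f (g : R -> R) L :
  cont_pos f -> cont_pos g -> (forall x, 0 < x -> norm (f x) <= g x) ->
  Ipos g L -> exists l, Ipos f l.
Proof.
move=> hf hg hfg hL.
have [l hl] : exists l : V, filterlim (fun ab : R * R => RInt f ab.1 ab.2)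
    (filter_prod (at_right 0) (Rbar_locally p_infty)) (locally l).
  apply/(filterlim_locally_cauchy (F := filter_prod (at_right 0) (Rbar_locally p_infty))) => eps.
  have heps4 : 0 < eps / 4 by have := cond_pos eps; lra.
  case: (proj1 (@IposRP g L hg) hL _ heps4) => a0 [b0 [h0 H0]].
  exists (fun ab => 0 < ab.1 < a0 /\ b0 < ab.2); split.
    by apply/Ipos_filter; exists a0, b0; split.
  move=> [a b] [c d] /= [ha hb] [hc hd].
  apply: (norm_compat1 (RInt f a b)).
  (* Two intervals are compared through one that contains both, so that only nested estimates
     occur. *)
  pose m := Rmin a c; pose M := Rmax b d.
  have hm : 0 < m < a0 /\ m <= a /\ m <= c.
    have hm0 : 0 < m by apply: Rmin_pos; lra.
    by have := Rmin_l a c; have := Rmin_r a c; rewrite -/m; lra.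
  have hM : b0 < M /\ b <= M /\ d <= M.
    by have := Rmax_l b d; have := Rmax_r b d; rewrite -/M; lra.
  have e1 : norm (minus (RInt f m M) (RInt f a b)) <= RInt g m M - RInt g a b.
    by apply: norm_RInt_nested => //; lra.
  have e2 : norm (minus (RInt f m M) (RInt f c d)) <= RInt g m M - RInt g c d.
    by apply: norm_RInt_nested => //; lra.
  have k1 : Rabs (RInt g m M - L) < eps / 4 by apply: H0; lra.
  have k2 : Rabs (RInt g a b - L) < eps / 4 by apply: H0; lra.
  have k3 : Rabs (RInt g c d - L) < eps / 4 by apply: H0; lra.
  rewrite (minus_trans (RInt f m M)).
  apply: Rle_lt_trans (norm_triangle _ _) _.
  rewrite minus_norm_sym; move/Rabs_def2: k1 => ?; move/Rabs_def2: k2 => ?; move/Rabs_def2: k3 => ?; lra.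
exists l; move=> P hP; case/Ipos_filter: (hl P hP) => a0 [b0 [h0 h]].
apply/Ipos_filter; exists a0, b0; split=> // a b ha hb.
exists (RInt f a b); split; last exact: h.
by apply: RInt_correct; apply: ex_RInt_pos => //=; lra.
Qed.

End Domination.

(** A bounded linear map commutes with every Riemann sum and is continuous, hence passes to the
    limits. Functionals and resolvents are moved under the integral in this way. *)
Lemma Ipos_linear (V W : CompleteNormedModule R_AbsRing) (u : V -> W)
  (f : R -> V) l : is_linear u -> Ipos f l -> Ipos (fun x => u (f x)) (u l).
Proof.
move=> hu hf P hP.
have hloc : locally l (fun x => P (u x)) by exact: (linear_cont u l hu).
have [Q1 Q2 hQ1 hQ2 hQ] := hf _ hloc.
exists Q1 Q2 => // a b ha hb.
case: (hQ a b ha hb) => y [hy hPy]; exists (u y); split=> //=.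
have := filterlim_comp _ _ _ _ u _ _ _ hy (linear_cont u y hu).
apply: filterlim_ext => ptd.
rewrite (linear_scal _ hu); congr (scal _ _).
move: ptd; apply: SF_cons_ind => [x0|[x h] s IH].
  rewrite /Riemann_sum /=.
  by rewrite -(scal_zero_r (V := V) 0) (linear_scal _ hu) !scal_zero_l.
by rewrite !Riemann_sum_cons (linear_plus _ hu) (linear_scal _ hu) IH.
Qed.

Lemma Ipos_primitive (D f : R -> R) l0 l1 :
  (forall x, 0 < x -> is_derive D x (f x)) -> cont_pos f ->
  (forall eps, 0 < eps -> exists a0, 0 < a0 /\
     forall a, 0 < a < a0 -> Rabs (D a - l0) < eps) ->
  (forall eps, 0 < eps -> exists b0, forall b, b0 < b -> Rabs (D b - l1) < eps) ->
  Ipos f (l1 - l0).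
Proof.
move=> hD hf h0 h1; apply/IposRP => // eps heps.
have heps2 : 0 < eps / 2 by lra.
case: (h0 _ heps2) => a0 [ha0 ha]; case: (h1 _ heps2) => b0 hb.
exists a0, (Rmax (a0 + 1) b0); split.
  by have := Rmax_l (a0 + 1) b0; lra.
move=> a b haa hbb.
have hb' : a0 + 1 < b by have := Rmax_l (a0 + 1) b0; lra.
have -> : RInt f a b = D b - D a.
  apply: is_RInt_unique; apply: (is_RInt_derive D f) => x hx.
    by apply: hD; move: hx; rewrite Rmin_left; lra.
  by apply: hf; move: hx; rewrite Rmin_left; lra.
have /Rabs_def2 := ha a haa.
have /Rabs_def2 : Rabs (D b - l1) < eps / 2.
  by apply: hb; have := Rmax_r (a0 + 1) b0; lra.
move=> *; apply: Rabs_def1; lra.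
Qed.

(** * The dominating function and integrals known in closed form *)

(** The bound of N^0 with exponent [al], divided by [r]: up to constants this is the size of
    [(s - T)^{-1} v f(s)] at [|s| = r]. It is the derivative of [atan (r^al) / al]. *)
Definition dom (al r : R) : R := Rpower r al / (1 + Rpower r (2 * al)) / r.

Lemma Rpower_2 r al : Rpower r (2 * al) = Rpower r al * Rpower r al.
Proof. by rewrite -Rpower_plus; congr Rpower; ring. Qed.

Lemma Rpower_pos r al : 0 < Rpower r al. Proof. exact: exp_pos. Qed.

Lemma dom_pos al r : 0 < r -> 0 < dom al r.
Proof.
move=> hr; rewrite /dom; have h1 := Rpower_pos r al; have h2 := Rpower_pos r (2 * al).
by apply: Rdiv_lt_0_compat => //; apply: Rdiv_lt_0_compat => //; lra.
Qed.

Lemma is_derive_dom al r : 0 < al -> 0 < r ->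
  is_derive (fun r => atan (Rpower r al) / al) r (dom al r).
Proof.
move=> hal hr; rewrite /dom Rpower_2; have hp := Rpower_pos r al.
have h1 : 1 + Rpower r al * Rpower r al <> 0 by nra.
rewrite /Rpower; auto_derive; first by [].
rewrite -/(Rpower r al) /Rsqr; field; repeat split; lra || nra.
Qed.

Lemma cont_pos_dom al : cont_pos (dom al).
Proof.
move=> r hr; apply: (ex_derive_continuous (dom al)).
have hp := Rpower_pos r (2 * al).
rewrite /dom /Rpower; auto_derive; rewrite -?/(Rpower r (2 * al)); repeat split; lra.
Qed.

Lemma Rpower_root al x : 0 < al -> 0 < x -> Rpower (Rpower x (/ al)) al = x.
Proof. by move=> hal hx; rewrite Rpower_mult Rinv_l ?Rpower_1 //; lra. Qed.

Lemma Rpower_small al eps : 0 < al -> 0 < eps ->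
  exists a0, 0 < a0 /\ forall a, 0 < a < a0 -> Rpower a al < eps.
Proof.
move=> hal heps; exists (Rpower eps (/ al)); split; first exact: Rpower_pos.
by move=> a ha; rewrite -(Rpower_root hal heps); apply: Rlt_Rpower_l.
Qed.

Lemma Rpower_large al M : 0 < al -> 0 < M ->
  exists b0, 0 < b0 /\ forall b, b0 < b -> M < Rpower b al.
Proof.
move=> hal hM; exists (Rpower M (/ al)).
have h0 := Rpower_pos M (/ al); split=> // b hb.
by rewrite -{1}(Rpower_root hal hM); apply: Rlt_Rpower_l.
Qed.

Lemma atan_small eps : 0 < eps ->
  exists d, 0 < d /\ forall x, 0 < x < d -> Rabs (atan x) < eps.
Proof.
move=> heps.
have /continuity_pt_locally hc : continuity_pt atan 0.
  by apply: derivable_continuous_pt; exact: derivable_pt_atan.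
case: (hc (mkposreal _ heps)) => d hd; exists d; split; first exact: cond_pos.
move=> x hx; rewrite -(Rminus_0_r (atan x)) -atan_0; apply: hd.
by rewrite /ball /= /AbsRing_ball /abs /= /minus /plus /opp /= Rabs_pos_eq; lra.
Qed.

Lemma atan_large eps : 0 < eps ->
  exists M, 0 < M /\ forall x, M < x -> Rabs (atan x - PI / 2) < eps.
Proof.
move=> /atan_small [d [hd h]]; exists (/ d); split; first exact: Rinv_0_lt_compat.
move=> x hx; have hd' := Rinv_0_lt_compat _ hd; have hx0 : 0 < x by lra.
have : 0 < / x < d.
  split; first exact: Rinv_0_lt_compat.
  by rewrite -(Rinv_inv d); apply: Rinv_lt_contravar => //; exact: Rmult_lt_0_compat.
move=> /h; rewrite atan_inv // => h1.
by rewrite -Rabs_Ropp Ropp_minus_distr.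
Qed.

Lemma Ipos_dom al : 0 < al -> exists L, Ipos (dom al) L.
Proof.
move=> hal; exists (PI / 2 / al - 0).
apply: (Ipos_primitive (D := fun r => atan (Rpower r al) / al)).
- by move=> x hx; exact: is_derive_dom.
- exact: cont_pos_dom.
- move=> eps heps.
  have he : 0 < eps * al by exact: Rmult_lt_0_compat.
  have [d [hd h]] := atan_small he; have [a0 [ha0 h']] := Rpower_small hal hd.
  exists a0; split=> // a ha.
  rewrite Rminus_0_r /Rdiv Rabs_mult (Rabs_pos_eq (/ al)); last first.
    by apply: Rlt_le; exact: Rinv_0_lt_compat.
  apply/Rlt_div_l => //; apply: h; split; [exact: Rpower_pos|exact: h'].
- move=> eps heps.
  have he : 0 < eps * al by exact: Rmult_lt_0_compat.
  have [d [hd h]] := atan_large he; have [b0 [hb0 h']] := Rpower_large hal hd.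
  exists b0 => b hb.
  have -> : atan (Rpower b al) / al - PI / 2 / al = (atan (Rpower b al) - PI / 2) / al.
    by field; lra.
  rewrite /Rdiv Rabs_mult (Rabs_pos_eq (/ al)); last first.
    by apply: Rlt_le; exact: Rinv_0_lt_compat.
  by apply/Rlt_div_l => //; apply: h; exact: h'.
Qed.

(** The integral that a pole of modulus [rho] produces on the rays orthogonal to it; the [PI] of
    Cauchy's formula originates here. *)
Lemma Ipos_poisson rho : 0 < rho -> Ipos (fun r => rho / (r * r + rho * rho)) (PI / 2).
Proof.
move=> hrho; rewrite -(Rminus_0_r (PI / 2)).
apply: (Ipos_primitive (D := fun r => atan (r / rho))).
- move=> r hr; auto_derive; first by [].
  by rewrite /Rsqr; field; split; nra.
- move=> r hr; apply: (ex_derive_continuous (fun r => rho / (r * r + rho * rho))).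
  by auto_derive; nra.
- move=> eps /atan_small [d [hd h]]; exists (d * rho); split; first exact: Rmult_lt_0_compat.
  move=> a ha; rewrite Rminus_0_r; apply: h; split; first by apply: Rdiv_lt_0_compat; lra.
  by apply/Rlt_div_l => //; lra.
- move=> eps /atan_large [d [hd h]]; exists (d * rho) => b hb; apply: h.
  by apply/Rlt_div_r => //; lra.
Qed.

Lemma Ipos_subst_sqr (V : CompleteNormedModule R_AbsRing) (f : R -> V) l :
  cont_pos f -> Ipos (fun r => scal (2 * r) (f (r * r))) l -> Ipos f l.
Proof.
move=> hf; have hg : cont_pos (fun r => scal (2 * r) (f (r * r))).
  move=> r hr; apply: continuous_scal.
    by apply: (ex_derive_continuous (fun r => 2 * r)); auto_derive.
  apply: (continuous_comp (fun r => r * r) f); last by apply: hf; nra.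
  by apply: (ex_derive_continuous (fun r => r * r)); auto_derive.
move=> /(IposP _ hg) h; apply/(IposP _ hf) => eps /h [a0 [b0 [h0 H]]].
exists (a0 * a0), (b0 * b0); split; first nra.
move=> a b ha hb.
have ea := sqrt_sqrt a; have eb := sqrt_sqrt b.
have hb0 : 0 < b by nra.
have -> : RInt f a b = RInt (fun r => scal (2 * r) (f (r * r))) (sqrt a) (sqrt b).
  rewrite (RInt_comp f (fun r => r * r) (fun r => 2 * r)) ?ea ?eb //; try lra.
    move=> x hx; apply: hf.
    have hm : 0 < Rmin (sqrt a) (sqrt b).
      by apply: Rmin_pos; apply: sqrt_lt_R0; lra.
    nra.
  move=> x _; split; first by auto_derive => //; ring.
  by apply: (ex_derive_continuous (fun r => 2 * r)); auto_derive.
apply: H.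
  split; first by apply: sqrt_lt_R0; lra.
  by rewrite -(sqrt_square a0); [apply: sqrt_lt_1|]; lra.
by rewrite -(sqrt_square b0); [apply: sqrt_lt_1|]; try lra; nra.
Qed.

(** * Integrals with a parameter and Fubini's theorem *)

Lemma continuity_2d_section1 F x y : continuity_2d_pt F x y -> continuous (F x) y.
Proof.
move=> h; apply/continuity_pt_filterlim/continuity_pt_locally => eps.
case: (h eps) => d hd; exists d => v hv; apply: hd => //.
by rewrite Rminus_eq_0 Rabs_R0; exact: cond_pos.
Qed.

Lemma continuity_2d_section2 F x y :
  continuity_2d_pt F x y -> continuous (fun t => F t y) x.
Proof.
move=> h; apply/continuity_pt_filterlim/continuity_pt_locally => eps.
case: (h eps) => d hd; exists d => v hv; apply: hd => //.
by rewrite Rminus_eq_0 Rabs_R0; exact: cond_pos.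
Qed.

Lemma continuous_RInt_param_le (F : R -> R -> R) c d x : c <= d ->
  (exists del : posreal, forall u v, x - del <= u <= x + del -> c <= v <= d ->
     continuity_2d_pt F u v) ->
  continuous (fun u => RInt (F u) c d) x.
Proof.
move=> hcd [del hF].
apply/continuity_pt_filterlim/continuity_pt_locally => eps.
(* The summand 1 keeps the denominator positive when [c = d]. *)
have heps : 0 < eps / (d - c + 1).
  by apply: Rdiv_lt_0_compat; [exact: cond_pos|lra].
have [eta h] := uniform_continuity_2d F (x - del) (x + del) c d hF (mkposreal _ heps).
have hd := cond_pos del.
have hm : 0 < Rmin del eta by apply: Rmin_pos; apply: cond_pos.
exists (mkposreal _ hm) => u hu.
have {}hu : Rabs (u - x) < Rmin del eta by exact: hu.
have hu1 := Rlt_le_trans _ _ _ hu (Rmin_l _ _).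
have hu2 := Rlt_le_trans _ _ _ hu (Rmin_r _ _).
have hu3 := Rabs_def2 _ _ hu1.
have hex w : x - del <= w <= x + del -> ex_RInt (F w) c d.
  move=> hw; apply: (ex_RInt_continuous (V := R_CompleteNormedModule)) => v.
  rewrite Rmin_left // Rmax_right // => hv.
  by apply: continuity_2d_section1; exact: hF.
have -> : RInt (F u) c d - RInt (F x) c d = RInt (fun v => minus (F u v) (F x v)) c d.
  by symmetry; apply: (RInt_minus (V := R_CompleteNormedModule)); apply: hex; lra.
have : Rabs (RInt (fun v => minus (F u v) (F x v)) c d) <= (d - c) * (eps / (d - c + 1)).
  apply: (norm_RInt_le_const (V := R_NormedModule) (fun v => minus (F u v) (F x v)) c d) => //.
    move=> v hv; apply: Rlt_le; apply: (h x v u v) => //; try lra.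
    by rewrite Rminus_eq_0 Rabs_R0; exact: cond_pos.
  apply: (RInt_correct (V := R_CompleteNormedModule)).
  by apply: (ex_RInt_minus (V := R_CompleteNormedModule)); apply: hex; lra.
move=> h1; apply: Rle_lt_trans h1 _.
have -> : (d - c) * (eps / (d - c + 1)) = (d - c) * eps / (d - c + 1) by rewrite /Rdiv; ring.
apply/Rlt_div_l; first lra.
have := cond_pos eps; nra.
Qed.

Lemma continuous_RInt_param (F : R -> R -> R) c d x (del : posreal) :
  (forall u v, x - del <= u <= x + del -> Rmin c d <= v <= Rmax c d ->
     continuity_2d_pt F u v) ->
  continuous (fun u => RInt (F u) c d) x.
Proof.
case: (Rle_dec c d) => hcd.
  rewrite Rmin_left // Rmax_right // => hF.
  by apply: continuous_RInt_param_le => //; exists del.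
rewrite Rmin_right; last lra.
rewrite Rmax_left; last lra.
move=> hF; apply: (continuous_ext_loc (T := R_UniformSpace) (U := R_UniformSpace) _ (fun u => opp (RInt (F u) d c))).
  exists del => u /= /Rabs_def2 hu; apply: opp_RInt_swap.
  apply: (ex_RInt_continuous (V := R_CompleteNormedModule)) => v.
  rewrite Rmin_left ?Rmax_right; try lra.
  move=> hv; apply: continuity_2d_section1; apply: hF => //.
  by move: hu; rewrite /minus /plus /opp /=; lra.
apply: (continuous_opp (V := R_NormedModule)).
by apply: continuous_RInt_param_le; [lra|exists del].
Qed.

Lemma continuity_2d_pt_swap F x y :
  continuity_2d_pt F x y -> continuity_2d_pt (fun u v => F v u) y x.
Proof. by move=> H e; have [e' h] := H e; exists e' => p q hp hq; exact: h. Qed.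

(** As functions of the upper limit [b] both iterated integrals have the derivative
    [RInt (F b) c d], and both vanish for [b = a]. *)
Lemma Fubini_rect (F : R -> R -> R) a b c d : 0 < a <= b -> 0 < c <= d ->
  (forall x y, 0 < x -> 0 < y -> continuity_2d_pt F x y) ->
  RInt (fun x => RInt (F x) c d) a b = RInt (fun y => RInt (fun x => F x y) a b) c d.
Proof.
move=> hab hcd hF.
have cI : cont_pos (fun x => RInt (F x) c d).
  move=> x hx; have hx2 : 0 < x / 2 by lra.
  apply: (@continuous_RInt_param _ _ _ _ (mkposreal _ hx2)) => u v /=.
  by rewrite Rmin_left; try lra; move=> hu hv; apply: hF; lra.
have exF y : 0 < y -> cont_pos (fun x => F x y).
  by move=> hy x hx; apply: continuity_2d_section2; exact: hF.
pose D t := RInt (fun x => RInt (F x) c d) a t - RInt (fun y => RInt (fun x => F x y) a t) c d.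
suff : D b - D a = 0.
  rewrite /D !RInt_point /=.
  have -> : RInt (fun y => RInt (fun x => F x y) a a) c d = 0.
    rewrite (RInt_ext _ (fun _ => 0)).
      by rewrite RInt_const scal_zero_r.
    by move=> y _; rewrite RInt_point.
  by rewrite /zero /=; lra.
have hD x : 0 < x -> is_derive D x 0.
  move=> hx.
  have hloc : locally x (fun t => 0 < t).
    exact: (open_gt 0 x hx).
  have -> : 0 = minus (RInt (F x) c d) (RInt (F x) c d) by rewrite minus_eq_zero.
  apply: (is_derive_minus (V := R_NormedModule) (fun t => RInt (fun x => RInt (F x) c d) a t)
    (fun t => RInt (fun y => RInt (fun x => F x y) a t) c d)).
    apply: (is_derive_RInt (V := R_NormedModule) (fun x => RInt (F x) c d) _ a); last exact: cI.
    apply: filter_imp hloc => t ht.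
    by apply: (RInt_correct (V := R_CompleteNormedModule)); apply: ex_RInt_pos => //; lra.
  have dF t y : 0 < t -> 0 < y -> is_derive (fun t => RInt (fun x => F x y) a t) t (F t y).
    move=> ht hy; apply: (is_derive_RInt (V := R_NormedModule) (fun x => F x y) _ a).
      have hloc' : locally t (fun t => 0 < t) by exact: (open_gt 0 t ht).
      apply: filter_imp hloc' => s hs.
      by apply: (RInt_correct (V := R_CompleteNormedModule)); apply: ex_RInt_pos => //; [exact: exF|lra].
    exact: exF.
  have key := is_derive_RInt_param (fun t y => RInt (fun x => F x y) a t) c d x.
  have E : RInt (fun t => Derive (fun s => RInt (fun x0 => F x0 t) a s) x) c d = RInt (F x) c d.
    apply: RInt_ext => y; rewrite Rmin_left ?Rmax_right; try lra.
    by move=> hy; apply: is_derive_unique; apply: dF => //; lra.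
  rewrite -E; apply: key.
  - apply: filter_imp hloc => t ht y; rewrite Rmin_left; last lra.
    by move=> hy; exists (F t y); apply: dF => //; lra.
  - move=> y; rewrite Rmin_left; last lra.
    move=> hy; apply: (continuity_2d_pt_ext_loc F).
      have hxy : 0 < Rmin x y by apply: Rmin_pos; lra.
      exists (mkposreal _ hxy) => u v /= /Rabs_def2 hu /Rabs_def2 hv.
      symmetry; apply: is_derive_unique; apply: dF.
        by have := Rmin_l x y; lra.
      by have := Rmin_r x y; lra.
    by apply: hF => //; lra.
  - apply: filter_imp hloc => t ht.
    apply: ex_RInt_pos; try lra.
    move=> y hy; have hy2 : 0 < y / 2 by lra.
    apply: (@continuous_RInt_param (fun y x => F x y) _ _ _ (mkposreal _ hy2)) => u v /= hu hv.
    apply: continuity_2d_pt_swap; apply: hF; last lra.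
    by apply: Rlt_le_trans (proj1 hv); apply: Rmin_pos; lra.
have h1 z : Rmin a b <= z <= Rmax a b -> is_derive D z 0.
  by rewrite Rmin_left; [move=> hz; apply: hD; lra|lra].
have [|z hz|z [_ ->]] := MVT_gen D a b (fun _ => 0); last by ring.
  by move=> z hz; apply: h1; lra.
apply: derivable_continuous_pt; exists 0; apply/is_derive_Reals; exact: h1.
Qed.

Lemma Ipos_mult (f : R -> R) (k l : R) :
  Ipos f l -> Ipos (fun x => k * f x) (k * l).
Proof. exact: (@is_RInt_gen_scal R_NormedModule). Qed.

Lemma RInt_le_Ipos (A : R -> R) (LA a b : R) : cont_pos A ->
  (forall x, 0 < x -> 0 <= A x) -> Ipos A LA -> 0 < a <= b -> RInt A a b <= LA.
Proof.
move=> cA A0 iA hab.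
have := @Ipos_tail R_CompleteNormedModule A A LA LA a b cA cA _ iA iA hab.
have H x : 0 < x -> norm (A x) <= A x.
  by move=> hx; rewrite /norm /= /abs /= Rabs_pos_eq; [lra|exact: A0].
move=> /(_ H); have := norm_ge_0 (V := R_NormedModule) (minus LA (RInt A a b)).
move=> h1 h2; have := Rle_trans _ _ _ h1 h2; lra.
Qed.

(** For fixed [x] the truncation of the inner integral costs at most [A x] times the tail of [B];
    this is then integrated over [x]. *)
Lemma Fubini_tail (F : R -> R -> R) (A B G : R -> R) (LA LB a b c d : R) :
  (forall x y, 0 < x -> 0 < y -> continuity_2d_pt F x y) ->
  cont_pos A -> cont_pos B -> cont_pos G ->
  (forall x, 0 < x -> 0 <= A x) -> (forall x, 0 < x -> 0 <= B x) ->
  (forall x y, 0 < x -> 0 < y -> Rabs (F x y) <= A x * B y) ->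
  Ipos A LA -> Ipos B LB -> (forall x, 0 < x -> Ipos (F x) (G x)) ->
  0 < a <= b -> 0 < c <= d ->
  Rabs (RInt G a b - RInt (fun x => RInt (F x) c d) a b) <= LA * (LB - RInt B c d).
Proof.
move=> cF cA cB cG A0 B0 hF iA iB iG hab hcd.
set k := LB - _.
have hk : 0 <= k by rewrite /k; have := RInt_le_Ipos cB B0 iB hcd; lra.
have hA := RInt_le_Ipos cA A0 iA hab.
have cI : cont_pos (fun x => RInt (F x) c d).
  move=> x hx; have hx2 : 0 < x / 2 by lra.
  apply: (@continuous_RInt_param _ _ _ _ (mkposreal _ hx2)) => u v /=.
  by rewrite Rmin_left; try lra; move=> hu hv; apply: cF; lra.
have pt x : 0 < x -> Rabs (G x - RInt (F x) c d) <= A x * k.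
  move=> hx; rewrite /k Rmult_minus_distr_l.
  have <- : RInt (fun y => A x * B y) c d = A x * RInt B c d.
    by apply: (RInt_scal (V := R_CompleteNormedModule)); apply: ex_RInt_pos => //; lra.
  apply: (@Ipos_tail R_CompleteNormedModule (F x) (fun y => A x * B y)) => //.
  - by move=> y hy; apply: continuity_2d_section1; exact: cF.
  - by move=> y hy; apply: (continuous_mult (K := R_AbsRing)); [exact: continuous_const|exact: cB].
  - by move=> y hy; exact: hF.
  - exact: iG.
  - exact: Ipos_mult.
apply: (Rle_trans _ (RInt A a b * k)); last nra.
have -> : RInt G a b - RInt (fun x => RInt (F x) c d) a b =
  RInt (fun x => minus (G x) (RInt (F x) c d)) a b.
  by symmetry; apply: (RInt_minus (V := R_CompleteNormedModule)); apply: ex_RInt_pos => //; lra.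
apply: (norm_RInt_le (V := R_NormedModule)
  (fun x => minus (G x) (RInt (F x) c d)) (fun x => A x * k) a b).
- lra.
- by move=> x hx; apply: pt; lra.
- apply: (RInt_correct (V := R_CompleteNormedModule)).
  apply: ex_RInt_pos; try lra.
  by move=> x hx; apply: (continuous_minus (V := R_NormedModule)); [exact: cG|exact: cI].
- have -> : RInt A a b * k = scal k (RInt A a b) by rewrite /scal /= /mult /= Rmult_comm.
  apply: (is_RInt_ext (V := R_NormedModule) (fun x => scal k (A x))).
    by move=> x _; rewrite /scal /= /mult /= Rmult_comm.
  apply: (is_RInt_scal (V := R_NormedModule)).
  by apply: (RInt_correct (V := R_CompleteNormedModule)); apply: ex_RInt_pos => //; lra.
Qed.

Lemma Ipos_approx2 (f g : R -> R) (l m e1 e2 : R) : cont_pos f -> cont_pos g ->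
  Ipos f l -> Ipos g m -> 0 < e1 -> 0 < e2 ->
  exists a b, 0 < a <= b /\ Rabs (RInt f a b - l) < e1 /\ Rabs (RInt g a b - m) < e2.
Proof.
move=> cf cg /(IposRP _ cf) If /(IposRP _ cg) Ig he1 he2.
have [a1 [b1 [h1 H1]]] := If _ he1; have [a2 [b2 [h2 H2]]] := Ig _ he2.
have hm : 0 < Rmin a1 a2 by apply: Rmin_pos; lra.
have := Rmin_l a1 a2; have := Rmin_r a1 a2; have := Rmax_l b1 b2; have := Rmax_r b1 b2.
move=> *; exists (Rmin a1 a2 / 2), (Rmax b1 b2 + 1).
by repeat split; try lra; [apply: H1|apply: H2]; lra.
Qed.

(** A dominating function of product form makes the truncation errors of both iterated integrals
    small on one common rectangle, where the theorem on rectangles applies. *)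
Lemma Fubini_pos (F : R -> R -> R) (A B G H : R -> R) (LA LB L M : R) :
  (forall x y, 0 < x -> 0 < y -> continuity_2d_pt F x y) ->
  cont_pos A -> cont_pos B -> cont_pos G -> cont_pos H ->
  (forall x, 0 < x -> 0 <= A x) -> (forall x, 0 < x -> 0 <= B x) ->
  (forall x y, 0 < x -> 0 < y -> Rabs (F x y) <= A x * B y) ->
  Ipos A LA -> Ipos B LB ->
  (forall x, 0 < x -> Ipos (F x) (G x)) ->
  (forall y, 0 < y -> Ipos (fun x => F x y) (H y)) ->
  Ipos G L -> Ipos H M -> L = M.
Proof.
move=> cF cA cB cG cH A0 B0 hF iA iB iG iH iL iM.
have pos (f : R -> R) (l : R) : cont_pos f -> (forall x, 0 < x -> 0 <= f x) -> Ipos f l -> 0 <= l.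
  move=> cf f0 If; have h12 : 0 < 1 <= 2 by lra.
  apply: Rle_trans (RInt_le_Ipos cf f0 If h12).
  apply: RInt_ge_0; [lra|apply: ex_RInt_pos => //; lra|].
  by move=> x hx; apply: f0; lra.
have LA0 := pos _ _ cA A0 iA; have LB0 := pos _ _ cB B0 iB.
apply: cond_eq => eps heps.
have he4 : 0 < eps / 4 by lra.
(* With this choice [LA * e1] and [LB * e1] are at most [eps / 4]. Four errors of that size separate
   [L] from [M]: the outer and the inner truncation, in each order of integration. *)
pose e1 := eps / 4 / (1 + LA + LB).
have he1 : 0 < e1 by apply: Rdiv_lt_0_compat; lra.
have e1E : e1 * (1 + LA + LB) = eps / 4 by rewrite /e1; field; lra.
have [a [b [hab [h1 h2]]]] := Ipos_approx2 cG cA iL iA he4 he1.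
have [c [d [hcd [h3 h4]]]] := Ipos_approx2 cH cB iM iB he4 he1.
have h5 := Fubini_tail cF cA cB cG A0 B0 hF iA iB iG hab hcd.
have cF' y x : 0 < y -> 0 < x -> continuity_2d_pt (fun y x => F x y) y x.
  by move=> hy hx; apply: continuity_2d_pt_swap; exact: cF.
have hF' y x : 0 < y -> 0 < x -> Rabs (F x y) <= B y * A x.
  by move=> hy hx; rewrite Rmult_comm; exact: hF.
have h6 := Fubini_tail cF' cB cA cH B0 A0 hF' iB iA iH hcd hab.
rewrite -(Fubini_rect hab hcd cF) in h6.
move/Rabs_def2: h1 => h1; move/Rabs_def2: h2 => h2.
move/Rabs_def2: h3 => h3; move/Rabs_def2: h4 => h4.
have h7 : LA * (LB - RInt B c d) <= eps / 4 by nra.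
have h8 : LB * (LA - RInt A a b) <= eps / 4 by nra.
move/Rabs_le_between: h5 => h5; move/Rabs_le_between: h6 => h6.
apply: Rabs_def1; lra.
Qed.

(** * Holomorphic functions *)

Section ComplexContinuity.
Variable U : UniformSpace.
Implicit Types (f g : U -> C) (x : U).

Lemma cC_pair f x : continuous (fun y => Re (f y)) x ->
  continuous (fun y => Im (f y)) x -> continuous f x.
Proof.
move=> h1 h2; apply: (continuous_ext (fun y => (Re (f y), Im (f y)))).
  by move=> y; case: (f y).
move=> P [eps hP].
have e1 : locally x (fun y => ball (Re (f x)) eps (Re (f y))) := h1 _ (locally_ball (Re (f x)) eps).
have e2 : locally x (fun y => ball (Im (f x)) eps (Im (f y))) := h2 _ (locally_ball (Im (f x)) eps).
change (locally x (fun y => P (Re (f y), Im (f y)))).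
apply: filter_imp (filter_and _ _ e1 e2) => y [y1 y2].
by apply: hP; split.
Qed.

Lemma cC_Re f x : continuous f x -> continuous (fun y => Re (f y)) x.
Proof.
move=> h; apply: (continuous_comp f (fun c : C => Re c) x h).
by case: (f x) => a b; exact: (continuous_fst (U := R_UniformSpace) (V := R_UniformSpace)).
Qed.

Lemma cC_Im f x : continuous f x -> continuous (fun y => Im (f y)) x.
Proof.
move=> h; apply: (continuous_comp f (fun c : C => Im c) x h).
by case: (f x) => a b; exact: (continuous_snd (U := R_UniformSpace) (V := R_UniformSpace)).
Qed.

Lemma cR_plus (f g : U -> R) x : continuous f x -> continuous g x ->
  continuous (fun y => f y + g y) x.
Proof. exact: (@continuous_plus U R_AbsRing R_NormedModule). Qed.

Lemma cR_opp (f : U -> R) x : continuous f x -> continuous (fun y => - f y) x.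
Proof. exact: (@continuous_opp U R_AbsRing R_NormedModule). Qed.

Lemma cR_minus (f g : U -> R) x : continuous f x -> continuous g x ->
  continuous (fun y => f y - g y) x.
Proof. exact: (@continuous_minus U R_AbsRing R_NormedModule). Qed.

Lemma cR_mult (f g : U -> R) x : continuous f x -> continuous g x ->
  continuous (fun y => f y * g y) x.
Proof. exact: (@continuous_mult U R_AbsRing). Qed.

Lemma cR_inv (f : U -> R) x : continuous f x -> f x <> 0 ->
  continuous (fun y => / f y) x.
Proof. by move=> hf h0; apply: (continuous_comp f Rinv x hf); exact: continuous_Rinv. Qed.

Lemma cC_plus f g x : continuous f x -> continuous g x ->
  continuous (fun y => (f y + g y)%C) x.
Proof.
move=> hf hg; apply: cC_pair => /=; apply: cR_plus; try exact: cC_Re; exact: cC_Im.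
Qed.

Lemma cC_opp f x : continuous f x -> continuous (fun y => (- f y)%C) x.
Proof. by move=> hf; apply: cC_pair => /=; apply: cR_opp; [exact: cC_Re|exact: cC_Im]. Qed.

Lemma cC_minus f g x : continuous f x -> continuous g x ->
  continuous (fun y => (f y - g y)%C) x.
Proof. by move=> hf hg; apply: cC_plus => //; exact: cC_opp. Qed.

Lemma cC_mult f g x : continuous f x -> continuous g x ->
  continuous (fun y => (f y * g y)%C) x.
Proof.
move=> hf hg; have := (cC_Re hf, cC_Im hf, cC_Re hg, cC_Im hg).
move=> [[[h1 h2] h3] h4].
by apply: cC_pair => /=; [apply: cR_minus|apply: cR_plus]; exact: cR_mult.
Qed.

Lemma cC_inv f x : continuous f x -> f x <> 0%C -> continuous (fun y => (/ f y)%C) x.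
Proof.
move=> hf h0; have [h1 h2] := (cC_Re hf, cC_Im hf).
have hn : Re (f x) ^ 2 + Im (f x) ^ 2 <> 0.
  move=> h; apply: h0; move: h; case: (f x) => a b /= h.
  by apply: injective_projections => /=; nra.
have hden : continuous (fun y => / (Re (f y) ^ 2 + Im (f y) ^ 2)) x.
  by apply: cR_inv => //; apply: cR_plus => /=; repeat (apply: cR_mult || exact: continuous_const) => //.
apply: cC_pair => /=; rewrite /Rdiv; apply: cR_mult => //.
exact: cR_opp.
Qed.

Lemma cC_const (c : C) x : continuous (fun _ : U => c) x.
Proof. exact: continuous_const. Qed.

End ComplexContinuity.

Ltac fixC := repeat match goal with w : UniformSpace.sort C_UniformSpace |- _ => change C in w end.
Ltac Cring := fixC; match goal with |- @eq _ ?a ?b => change (@eq C a b); ring end.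
Ltac Cfield := fixC; match goal with |- @eq _ ?a ?b => change (@eq C a b); field end.

(** Caratheodory's form of complex differentiability: [k] is the difference quotient, extended
    continuously to [z]. The rules of differentiation need no estimates in this form, and [k] itself
    later removes the singularity of a quotient. *)
Definition hol (h : C -> C) (z d : C) : Prop :=
  exists k : C -> C, [/\ continuous k z, k z = d &
    locally z (fun w => h w = (h z + k w * (w - z))%C)].

Section Holomorphic.
Implicit Types (f g h : C -> C) (z w d e : C).

Lemma hol_const c z : hol (fun _ => c) z 0%C.
Proof. by exists (fun _ => 0%C); split=> //; [exact: cC_const|apply: filter_forall => w; Cring]. Qed.

Lemma hol_id z : hol (fun w => w) z 1%C.
Proof. by exists (fun _ => 1%C); split=> //; [exact: cC_const|apply: filter_forall => w; Cring]. Qed.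

Lemma hol_ext_loc f g z d : locally z (fun w => f w = g w) -> hol f z d -> hol g z d.
Proof.
move=> e [k [ck kz h]]; exists k; split=> //.
have ez := locally_singleton _ _ e.
apply: filter_imp (filter_and _ _ e h) => w [<- ->].
by rewrite ez.
Qed.

Lemma hol_cont f z d : hol f z d -> continuous f z.
Proof.
move=> [k [ck kz h]].
apply: (continuous_ext_loc _ (fun w => (f z + k w * (w - z))%C)).
  by apply: filter_imp h => w ->.
apply: cC_plus; first exact: cC_const.
by apply: cC_mult => //; apply: cC_minus; [exact: continuous_id|exact: cC_const].
Qed.

Lemma hol_plus f g z d e : hol f z d -> hol g z e -> hol (fun w => (f w + g w)%C) z (d + e)%C.
Proof.
move=> [k [ck <- h]] [k' [ck' <- h']]; exists (fun w => (k w + k' w)%C); split=> //.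
  exact: cC_plus.
apply: filter_imp (filter_and _ _ h h') => w [-> ->]; Cring.
Qed.

Lemma hol_mult f g z d e : hol f z d -> hol g z e ->
  hol (fun w => (f w * g w)%C) z (d * g z + f z * e)%C.
Proof.
move=> hf hg; have cg := hol_cont hg; move: hf hg.
move=> [k [ck <- h]] [k' [ck' <- h']]; exists (fun w => (k w * g w + f z * k' w)%C); split=> //.
  by apply: cC_plus; apply: cC_mult => //; exact: cC_const.
apply: filter_imp (filter_and _ _ h h') => w [-> ->]; Cring.
Qed.

Lemma continuous_neq0 (U : UniformSpace) (f : U -> C) x :
  continuous f x -> f x <> 0%C -> locally x (fun y => f y <> 0%C).
Proof.
move=> hf h0.
have hn : Re (f x) <> 0 \/ Im (f x) <> 0.
  case: (Req_dec (Re (f x)) 0); case: (Req_dec (Im (f x)) 0); try by [left|right].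
  by move=> h1 h2; case: h0; move: h1 h2; case: (f x) => a b /= -> ->.
case: hn => hn.
  have h : locally x (fun y => Re (f y) <> 0) := cC_Re hf (open_neq 0 _ hn).
  apply: filter_imp h => y hy e; apply: hy.
  by rewrite e.
have h : locally x (fun y => Im (f y) <> 0) := cC_Im hf (open_neq 0 _ hn).
apply: filter_imp h => y hy e; apply: hy.
by rewrite e.
Qed.

Lemma hol_inv f z d : hol f z d -> f z <> 0%C ->
  hol (fun w => (/ f w)%C) z (- d / (f z * f z))%C.
Proof.
move=> hf h0; have cf := hol_cont hf; have n0 := continuous_neq0 cf h0; move: hf.
move=> [k [ck <- h]]; exists (fun w => (- k w * / (f w * f z))%C); split=> //.
  apply: cC_mult; first exact: cC_opp.
  apply: cC_inv; last exact: Cmult_neq_0.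
  by apply: cC_mult => //; exact: cC_const.
apply: filter_imp (filter_and _ _ n0 h) => w [nw e].
have -> : (- k w * / (f w * f z) * (w - z) = - (k w * (w - z)) * / (f w * f z))%C by Cring.
have -> : (k w * (w - z) = f w - f z)%C by rewrite e; Cring.
by Cfield; split.
Qed.

Lemma hol_comp f g z d e : hol f z d -> hol g (f z) e -> hol (fun w => g (f w)) z (e * d)%C.
Proof.
move=> hf; have cf := hol_cont hf; move: hf.
move=> [k [ck <- h]] [k' [ck' <- h']]; exists (fun w => (k' (f w) * k w)%C); split=> //.
  by apply: cC_mult => //; exact: continuous_comp.
have h2 : locally z (fun w => g (f w) = (g (f z) + k' (f w) * (f w - f z))%C) := cf _ h'.
apply: filter_imp (filter_and _ _ h h2) => w [e1 ->].
have -> : (k' (f w) * k w * (w - z) = k' (f w) * (k w * (w - z)))%C by Cring.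
by rewrite {2}e1; Cring.
Qed.

End Holomorphic.

Lemma cC_comp (U : UniformSpace) (f : U -> C) (h : C -> C) (x : U) :
  continuous f x -> continuous h (f x) -> continuous (fun y => h (f y)) x.
Proof. exact: (continuous_comp (U := U) (V := C_UniformSpace) (W := C_UniformSpace)). Qed.

Lemma is_derive_slope (g : R -> R) (t l : R) :
  is_derive g t l <-> exists k : R -> R, [/\ continuous k t, k t = l &
    locally t (fun s => g s = g t + k s * (s - t))].
Proof.
split.
- move/is_derive_Reals => h.
  exists (fun s => if Req_EM_T s t then l else (g s - g t) / (s - t)); split.
  + apply/continuity_pt_filterlim/continuity_pt_locally => eps.
    have [d hd] := h eps (cond_pos eps); exists d => s hs.
    destruct (Req_EM_T t t) as [e0|e0] => //; destruct (Req_EM_T s t) as [e|ne].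
      by rewrite /= /Rminus Rplus_opp_r Rabs_R0; exact: cond_pos.
    have hs0 : s - t <> 0 by lra.
    have := hd (s - t) hs0 hs.
    by have -> : t + (s - t) = s by ring.
  + by destruct (Req_EM_T t t).
  + apply: filter_forall => s; destruct (Req_EM_T s t) as [->|ne] => /=; first by ring.
    by field; lra.
- move=> [k [ck kt h]]; apply/is_derive_Reals => eps heps.
  move/continuity_pt_filterlim/continuity_pt_locally: ck => ck.
  have [d hd] := ck (mkposreal _ heps).
  have [d' hd'] := h.
  have hm : 0 < Rmin d d' by apply: Rmin_pos; exact: cond_pos.
  exists (mkposreal _ hm) => u hu0 /= hu.
  have h1 : Rabs u < d by apply: Rlt_le_trans hu _; exact: Rmin_l.
  have h2 : Rabs u < d' by apply: Rlt_le_trans hu _; exact: Rmin_r.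
  have e : t + u - t = u by ring.
  have -> : g (t + u) = g t + k (t + u) * (t + u - t).
    by apply: hd'; rewrite /ball /= /AbsRing_ball /abs /= /minus /plus /opp /= -/(Rminus _ _) e.
  have -> : (g t + k (t + u) * (t + u - t) - g t) / u - l = k (t + u) - k t.
    by rewrite e kt; field.
  by apply: hd; rewrite /ball /= /AbsRing_ball /abs /= /minus /plus /opp /= -/(Rminus _ _) e.
Qed.

(** * Polar coordinates and differentiation along curves *)

Definition cis (t : R) : C := (cos t, sin t).
Definition polar (r t : R) : C := (r * cos t, r * sin t).

Lemma polarE r t : polar r t = (RtoC r * cis t)%C.
Proof. by rewrite /polar /cis /RtoC /Cmult /=; congr pair; ring. Qed.

Lemma curve_slope (g : R -> C) (t : R) (c : C) :
  is_derive (fun s => Re (g s)) t (Re c) -> is_derive (fun s => Im (g s)) t (Im c) ->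
  exists k : R -> C, [/\ continuous k t, k t = c &
    locally t (fun s => g s = (g t + k s * RtoC (s - t))%C)].
Proof.
move=> /is_derive_slope [k1 [c1 e1 h1]] /is_derive_slope [k2 [c2 e2 h2]].
exists (fun s => (k1 s, k2 s)); split.
- exact: cC_pair.
- by rewrite e1 e2; case: (c).
- apply: filter_imp (filter_and _ _ h1 h2) => s [].
  case: (g s) => a b; case: (g t) => a' b' /= -> ->.
  by rewrite /Cplus /Cmult /RtoC /=; congr pair; ring.
Qed.

Lemma hol_curve (h : C -> C) (d : C) (g : R -> C) (t : R) (c : C) :
  hol h (g t) d ->
  is_derive (fun s => Re (g s)) t (Re c) -> is_derive (fun s => Im (g s)) t (Im c) ->
  is_derive (fun s => Re (h (g s))) t (Re (d * c)%C) /\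
  is_derive (fun s => Im (h (g s))) t (Im (d * c)%C).
Proof.
move=> [m [cm em hm]] d1 d2; have [k [ck ek hk]] := curve_slope d1 d2.
have cg : continuous g t.
  apply: cC_pair; apply: (ex_derive_continuous (fun s => _ (g s))).
    by exists (Re c).
  by exists (Im c).
have hloc : locally t (fun s => h (g s) = (h (g t) + m (g s) * k s * RtoC (s - t))%C).
  have hm' : locally t (fun s => h (g s) = (h (g t) + m (g s) * (g s - g t))%C) := cg _ hm.
  apply: filter_imp (filter_and _ _ hm' hk) => s [-> e].
  rewrite {2}e; ring.
have cmk : continuous (fun s => (m (g s) * k s)%C) t.
  by apply: cC_mult => //; apply: cC_comp.
split; apply/is_derive_slope.
- exists (fun s => Re (m (g s) * k s)%C); split; first exact: (cC_Re cmk).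
    by rewrite em ek.
  by apply: filter_imp hloc => s ->; rewrite /Re /Im /Cplus /Cmult /RtoC /=; ring.
- exists (fun s => Im (m (g s) * k s)%C); split; first exact: (cC_Im cmk).
    by rewrite em ek.
  by apply: filter_imp hloc => s ->; rewrite /Re /Im /Cplus /Cmult /RtoC /=; ring.
Qed.

Lemma continuous_polar (r t : R) :
  continuous (fun p : R * R => polar p.1 p.2) (r, t).
Proof.
have c1 : continuous (fun p : R * R => p.1) (r, t).
  exact: (continuous_fst (U := R_UniformSpace) (V := R_UniformSpace)).
have c2 : continuous (fun p : R * R => p.2) (r, t).
  exact: (continuous_snd (U := R_UniformSpace) (V := R_UniformSpace)).
apply: cC_pair => /=; apply: cR_mult => //.
  by apply: (continuous_comp (fun p : R * R => p.2) cos) => //; exact: continuous_cos.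
by apply: (continuous_comp (fun p : R * R => p.2) sin) => //; exact: continuous_sin.
Qed.

Lemma polar_cont2 (h : C -> C) (r t : R) : continuous h (polar r t) ->
  continuity_2d_pt (fun r t => Re (h (polar r t))) r t.
Proof.
move=> ch; apply/continuity_2d_pt_filterlim.
have H : continuous (fun p : R * R => h (polar p.1 p.2)) (r, t).
  by apply: (cC_comp (f := fun p : R * R => polar p.1 p.2)) => //; exact: continuous_polar.
exact (cC_Re H).
Qed.

Lemma is_derive_polar_r r t :
  is_derive (fun r => Re (polar r t)) r (Re (cis t)) /\
  is_derive (fun r => Im (polar r t)) r (Im (cis t)).
Proof. by split=> /=; auto_derive => //; ring. Qed.

Lemma is_derive_polar_t r t :
  is_derive (fun t => Re (polar r t)) t (Re (Ci * polar r t)%C) /\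
  is_derive (fun t => Im (polar r t)) t (Im (Ci * polar r t)%C).
Proof. by split=> /=; auto_derive => //; ring. Qed.

(* Green's theorem in polar coordinates: r -> int_a^b Re (i z h(z)) dt, z = r e^{it}, has
   derivative Re (h(r e^{ib}) e^{ib} - h(r e^{ia}) e^{ia}); on the exceptional radius rho only
   continuity is needed, by the mean value theorem. *)
Lemma polar_cauchy_Re (h d : C -> C) (lo hi a b rho : R) :
  lo < a < hi -> lo < b < hi ->
  (forall r t, 0 < r -> lo < t < hi -> continuous h (polar r t)) ->
  (forall r t, 0 < r -> r <> rho -> lo < t < hi ->
     hol h (polar r t) (d (polar r t)) /\ continuous d (polar r t)) ->
  forall x y, 0 < x <= y ->
  RInt (fun r => Re (h (polar r b) * cis b - h (polar r a) * cis a)%C) x y =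
  RInt (fun t => Re (Ci * polar y t * h (polar y t))%C) a b -
  RInt (fun t => Re (Ci * polar x t * h (polar x t))%C) a b.
Proof.
move=> ha hb hc hd.
have hab t : Rmin a b <= t <= Rmax a b -> lo < t < hi.
  by rewrite /Rmin /Rmax; case: Rle_dec; lra.
set B := fun r => Re _.
set P := fun r t => Re (Ci * polar r t * h (polar r t))%C.
(* This is both the [r]-derivative of [P] and, by holomorphy, the [t]-derivative of
   [Re (h(z) cis t)] at [z = polar r t]; the coincidence of the two is the whole content of the
   theorem. *)
pose D r t := Re (Ci * cis t * (h (polar r t) + polar r t * d (polar r t)))%C.
have cPid (U : UniformSpace) (f : U -> C) z : continuous f z -> continuous (fun y => (Ci * f y)%C) z.
  by move=> cf; apply: cC_mult => //; exact: cC_const.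
have cis_c t : continuous cis t.
  by apply: cC_pair => /=; [exact: continuous_cos|exact: continuous_sin].
have cP r t : 0 < r -> lo < t < hi -> continuity_2d_pt P r t.
  move=> hr ht; apply: (polar_cont2 (h := fun z => (Ci * z * h z)%C)).
  by apply: cC_mult; [apply: cPid; exact: continuous_id|exact: hc].
have cB : cont_pos B.
  have c1 c : lo < c < hi -> cont_pos (fun r => (h (polar r c) * cis c)%C).
    move=> hcc r hr; apply: cC_mult; last exact: cC_const.
    apply: (cC_comp (f := fun r => polar r c)); last exact: hc.
    apply: cC_pair; apply: (ex_derive_continuous (fun r => _ (polar r c))).
      by exists (Re (cis c)); exact: (proj1 (is_derive_polar_r r c)).
    by exists (Im (cis c)); exact: (proj2 (is_derive_polar_r r c)).
  move=> r hr; apply: (cC_Re (f := fun r => (h (polar r b) * cis b - h (polar r a) * cis a)%C)).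
  by apply: cC_minus; exact: c1.
have cD r t : 0 < r -> r <> rho -> lo < t < hi -> continuity_2d_pt D r t.
  move=> hr hr' ht; apply/continuity_2d_pt_filterlim.
  have [h1 h2] := hd r t hr hr' ht.
  have H : continuous (fun p : R * R => (Ci * cis p.2 * (h (polar p.1 p.2) + polar p.1 p.2 * d (polar p.1 p.2)))%C) (r, t).
    apply: cC_mult.
      apply: cPid; apply: (continuous_comp (fun p : R * R => p.2) cis) => //.
      exact: (continuous_snd (U := R_UniformSpace) (V := R_UniformSpace)).
    apply: (cC_comp (f := fun p : R * R => polar p.1 p.2) (h := fun z => (h z + z * d z)%C)).
      exact: continuous_polar.
    apply: cC_plus; first exact: hc.
    by apply: cC_mult => //; exact: continuous_id.
  exact (cC_Re H).
have dP r t : 0 < r -> r <> rho -> lo < t < hi -> is_derive (fun r => P r t) r (D r t).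
  move=> hr hr' ht; have [h1 h2] := hd r t hr hr' ht.
  have hz : hol (fun z => (Ci * z * h z)%C) (polar r t)
     ((0 * polar r t + Ci * 1) * h (polar r t) + Ci * polar r t * d (polar r t))%C.
    by apply: hol_mult h1; apply: hol_mult; [exact: hol_const|exact: hol_id].
  have [d1 d2] := is_derive_polar_r r t.
  have [+ _] := hol_curve (g := fun r => polar r t) hz d1 d2.
  rewrite /P /D; congr (is_derive _ _ (Re _)); ring.
have dW r t : 0 < r -> r <> rho -> lo < t < hi ->
    is_derive (fun t => Re (h (polar r t) * cis t)%C) t (D r t).
  move=> hr hr' ht; have [h1 h2] := hd r t hr hr' ht.
  (* On the circle of radius [r] the factor [cis t] equals [z / r], so that the function to be
     differentiated is a holomorphic function of [z]. *)
  have hz : hol (fun z => (h z * (z * RtoC (/ r)))%C) (polar r t)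
     (d (polar r t) * (polar r t * RtoC (/ r)) + h (polar r t) * (1 * RtoC (/ r) + polar r t * 0))%C.
    by apply: hol_mult h1 _; apply: hol_mult; [exact: hol_id|exact: hol_const].
  have [d1 d2] := is_derive_polar_t r t.
  have [+ _] := hol_curve (g := fun t => polar r t) hz d1 d2.
  have hcis s : (polar r s * RtoC (/ r))%C = cis s.
    rewrite polarE /cis /RtoC /Cmult /=; congr pair; field; lra.
  rewrite /D => H.
  have -> : (Ci * cis t * (h (polar r t) + polar r t * d (polar r t)) =
     (d (polar r t) * (polar r t * RtoC (/ r)) + h (polar r t) * (1 * RtoC (/ r) + polar r t * 0)) *
     (Ci * polar r t))%C.
    by rewrite -(hcis t); ring.
  apply: (is_derive_ext _ _ _ _ _ H) => s.
  by rewrite -(hcis s).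
pose A r := RInt (P r) a b.
have cA : cont_pos A.
  move=> r hr; have hr2 : 0 < r / 2 by lra.
  apply: (@continuous_RInt_param _ _ _ _ (mkposreal _ hr2)) => u v /= hu hv.
  by apply: cP; [lra|exact: hab].
have dA r : 0 < r -> r <> rho -> is_derive A r (B r).
  move=> hr hr'.
  have hloc : locally r (fun s => 0 < s /\ s <> rho).
    apply: filter_and; first exact: (open_gt 0 r hr).
    exact: (open_neq rho r hr').
  have -> : B r = RInt (fun t => Derive (fun s => P s t) r) a b.
    rewrite (RInt_ext _ (D r)); last first.
      move=> t ht; apply: is_derive_unique; apply: dP => //; apply: hab; lra.
    symmetry; apply: is_RInt_unique.
    have -> : B r = minus (Re (h (polar r b) * cis b)%C) (Re (h (polar r a) * cis a)%C).
      by rewrite /B /Cminus /Cplus /Copp /minus /plus /opp /=.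
    apply: (is_RInt_derive (V := R_CompleteNormedModule) (fun t => Re (h (polar r t) * cis t)%C) (D r)) => t /hab ht.
      exact: dW.
    by apply: continuity_2d_section1; exact: cD.
  apply: (is_derive_RInt_param P a b r).
  - apply: filter_imp hloc => s [s0 s1] t /hab ht; exists (D s t); exact: dP.
  - move=> t /hab ht; apply: (continuity_2d_pt_ext_loc D); last exact: cD.
    have [del hdel] := hloc.
    have hm : 0 < Rmin del (Rmin (t - lo) (hi - t)).
      by apply: Rmin_pos; [exact: cond_pos|apply: Rmin_pos; lra].
    exists (mkposreal _ hm) => u v /= hu hv.
    have [u0 u1] : 0 < u /\ u <> rho.
      apply: hdel; rewrite /ball /= /AbsRing_ball /abs /= /minus /plus /opp /= -/(Rminus _ _).
      by apply: Rlt_le_trans hu _; exact: Rmin_l.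
    have hv' : Rabs (v - t) < Rmin (t - lo) (hi - t) by apply: Rlt_le_trans hv _; exact: Rmin_r.
    have := Rlt_le_trans _ _ _ hv' (Rmin_l _ _); have := Rlt_le_trans _ _ _ hv' (Rmin_r _ _).
    move=> /Rabs_def2 v1 /Rabs_def2 v2.
    by symmetry; apply: is_derive_unique; apply: dP => //; lra.
  - apply: filter_imp hloc => s [s0 s1].
    apply: (ex_RInt_continuous (V := R_CompleteNormedModule)) => t /hab ht.
    by apply: continuity_2d_section1; exact: cP.
move=> x y hxy.
pose E s := A s - RInt B x s.
change (RInt B x y = A y - A x).
have e0 : RInt B x x = 0 by exact: RInt_point.
suff : E y - E x = 0 by rewrite /E e0; lra.
have dI s : 0 < s -> is_derive (fun s => RInt B x s) s (B s).
  move=> hs; apply: (is_derive_RInt (V := R_NormedModule) B _ x); last exact: cB.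
  apply: filter_imp (open_gt 0 s hs) => u hu.
  by apply: (RInt_correct (V := R_CompleteNormedModule)); apply: ex_RInt_pos => //; lra.
have dE s : 0 < s -> s <> rho -> is_derive E s 0.
  move=> h1 h2; have -> : 0 = minus (B s) (B s) by rewrite minus_eq_zero.
  apply: (is_derive_minus (V := R_NormedModule) A (fun s => RInt B x s)); [exact: dA|exact: dI].
have cE s : 0 < s -> continuity_pt E s.
  move=> hs; apply/continuity_pt_filterlim; apply: cR_minus; first exact: cA.
  by apply: (ex_derive_continuous (fun s => RInt B x s)); exists (B s); exact: dI.
have seg u v : 0 < u <= v -> ~ (u < rho < v) -> E v - E u = 0.
  move=> huv hn.
  have [|z hz|z [_ ->]] := MVT_gen E u v (fun _ => 0); last by ring.
    by rewrite Rmin_left ?Rmax_right; try lra; move=> z hz; apply: dE; lra.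
  by apply: cE; move: hz; rewrite Rmin_left; lra.
case: (Rle_dec rho x) => h1; first by apply: seg; lra.
case: (Rle_dec y rho) => h2; first by apply: seg; lra.
have e1 : E rho - E x = 0 by apply: seg; lra.
have e2 : E y - E rho = 0 by apply: seg; lra.
lra.
Qed.

(** * Cauchy's theorem and formula on sectors and double sectors *)

Definition cint (h : R -> C) (c : C) : Prop :=
  Ipos (fun r => Re (h r)) (Re c) /\ Ipos (fun r => Im (h r)) (Im c).

Lemma cint_unique h c c' : cint h c -> cint h c' -> c = c'.
Proof.
move=> [h1 h2] [h3 h4]; apply: injective_projections.
  exact: (Ipos_unique (V := R_CompleteNormedModule) h1 h3).
exact: (Ipos_unique (V := R_CompleteNormedModule) h2 h4).
Qed.

Lemma cint_ext f g c : (forall r, 0 < r -> f r = g r) -> cint f c -> cint g c.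
Proof.
move=> e [h1 h2]; split.
  by apply: (Ipos_ext (V := R_CompleteNormedModule) _ h1) => r hr; rewrite e.
by apply: (Ipos_ext (V := R_CompleteNormedModule) _ h2) => r hr; rewrite e.
Qed.

Lemma Ipos_plusR (f g : R -> R) (l m : R) : Ipos f l -> Ipos g m ->
  Ipos (fun x => f x + g x) (l + m).
Proof. exact: (@is_RInt_gen_plus R_NormedModule). Qed.

Lemma Ipos_minusR (f g : R -> R) (l m : R) : Ipos f l -> Ipos g m ->
  Ipos (fun x => f x - g x) (l - m).
Proof. exact: (@is_RInt_gen_minus R_NormedModule). Qed.

Lemma cint_plus f g c d : cint f c -> cint g d -> cint (fun r => (f r + g r)%C) (c + d)%C.
Proof. by move=> [h1 h2] [h3 h4]; split; exact: Ipos_plusR. Qed.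

Lemma cint_minus f g c d : cint f c -> cint g d -> cint (fun r => (f r - g r)%C) (c - d)%C.
Proof. by move=> [h1 h2] [h3 h4]; split; exact: Ipos_minusR. Qed.

Lemma cint_mult k f c : cint f c -> cint (fun r => (k * f r)%C) (k * c)%C.
Proof.
by move=> [h1 h2]; split; [apply: Ipos_minusR|apply: Ipos_plusR]; exact: Ipos_mult.
Qed.

(** [r |h|] is the size of the integrand, with respect to the angle, on the arc of radius [r]: the
    arcs contribute nothing as [r -> 0] and as [r -> oo]. *)
Definition vanishing (lo hi : R) (h : C -> C) : Prop :=
  forall eps, 0 < eps -> exists x0 y0, 0 < x0 < y0 /\
    forall r t, lo < t < hi -> 0 < r -> r < x0 \/ y0 < r ->
      r * Cmod (h (polar r t)) <= eps.

(** The factor [cis t] is [ds / dr] on the ray. *)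
Definition ray (h : C -> C) (t r : R) : C := (h (polar r t) * cis t)%C.

Lemma Cmod_cis t : Cmod (cis t) = 1.
Proof.
rewrite /Cmod /cis /= !Rmult_1_r; have := sin2_cos2 t; rewrite /Rsqr => e.
by rewrite Rplus_comm e sqrt_1.
Qed.

Lemma Cmod_polar r t : 0 < r -> Cmod (polar r t) = r.
Proof.
by move=> hr; rewrite polarE Cmod_mult Cmod_cis Cmod_R Rabs_pos_eq; lra.
Qed.

(** Differentiation under the integral sign needs a continuous derivative. Continuity is carried
    along, since intrinsic functions and resolvents supply it directly. *)
Definition hol1 (h d : C -> C) (z : C) : Prop := hol h z (d z) /\ continuous d z.

(** Over a finite range of radii, the difference of the two ray integrals equals the difference of
    two arc integrals, and these tend to 0. *)
Lemma ray_rotation_Re (h d : C -> C) (lo hi a b rho : R) :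
  lo < a < hi -> lo < b < hi ->
  (forall r t, 0 < r -> lo < t < hi -> continuous h (polar r t)) ->
  (forall r t, 0 < r -> r <> rho -> lo < t < hi -> hol1 h d (polar r t)) ->
  vanishing lo hi h ->
  Ipos (fun r => Re (ray h b r - ray h a r)%C) 0.
Proof.
move=> ha hb hc hd hv.
have cB : cont_pos (fun r => Re (ray h b r - ray h a r)%C).
  have c1 c : lo < c < hi -> cont_pos (ray h c).
    move=> hcc r hr; apply: cC_mult; last exact: cC_const.
    apply: (cC_comp (f := fun r => polar r c)); last exact: hc.
    apply: cC_pair; apply: (ex_derive_continuous (fun r => _ (polar r c))).
      by exists (Re (cis c)); exact: (proj1 (is_derive_polar_r r c)).
    by exists (Im (cis c)); exact: (proj2 (is_derive_polar_r r c)).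
  move=> r hr; apply: (cC_Re (f := fun r => (ray h b r - ray h a r)%C)).
  by apply: cC_minus; exact: c1.
apply/(IposRP _ cB) => eps heps.
have hk : 0 < 1 + Rabs (b - a) by have := Rabs_pos (b - a); lra.
have he : 0 < eps / 2 / (1 + Rabs (b - a)) by apply: Rdiv_lt_0_compat; lra.
have [x0 [y0 [h0 H]]] := hv _ he.
exists x0, y0; split=> // x y hx hy.
have -> : RInt (fun r => Re (ray h b r - ray h a r)%C) x y =
  RInt (fun t => Re (Ci * polar y t * h (polar y t))%C) a b -
  RInt (fun t => Re (Ci * polar x t * h (polar x t))%C) a b.
  by apply: (polar_cauchy_Re (rho := rho) (d := d) ha hb hc hd); lra.
have bd r : 0 < r -> r < x0 \/ y0 < r ->
    Rabs (RInt (fun t => Re (Ci * polar r t * h (polar r t))%C) a b) < eps / 2.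
  move=> hr hr'.
  apply: (Rle_lt_trans _ (Rabs (b - a) * (eps / 2 / (1 + Rabs (b - a))))); last first.
    have -> : Rabs (b - a) * (eps / 2 / (1 + Rabs (b - a))) = Rabs (b - a) * (eps / 2) / (1 + Rabs (b - a)).
      by rewrite /Rdiv; ring.
    by apply/Rlt_div_l => //; have := Rabs_pos (b - a); nra.
  have hab t : Rmin a b <= t <= Rmax a b -> lo < t < hi.
    by rewrite /Rmin /Rmax; case: Rle_dec; lra.
  apply: (norm_RInt_le_const_abs (V := R_NormedModule) (fun t => Re (Ci * polar r t * h (polar r t))%C)).
    move=> t /hab ht; apply: Rle_trans (H r t ht hr hr').
    apply: Rle_trans (re_le_Cmod _) _.
    by rewrite !Cmod_mult Cmod_Ci Cmod_polar //; lra.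
  apply: (RInt_correct (V := R_CompleteNormedModule)).
  apply: (ex_RInt_continuous (V := R_CompleteNormedModule)) => t /hab ht.
  apply: (continuity_2d_section1 (F := fun r t => Re (Ci * polar r t * h (polar r t))%C) (x := r)).
  apply: (polar_cont2 (h := fun z => (Ci * z * h z)%C)).
  apply: cC_mult; last exact: hc.
  by apply: cC_mult; [exact: cC_const|exact: continuous_id].
rewrite Rminus_0_r.
have b1 : Rabs (RInt (fun t => Re (Ci * polar x t * h (polar x t))%C) a b) < eps / 2 by apply: bd; [lra|left; lra].
have b2 : Rabs (RInt (fun t => Re (Ci * polar y t * h (polar y t))%C) a b) < eps / 2 by apply: bd; [lra|right; lra].
move/Rabs_def2: b1 => b1; move/Rabs_def2: b2 => b2.
apply: Rabs_def1; lra.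
Qed.

Lemma ray_rotation (h d : C -> C) (lo hi a b rho : R) :
  lo < a < hi -> lo < b < hi ->
  (forall r t, 0 < r -> lo < t < hi -> continuous h (polar r t)) ->
  (forall r t, 0 < r -> r <> rho -> lo < t < hi -> hol1 h d (polar r t)) ->
  vanishing lo hi h ->
  cint (fun r => (ray h b r - ray h a r)%C) 0%C.
Proof.
move=> ha hb hc hd hv; split; first exact: (ray_rotation_Re ha hb hc hd hv).
(* Since [Im w = Re (- i w)], the imaginary part is the real part for [- i h]. *)
have := @ray_rotation_Re (fun z => (- Ci * h z)%C) (fun z => (- Ci * d z)%C) lo hi a b rho ha hb.
move=> H; apply: (Ipos_ext (V := R_CompleteNormedModule) _ (H _ _ _)).
- move=> r hr; rewrite /ray /Re /Im /=; ring.
- by move=> r t hr ht; apply: cC_mult; [exact: cC_const|exact: hc].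
- move=> r t hr hr' ht; have [h1 h2] := hd r t hr hr' ht; split.
    have := hol_mult (hol_const (- Ci)%C (polar r t)) h1.
    by congr hol; ring.
  by apply: cC_mult => //; exact: cC_const.
- move=> eps heps; have [x0 [y0 [h0 h1]]] := hv eps heps.
  exists x0, y0; split=> // r t ht hr hr'.
  by rewrite Cmod_mult Cmod_opp Cmod_Ci Rmult_1_l; exact: h1.
Qed.

Definition on_sector (th : R) (P : C -> Prop) : Prop :=
  forall r t, 0 < r -> - th < t < th -> P (polar r t).

(* The integrand of the boundary integral over the sector |arg z| < phi. *)
Definition kR (phi : R) (h : C -> C) (r : R) : C := (ray h (- phi) r - ray h phi r)%C.

Lemma sector_cauchy (h d : C -> C) (phi th : R) : 0 < phi < th ->
  on_sector th (hol1 h d) -> vanishing (- th) th h -> cint (kR phi h) 0%C.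
Proof.
(* Radii are positive, so [rho := 0] means that no radius is exceptional. *)
move=> hphi hh hv; apply: (ray_rotation (lo := - th) (hi := th) (rho := 0) (d := d)) => //; try lra.
- by move=> r t hr ht; case: (hh r t hr ht) => /hol_cont.
- by move=> r t hr _ ht; exact: hh.
Qed.

Lemma Cmod_sub_ge (x y : C) : Cmod x - Cmod y <= Cmod (x - y).
Proof.
have := Cmod_triangle (x - y) y.
have -> : (x - y + y)%C = x by ring.
lra.
Qed.

Lemma Cmod_sub_le (x y : C) : Cmod (x - y) <= Cmod x + Cmod y.
Proof. by rewrite -(Cmod_opp y); exact: Cmod_triangle. Qed.

Lemma Cmod_sub_sym (x y : C) : Cmod (x - y) = Cmod (y - x).
Proof. by rewrite -Cmod_opp; congr Cmod; ring. Qed.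

Lemma Cmod_half (s p : C) : Cmod p < Cmod s / 2 ->
  Cmod s / 2 <= Cmod (s - p) /\ Cmod s / 2 <= Cmod (s + p).
Proof.
move=> h; have h1 := Cmod_sub_ge s p; have h2 := Cmod_sub_ge s (- p)%C.
rewrite Cmod_opp in h2.
have e : (s - - p)%C = (s + p)%C by ring.
by rewrite e in h2; lra.
Qed.

Lemma vanishing_minus lo hi f g : vanishing lo hi f -> vanishing lo hi g ->
  vanishing lo hi (fun s => (f s - g s)%C).
Proof.
move=> hf hg eps heps; have h2 : 0 < eps / 2 by lra.
have [x0 [y0 [h0 H0]]] := hf _ h2; have [x1 [y1 [h1 H1]]] := hg _ h2.
have := Rmin_l x0 x1; have := Rmin_r x0 x1; have := Rmax_l y0 y1; have := Rmax_r y0 y1.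
move=> *; exists (Rmin x0 x1), (Rmax y0 y1); split.
  by split; [apply: Rmin_pos; lra|lra].
move=> r t ht hr hr'.
have k0 : r * Cmod (f (polar r t)) <= eps / 2 by apply: H0 => //; lra.
have k1 : r * Cmod (g (polar r t)) <= eps / 2 by apply: H1 => //; lra.
have := Cmod_sub_le (f (polar r t)) (g (polar r t)); nra.
Qed.

Lemma vanishing_scal lo hi c f : vanishing lo hi f -> vanishing lo hi (fun s => (c * f s)%C).
Proof.
move=> hf eps heps; have hc := Cmod_ge_0 c.
have h2 : 0 < eps / (1 + Cmod c) by apply: Rdiv_lt_0_compat; lra.
have [x0 [y0 [h0 H0]]] := hf _ h2; exists x0, y0; split=> // r t ht hr hr'.
have := H0 r t ht hr hr'; rewrite Cmod_mult => k.
have hp := Cmod_ge_0 (f (polar r t)).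
have e : eps / (1 + Cmod c) * (1 + Cmod c) = eps by field; lra.
have hX : 0 <= r * Cmod (f (polar r t)) by apply: Rmult_le_pos; lra.
have : r * Cmod (f (polar r t)) * (1 + Cmod c) <= eps.
  by rewrite -e; apply: Rmult_le_compat_r; lra.
nra.
Qed.

(** The decay for which [E(s) / (s - p)] is [vanishing]: near 0 the factor [1 / (s - p)] is merely
    bounded, near oo it contributes [1 / r]. *)
Definition mild (lo hi : R) (E : C -> C) : Prop :=
  forall eps, 0 < eps -> exists x0 y0, 0 < x0 < y0 /\
    forall r t, lo < t < hi -> 0 < r ->
      (r < x0 -> r * Cmod (E (polar r t)) <= eps) /\
      (y0 < r -> Cmod (E (polar r t)) <= eps).

Lemma mild_div lo hi E (p : C) : p <> 0%C -> mild lo hi E ->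
  vanishing lo hi (fun s => (E s / (s - p))%C).
Proof.
move=> /Cmod_gt_0 hp hE eps heps.
have hm : 0 < Rmin (eps / 2) (eps * Cmod p / 2) by apply: Rmin_pos; nra.
have [x0 [y0 [h0 H0]]] := hE _ hm.
have m1 := Rmin_l (eps / 2) (eps * Cmod p / 2); have m2 := Rmin_r (eps / 2) (eps * Cmod p / 2).
have n1 := Rmin_l x0 (Cmod p / 2); have n2 := Rmin_r x0 (Cmod p / 2).
have n3 := Rmax_l y0 (3 * Cmod p); have n4 := Rmax_r y0 (3 * Cmod p).
exists (Rmin x0 (Cmod p / 2)), (Rmax y0 (3 * Cmod p)); split.
  by split; [apply: Rmin_pos; lra|lra].
move=> r t ht hr hr'; have es := Cmod_polar t hr.
have hEp := Cmod_ge_0 (E (polar r t)).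
have [k1 k2] := H0 r t ht hr.
have bnd (c : R) : 0 < c -> c <= Cmod (polar r t - p) ->
    r * Cmod (E (polar r t)) <= eps * c -> r * Cmod (E (polar r t) / (polar r t - p)) <= eps.
  move=> hc hc' hK.
  have nz : (polar r t - p)%C <> 0%C by move=> e; rewrite e Cmod_0 in hc'; lra.
  rewrite Cmod_div // /Rdiv -Rmult_assoc; apply/Rle_div_l; first lra.
  by apply: Rle_trans hK _; nra.
case: hr' => hr'.
  have [l1 l2] : Cmod p / 2 <= Cmod (p - polar r t) /\ Cmod p / 2 <= Cmod (p + polar r t).
    by apply: Cmod_half; lra.
  rewrite Cmod_sub_sym in l1.
  by apply: (bnd (Cmod p / 2)) => //; [lra|have := k1; lra].
have [l1 l2] : Cmod (polar r t) / 2 <= Cmod (polar r t - p) /\ Cmod (polar r t) / 2 <= Cmod (polar r t + p).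
  by apply: Cmod_half; lra.
apply: (bnd (r / 2)) => //; [lra|lra|].
have k3 : Cmod (E (polar r t)) <= eps / 2 by have := k2; lra.
nra.
Qed.

Lemma mild_inv lo hi (p c : C) : p <> 0%C -> mild lo hi (fun s => (c / (s + p))%C).
Proof.
move=> hp0 eps heps; have hp := proj1 (Cmod_gt_0 _) hp0; have hc := Cmod_ge_0 c.
pose K := 2 * Cmod c + 1.
have hK : 0 < K by rewrite /K; lra.
have e1 : 0 < eps * Cmod p / (2 * K) by apply: Rdiv_lt_0_compat; nra.
have m1 := Rmin_l (Cmod p / 2) (eps * Cmod p / (2 * K)).
have m2 := Rmin_r (Cmod p / 2) (eps * Cmod p / (2 * K)).
have n1 := Rmax_l (3 * Cmod p) (2 * K / eps); have n2 := Rmax_r (3 * Cmod p) (2 * K / eps).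
exists (Rmin (Cmod p / 2) (eps * Cmod p / (2 * K))), (Rmax (3 * Cmod p) (2 * K / eps)); split.
  by split; [apply: Rmin_pos; lra|lra].
move=> r t ht hr; have es := Cmod_polar t hr; split=> hr'.
  have [l1 l2] : Cmod p / 2 <= Cmod (p - polar r t) /\ Cmod p / 2 <= Cmod (p + polar r t).
    by apply: Cmod_half; lra.
  have nz : (polar r t + p)%C <> 0%C.
    by rewrite Cplus_comm => e; rewrite e Cmod_0 in l2; lra.
  rewrite Cmod_div // (Cplus_comm _ p) /Rdiv -Rmult_assoc; apply/Rle_div_l; first lra.
  have hr2 : r < eps * Cmod p / (2 * K) by lra.
  have {}hr2 : r * (2 * K) < eps * Cmod p by apply/Rlt_div_r => //; lra.
  by rewrite /K in hr2; nra.
have [l1 l2] : Cmod (polar r t) / 2 <= Cmod (polar r t - p) /\ Cmod (polar r t) / 2 <= Cmod (polar r t + p).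
  by apply: Cmod_half; lra.
have nz : (polar r t + p)%C <> 0%C by move=> e; rewrite e Cmod_0 in l2; lra.
rewrite Cmod_div //; apply/Rle_div_l; first lra.
have hr2 : 2 * K / eps < r by lra.
have {}hr2 : 2 * K < r * eps by apply/Rlt_div_l.
by rewrite /K in hr2; nra.
Qed.

(** Up to the factor [r rho], [sin (t - psi)] is the determinant of the two points, so that they lie
    on different lines through 0. *)
Lemma polar_neq r t rho psi : 0 < r -> 0 < rho -> sin (t - psi) <> 0 ->
  polar r t <> polar rho psi /\ (- polar r t)%C <> polar rho psi.
Proof.
move=> hr hrho hs; rewrite sin_minus in hs.
have e : r * (sin t * cos psi - cos t * sin psi) = (r * sin t) * cos psi - (r * cos t) * sin psi by ring.
split; move=> [h1 h2]; apply: hs; apply: (Rmult_eq_reg_l r); try lra; rewrite e.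
  by rewrite h1 h2; ring.
have -> : r * cos t = - (rho * cos psi) by rewrite -h1; ring.
have -> : r * sin t = - (rho * sin psi) by rewrite -h2; ring.
ring.
Qed.

Lemma polar_neq0 r t : 0 < r -> polar r t <> 0%C.
Proof. by move=> hr e; have := Cmod_polar t hr; rewrite e Cmod_0; lra. Qed.

(* The residue at p of 1/(s-p) - 1/(s+p) is seen on the rays orthogonal to p, where the
   integrand is -+ 2i rho / (r^2 + rho^2). *)
Definition dipole (p s : C) : C := (2 * p / (s + p) / (s - p))%C.

Lemma cint_dipole_orth rho psi (sg : R) : 0 < rho -> sg = 1 \/ sg = - 1 ->
  cint (ray (dipole (polar rho psi)) (psi + sg * (PI / 2))) (- RtoC (sg * PI) * Ci)%C.
Proof.
move=> hrho hsg.
have ecis : cis (psi + sg * (PI / 2)) = (RtoC sg * Ci * cis psi)%C.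
  rewrite /cis cos_plus sin_plus.
  by case: hsg => ->; rewrite ?Rmult_1_l -?Ropp_mult_distr_l ?Rmult_1_l ?cos_neg ?sin_neg cos_PI2 sin_PI2;
    apply: injective_projections => /=; ring.
have hPI : (RtoC 2 * RtoC (PI / 2))%C = RtoC PI by rewrite -RtoC_mult; congr RtoC; field.
have hpos : cint (fun r => RtoC (rho / (r * r + rho * rho))) (RtoC (PI / 2)).
  split; first exact: Ipos_poisson.
  have := Ipos_mult (k := 0) (Ipos_poisson hrho); rewrite Rmult_0_l.
  by apply: (Ipos_ext (V := R_CompleteNormedModule)) => r hr; rewrite /= Rmult_0_l.
have := cint_mult (- RtoC sg * 2 * Ci)%C hpos.
have -> : (- RtoC sg * 2 * Ci * RtoC (PI / 2) = - RtoC (sg * PI) * Ci)%C.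
  by rewrite RtoC_mult -hPI; ring.
apply: cint_ext => r hr; rewrite /ray /dipole !polarE ecis.
have sq : (RtoC sg * RtoC sg)%C = 1%C by rewrite -RtoC_mult; congr RtoC; case: hsg => ->; ring.
have c0 : cis psi <> 0%C by move=> e; have := Cmod_cis psi; rewrite e Cmod_0; lra.
have n0 : RtoC (r * r + rho * rho) <> 0%C by move=> [e]; nra.
have rh0 : RtoC rho <> 0%C by move=> [e]; lra.
have I2 : (Ci * Ci = - 1)%C by rewrite /Ci /Cmult /Copp /RtoC /=; congr pair; ring.
rewrite RtoC_div; last nra.
set I' := (RtoC sg * Ci)%C.
have I2' : (I' * I' = - 1)%C.
  have -> : (I' * I' = (RtoC sg * RtoC sg) * (Ci * Ci))%C by rewrite /I'; ring.
  by rewrite sq I2; ring.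
(* On an orthogonal ray [s^2 = - r^2 cis(psi)^2], hence [(s + p) (s - p) = s^2 - p^2 = - (r^2 +
   rho^2) cis(psi)^2]. *)
have e1 : ((RtoC r * (I' * cis psi) + RtoC rho * cis psi) *
   (RtoC r * (I' * cis psi) - RtoC rho * cis psi) =
   - (RtoC (r * r + rho * rho) * (cis psi * cis psi)))%C.
  rewrite RtoC_plus !RtoC_mult.
  have -> : ((RtoC r * (I' * cis psi) + RtoC rho * cis psi) *
   (RtoC r * (I' * cis psi) - RtoC rho * cis psi) =
   RtoC r * RtoC r * (I' * I') * (cis psi * cis psi) - RtoC rho * RtoC rho * (cis psi * cis psi))%C by ring.
  by rewrite I2'; ring.
have n1 : (- (RtoC (r * r + rho * rho) * (cis psi * cis psi)))%C <> 0%C.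
  move=> e; have : (RtoC (r * r + rho * rho) * (cis psi * cis psi))%C <> 0%C.
    by repeat apply: Cmult_neq_0.
  set X := (_ * _)%C in e *; apply; have -> : X = (- - X)%C by ring.
  by rewrite e; ring.
have n2 : (RtoC r * (I' * cis psi) + RtoC rho * cis psi)%C <> 0%C.
  by move=> e; apply: n1; rewrite -e1 e; ring.
have n3 : (RtoC r * (I' * cis psi) - RtoC rho * cis psi)%C <> 0%C.
  by move=> e; apply: n1; rewrite -e1 e; ring.
have -> : (2 * (RtoC rho * cis psi) / (RtoC r * (I' * cis psi) + RtoC rho * cis psi) /
   (RtoC r * (I' * cis psi) - RtoC rho * cis psi) * (I' * cis psi) =
   2 * RtoC rho * I' * (cis psi * cis psi) /
   ((RtoC r * (I' * cis psi) + RtoC rho * cis psi) * (RtoC r * (I' * cis psi) - RtoC rho * cis psi)))%C.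
  by field; split.
rewrite e1 /I'; field; split=> //.
Qed.

Lemma Csub_eq0 (x y : C) : (x - y)%C = 0%C -> x = y.
Proof.
move=> e; have -> : x = (y + (x - y))%C by ring.
by rewrite e Cplus_0_r.
Qed.

Lemma C_dec (x y : C) : {x = y} + {x <> y}.
Proof.
destruct (Req_EM_T (Cmod (x - y)) 0) as [h|h]; [left|right].
  by apply: Csub_eq0; exact: Cmod_eq_0.
move=> e; apply: h; rewrite e; have -> : (y - y)%C = 0%C by ring.
exact: Cmod_0.
Qed.

Lemma hol1_const c z : hol1 (fun _ => c) (fun _ => 0%C) z.
Proof. by split; [exact: hol_const|exact: cC_const]. Qed.

Lemma hol1_id z : hol1 (fun w => w) (fun _ => 1%C) z.
Proof. by split; [exact: hol_id|exact: cC_const]. Qed.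

Lemma hol1_plus f g d e z : hol1 f d z -> hol1 g e z ->
  hol1 (fun w => (f w + g w)%C) (fun w => (d w + e w)%C) z.
Proof. by move=> [h1 h2] [h3 h4]; split; [exact: hol_plus|exact: cC_plus]. Qed.

Lemma hol1_mult f g d e z : hol1 f d z -> hol1 g e z ->
  hol1 (fun w => (f w * g w)%C) (fun w => (d w * g w + f w * e w)%C) z.
Proof.
move=> [h1 h2] [h3 h4]; split; first exact: hol_mult.
by apply: cC_plus; apply: cC_mult => //; [exact: hol_cont h3|exact: hol_cont h1].
Qed.

Lemma hol1_inv f d z : hol1 f d z -> f z <> 0%C ->
  hol1 (fun w => (/ f w)%C) (fun w => (- d w / (f w * f w))%C) z.
Proof.
move=> [h1 h2] nz; split; first exact: hol_inv.
have cf := hol_cont h1.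
apply: cC_mult; first exact: cC_opp.
by apply: cC_inv; [exact: cC_mult|exact: Cmult_neq_0].
Qed.

Lemma hol1_comp f g d e z : hol1 f d z -> hol1 g e (f z) ->
  hol1 (fun w => g (f w)) (fun w => (e (f w) * d w)%C) z.
Proof.
move=> [h1 h2] [h3 h4]; split; first exact: hol_comp.
by apply: cC_mult => //; apply: cC_comp => //; exact: hol_cont h1.
Qed.

Lemma hol1_cont f d z : hol1 f d z -> continuous f z.
Proof. by case=> /hol_cont. Qed.

Lemma hol1_shift p z : hol1 (fun w => (w - p)%C) (fun w => (1 + 0)%C) z.
Proof. by apply: hol1_plus; [exact: hol1_id|exact: hol1_const]. Qed.

Definition d_over_shift (E d : C -> C) (p w : C) : C :=
  (d w * / (w - p) + E w * (- (1 + 0) / ((w - p) * (w - p))))%C.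

Lemma hol1_over_shift E d p z : hol1 E d z -> z <> p ->
  hol1 (fun w => (E w / (w - p))%C) (d_over_shift E d p) z.
Proof.
move=> hE nz; apply: hol1_mult => //; apply: hol1_inv; first exact: hol1_shift.
by move=> /Csub_eq0.
Qed.

Definition d_dipole (p : C) : C -> C :=
  d_over_shift (fun s => (2 * p / (s - - p))%C) (d_over_shift (fun _ => (2 * p)%C) (fun _ => 0%C) (- p)%C) p.

Lemma hol1_dipole p z : z <> p -> z <> (- p)%C -> hol1 (dipole p) (d_dipole p) z.
Proof.
move=> h1 h2.
have := hol1_over_shift (hol1_over_shift (hol1_const (2 * p)%C z) h2) h1.
move=> [H1 H2]; split=> //; apply: hol_ext_loc H1; apply: filter_forall => w.
rewrite /dipole; congr (_ / _ / _)%C; Cring.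
Qed.

Lemma vanishing_dipole lo hi (p : C) : p <> 0%C -> vanishing lo hi (dipole p).
Proof. by move=> hp; exact: (mild_div hp (@mild_inv lo hi p (2 * p)%C hp)). Qed.

(** As long as the ray does not cross the line through [p] and [- p], it can be rotated to the
    orthogonal ray on the same side; [sg] records the side. *)
Lemma cint_dipole_ray rho psi phi sg : 0 < rho ->
  sg = 1 /\ psi < phi < psi + PI \/ sg = - 1 /\ psi - PI < phi < psi ->
  cint (ray (dipole (polar rho psi)) phi) (- RtoC (sg * PI) * Ci)%C.
Proof.
move=> hrho hphi; have hpi := PI_RGT_0.
have hsg : sg = 1 \/ sg = - 1 by case: hphi => -[-> _]; [left|right].
have orth := cint_dipole_orth psi hrho hsg.
have rot : cint (fun r => (ray (dipole (polar rho psi)) phi r -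
    ray (dipole (polar rho psi)) (psi + sg * (PI / 2)) r)%C) 0%C.
  have aux lo hi : lo < phi < hi -> lo < psi + sg * (PI / 2) < hi ->
      (forall t, lo < t < hi -> sin (t - psi) <> 0) ->
      cint (fun r => (ray (dipole (polar rho psi)) phi r -
        ray (dipole (polar rho psi)) (psi + sg * (PI / 2)) r)%C) 0%C.
    move=> h1 h2 h3.
    have H r t : 0 < r -> lo < t < hi -> hol1 (dipole (polar rho psi)) (d_dipole (polar rho psi)) (polar r t).
      move=> hr /h3 hs; have [n1 n2] := polar_neq hr hrho hs.
      apply: hol1_dipole => // e; apply: n2; rewrite e; ring.
    apply: (ray_rotation (lo := lo) (hi := hi) (rho := 0) (d := d_dipole (polar rho psi))) => //.
    - by move=> r t hr ht; exact: hol1_cont (H r t hr ht).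
    - by move=> r t hr _ ht; exact: H.
    - by apply: vanishing_dipole; exact: polar_neq0.
  case: hphi => -[e h].
    apply: (aux psi (psi + PI)); rewrite ?e; try lra.
    by move=> t ht; apply: Rgt_not_eq; apply: sin_gt_0; lra.
  apply: (aux (psi - PI) psi); rewrite ?e; try lra.
  by move=> t ht; apply: Rlt_not_eq; apply: sin_lt_0_var; lra.
have := cint_plus rot orth; rewrite Cplus_0_l; apply: cint_ext => r hr; ring.
Qed.

(* E(s) - E(p) 2p/(s+p) vanishes at p, so that its quotient by s - p extends continuously to p
   and Cauchy's theorem with an exceptional radius applies to it. *)
Lemma sector_cauchy_formula (E d : C -> C) (rho psi phi th : R) :
  0 < rho -> th <= PI / 2 -> - phi < psi < phi -> phi < th ->
  on_sector th (hol1 E d) -> mild (- th) th E ->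
  cint (kR phi (fun s => (E s / (s - polar rho psi))%C)) (2 * RtoC PI * Ci * E (polar rho psi))%C.
Proof.
move=> hrho hth hpsi hphi hE mE; set p := polar rho psi; have hpi := PI_RGT_0.
have p0 : p <> 0%C by exact: polar_neq0.
have repos r t : 0 < r -> - th < t < th -> 0 < Re (polar r t).
  by move=> hr ht; rewrite /polar /=; apply: Rmult_lt_0_compat => //; apply: cos_gt_0; lra.
have sp0 r t : 0 < r -> - th < t < th -> polar r t <> (- p)%C.
  move=> hr ht e; have := repos r t hr ht; have hpsi' : - th < psi < th by lra.
  by have := repos rho psi hrho hpsi'; rewrite e -/p /=; lra.
(* [M] takes the value 1 at [p], decays at oo, and has its only pole at [- p], outside the sector
   because [th <= PI / 2]. Subtracting [E p * M] instead of the constant [E p] keeps the decay. *)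
pose M s := (2 * p / (s - - p))%C.
pose dM := d_over_shift (fun _ => (2 * p)%C) (fun _ => 0%C) (- p)%C.
pose N s := (E s + - E p * M s)%C.
pose dN w := (d w + (0 * M w + - E p * dM w))%C.
have hN r t : 0 < r -> - th < t < th -> hol1 N dN (polar r t).
  move=> hr ht; apply: hol1_plus; first exact: hE.
  apply: hol1_mult; first exact: hol1_const.
  by apply: hol1_over_shift; [exact: hol1_const|exact: sp0].
have Np : N p = 0%C.
  have n2 : (p - - p)%C <> 0%C.
    move=> e; apply: p0; have -> : p = (RtoC (/ 2) * (p - - p))%C; last by rewrite e; ring.
    have -> : (p - - p = RtoC 2 * p)%C by ring.
    by rewrite Cmult_assoc -RtoC_mult Rinv_l; [ring|lra].
  rewrite /N /M; have -> : (2 * p / (p - - p))%C = 1%C; last by ring.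
  by field.
have hpsi' : - th < psi < th by lra.
have [[k [ck kp hk]] _] := hN rho psi hrho hpsi'; rewrite -/p in ck kp hk.
pose q s := if Req_EM_T (Cmod (s - p)) 0 then k p else (N s / (s - p))%C.
have qE s : s <> p -> q s = (N s / (s - p))%C.
  move=> ns; rewrite /q; destruct (Req_EM_T (Cmod (s - p)) 0) as [e|e] => //=; case: ns.
  by apply: Csub_eq0; exact: Cmod_eq_0.
have cq : continuous q p.
  apply: (continuous_ext_loc _ k) ck.
  apply: filter_imp hk => w e; rewrite /q; destruct (Req_EM_T (Cmod (w - p)) 0) as [e0|e0] => /=.
    have -> // : w = p by apply: Csub_eq0; exact: Cmod_eq_0.
  rewrite e Np; Cfield => e1; apply: e0; by rewrite e1 Cmod_0.
have qloc z : z <> p -> locally z (fun w => (N w / (w - p))%C = q w).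
  move=> nz; have h : locally z (fun w => (w - p)%C <> 0%C).
    apply: continuous_neq0; first by apply: cC_minus; [exact: continuous_id|exact: cC_const].
    by move=> /Csub_eq0.
  apply: filter_imp h => w hw; rewrite qE // => e; apply: hw; rewrite e; Cring.
pose dq := d_over_shift N dN p.
have hq r t : 0 < r -> - th < t < th -> polar r t <> p -> hol1 q dq (polar r t).
  move=> hr ht np; have [H1 H2] := hol1_over_shift (hN r t hr ht) np; split=> //.
  by apply: hol_ext_loc H1; exact: qloc.
have hv : vanishing (- th) th q.
  have v1 : vanishing (- th) th (fun s => (E s / (s - p) - E p * dipole p s)%C).
    apply: vanishing_minus; first exact: mild_div.
    by apply: vanishing_scal; exact: vanishing_dipole.
  move=> eps heps; have [x0 [y0 [h0 H]]] := v1 eps heps.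
  have m1 := Rmin_l x0 rho; have m2 := Rmin_r x0 rho.
  have m3 := Rmax_l y0 rho; have m4 := Rmax_r y0 rho.
  exists (Rmin x0 rho), (Rmax y0 rho); split.
    by split; [apply: Rmin_pos; lra|lra].
  move=> r t ht hr hr'.
  have np : polar r t <> p.
    move=> e; have := Cmod_polar t hr; rewrite e Cmod_polar //; lra.
  have -> : q (polar r t) = (E (polar r t) / (polar r t - p) - E p * dipole p (polar r t))%C.
    rewrite qE // /N /M /dipole.
    have -> : (polar r t - - p = polar r t + p)%C by ring.
    by rewrite /Cdiv; ring.
  by apply: H => //; lra.
have c1 : cint (kR phi q) 0%C.
  (* The exceptional radius is the modulus of [p], where [q] is only known to be continuous. *)
  apply: (ray_rotation (lo := - th) (hi := th) (rho := rho) (d := dq)) => //; try lra.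
  - move=> r t hr ht; have [e|ne] := C_dec (polar r t) p; first by rewrite e.
    exact: hol1_cont (hq r t hr ht ne).
  - move=> r t hr nr ht; apply: hq => // e; apply: nr.
    by have := Cmod_polar t hr; rewrite e Cmod_polar.
(* The lower ray lies on the side [sg = -1] of [p], the upper one on the side [sg = 1]; they give
   [i PI] and [- i PI], and the orientation subtracts the second. *)
have c2 : cint (kR phi (dipole p)) (2 * RtoC PI * Ci)%C.
  have hl : - 1 = 1 /\ psi < - phi < psi + PI \/ - 1 = - 1 /\ psi - PI < - phi < psi by right; lra.
  have hu : 1 = 1 /\ psi < phi < psi + PI \/ 1 = - 1 /\ psi - PI < phi < psi by left; lra.
  have := cint_minus (cint_dipole_ray hrho hl) (cint_dipole_ray hrho hu).
  rewrite -!Ropp_mult_distr_l Rmult_1_l RtoC_opp.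
  by have -> : (- - RtoC PI * Ci - - RtoC PI * Ci = 2 * RtoC PI * Ci)%C by ring.
have := cint_plus c1 (cint_mult (E p) c2).
have -> : (0 + E p * (2 * RtoC PI * Ci) = 2 * RtoC PI * Ci * E p)%C by ring.
have npol r (hr : 0 < r) : polar r phi <> p /\ polar r (- phi) <> p.
  split; [have hs : sin (phi - psi) <> 0|have hs : sin (- phi - psi) <> 0].
  - by apply: Rgt_not_eq; apply: sin_gt_0; lra.
  - by case: (polar_neq hr hrho hs).
  - by apply: Rlt_not_eq; apply: sin_lt_0_var; lra.
  - by case: (polar_neq hr hrho hs).
apply: cint_ext => r hr; have [n1 n2] := npol r hr.
rewrite /kR /ray !qE // /N /M /dipole.
have e1 s : (s - - p = s + p)%C by ring.
by rewrite !e1 /Cdiv; ring.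
Qed.

(* The integrand of the boundary integral over the double sector, whose left half contributes
   like the right one for s -> - h (- s). *)
Definition kB (phi : R) (h : C -> C) (r : R) : C :=
  (kR phi h r + kR phi (fun s => - h (- s)%C) r)%C.

Definition bd (phi r : R) (s : C) : Prop :=
  [\/ s = polar r (- phi), s = polar r phi, s = (- polar r (- phi))%C | s = (- polar r phi)%C].

Definition on_bisector (th : R) (P : C -> Prop) : Prop :=
  forall r t, 0 < r -> - th < t < th -> P (polar r t) /\ P (- polar r t)%C.

Definition bmild (th : R) (E : C -> C) : Prop :=
  mild (- th) th E /\ mild (- th) th (fun s => E (- s)%C).

Lemma Cmod_bd phi r s : 0 < r -> bd phi r s -> Cmod s = r.
Proof. by move=> hr []->; rewrite ?Cmod_opp Cmod_polar. Qed.

Lemma bd_neq0 phi r s : 0 < r -> bd phi r s -> s <> 0%C.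
Proof. by move=> hr /(Cmod_bd hr) h e; rewrite e Cmod_0 in h; lra. Qed.

(** * Integration over the boundary of the double sector *)

Section Contour.
Variable phi : R.
Implicit Types (f g h : C -> C).

Lemma kBE h r : kB phi h r =
  (h (polar r (- phi)) * cis (- phi) - h (polar r phi) * cis phi
   - h (- polar r (- phi)) * cis (- phi) + h (- polar r phi) * cis phi)%C.
Proof. by rewrite /kB /kR /ray; ring. Qed.

Lemma kB_ext f g r : (forall s, bd phi r s -> f s = g s) -> kB phi f r = kB phi g r.
Proof.
move=> e; rewrite !kBE !e //; by [apply: Or41|apply: Or42|apply: Or43|apply: Or44].
Qed.

Lemma kB_mult c f r : kB phi (fun s => (c * f s)%C) r = (c * kB phi f r)%C.
Proof. by rewrite !kBE; ring. Qed.

Lemma kB_minus f g r : kB phi (fun s => (f s - g s)%C) r = (kB phi f r - kB phi g r)%C.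
Proof. by rewrite !kBE; ring. Qed.

Lemma kB_norm h r M : (forall s, bd phi r s -> Cmod (h s) <= M) -> Cmod (kB phi h r) <= 4 * M.
Proof.
move=> H; have h1 := H _ (Or41 _ _ _ erefl); have h2 := H _ (Or42 _ _ _ erefl).
have h3 := H _ (Or43 _ _ _ erefl); have h4 := H _ (Or44 _ _ _ erefl).
rewrite kBE.
have m (x : C) t : Cmod (x * cis t) = Cmod x by rewrite Cmod_mult Cmod_cis Rmult_1_r.
apply: Rle_trans (Cmod_triangle _ _) _; rewrite m.
have := Cmod_sub_le (h (polar r (- phi)) * cis (- phi) - h (polar r phi) * cis phi)%C (h (- polar r (- phi))%C * cis (- phi))%C.
have := Cmod_sub_le (h (polar r (- phi)) * cis (- phi))%C (h (polar r phi) * cis phi)%C.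
rewrite !m; lra.
Qed.

Lemma continuous_polar_r t r : continuous (fun r => polar r t) r.
Proof.
apply: cC_pair; apply: (ex_derive_continuous (fun r => _ (polar r t))).
  by exists (Re (cis t)); exact: (proj1 (is_derive_polar_r r t)).
by exists (Im (cis t)); exact: (proj2 (is_derive_polar_r r t)).
Qed.

Lemma kB_cont h r : (forall s, bd phi r s -> continuous h s) -> continuous (kB phi h) r.
Proof.
move=> H; have h1 := H _ (Or41 _ _ _ erefl); have h2 := H _ (Or42 _ _ _ erefl).
have h3 := H _ (Or43 _ _ _ erefl); have h4 := H _ (Or44 _ _ _ erefl).
apply: (continuous_ext (fun r => _ : C) (kB phi h) r) => [x|]; first by rewrite kBE.
have c1 t : continuous h (polar r t) -> continuous (fun r => (h (polar r t) * cis t)%C) r.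
  move=> c; apply: cC_mult; last exact: cC_const.
  by apply: (cC_comp (f := fun r => polar r t)) => //; exact: continuous_polar_r.
have c2 t : continuous h (- polar r t)%C -> continuous (fun r => (h (- polar r t) * cis t)%C) r.
  move=> c; apply: cC_mult; last exact: cC_const.
  by apply: (cC_comp (f := fun r => (- polar r t)%C)) => //; apply: cC_opp; exact: continuous_polar_r.
by apply: cC_plus; [apply: cC_minus; [apply: cC_minus; exact: c1|]|]; exact: c2.
Qed.

Lemma kB_cint (K : C -> R -> C) (G : C -> C) r :
  (forall s, bd phi r s -> cint (K s) (G s)) ->
  cint (fun rho => kB phi (fun s => K s rho) r) (kB phi G r).
Proof.
move=> H; have h1 := H _ (Or41 _ _ _ erefl); have h2 := H _ (Or42 _ _ _ erefl).
have h3 := H _ (Or43 _ _ _ erefl); have h4 := H _ (Or44 _ _ _ erefl).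
have := cint_plus (cint_minus (cint_minus (cint_mult (cis (- phi)) h1) (cint_mult (cis phi) h2))
  (cint_mult (cis (- phi)) h3)) (cint_mult (cis phi) h4).
rewrite kBE.
have -> : (cis (- phi) * G (polar r (- phi)) - cis phi * G (polar r phi)
  - cis (- phi) * G (- polar r (- phi)) + cis phi * G (- polar r phi) =
  G (polar r (- phi)) * cis (- phi) - G (polar r phi) * cis phi
  - G (- polar r (- phi)) * cis (- phi) + G (- polar r phi) * cis phi)%C by ring.
by apply: cint_ext => rho _; rewrite kBE; ring.
Qed.

End Contour.

Lemma kB_swap phi1 phi2 (F : C -> C -> C) r rho :
  kB phi1 (fun s => kB phi2 (F s) rho) r = kB phi2 (fun p => kB phi1 (fun s => F s p) r) rho.
Proof. by rewrite !kBE; ring. Qed.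

(** The double contour integral consists of sixteen double ray integrals. They are gathered in one
    function [FF] on the quarter plane, dominated by [16 A B], and the real Fubini theorem is
    applied to its real and imaginary parts. *)
Lemma kB_fubini phi1 phi2 (F : C -> C -> C) (A B : R -> R) (LA LB : R) (G H : C -> C) (L M : C) :
  (forall r rho s p, 0 < r -> 0 < rho -> bd phi1 r s -> bd phi2 rho p ->
     continuous (fun q : C * C => F q.1 q.2) (s, p) /\ Cmod (F s p) <= A r * B rho) ->
  cont_pos A -> cont_pos B -> (forall r, 0 < r -> 0 <= A r) -> (forall r, 0 < r -> 0 <= B r) ->
  Ipos A LA -> Ipos B LB ->
  (forall r s, 0 < r -> bd phi1 r s -> cint (kB phi2 (F s)) (G s) /\ continuous G s) ->
  (forall rho p, 0 < rho -> bd phi2 rho p -> cint (kB phi1 (fun s => F s p)) (H p) /\ continuous H p) ->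
  cint (kB phi1 G) L -> cint (kB phi2 H) M -> L = M.
Proof.
move=> hF cA cB A0 B0 iA iB hG hH iL iM.
pose FF r rho := kB phi1 (fun s => kB phi2 (F s) rho) r.
have FFn r rho : 0 < r -> 0 < rho -> Cmod (FF r rho) <= (16 * A r) * B rho.
  move=> hr hrho; have -> : 16 * A r * B rho = 4 * (4 * (A r * B rho)) by ring.
  apply: kB_norm => s hs; apply: kB_norm => p hp.
  by case: (hF r rho s p hr hrho hs hp).
have FFc r rho : 0 < r -> 0 < rho -> continuous (fun q : R * R => FF q.1 q.2) (r, rho).
  move=> hr hrho.
  have cpt (a b : R * R -> C) : continuous a (r, rho) -> continuous b (r, rho) ->
      bd phi1 r (a (r, rho)) -> bd phi2 rho (b (r, rho)) ->
      continuous (fun q => F (a q) (b q)) (r, rho).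
    move=> ca cb ha hb; have [c _] := hF r rho _ _ hr hrho ha hb.
    exact: (continuous_comp_2 (V := C_UniformSpace) (W := C_UniformSpace) (X := C_UniformSpace) a b F).
  have c1 t : continuous (fun q : R * R => polar q.1 t) (r, rho).
    apply: (continuous_comp (fun q : R * R => q.1) (fun r => polar r t : C)).
      exact: (continuous_fst (U := R_UniformSpace) (V := R_UniformSpace)).
    exact: continuous_polar_r.
  have c2 t : continuous (fun q : R * R => polar q.2 t) (r, rho).
    apply: (continuous_comp (fun q : R * R => q.2) (fun r => polar r t : C)).
      exact: (continuous_snd (U := R_UniformSpace) (V := R_UniformSpace)).
    exact: continuous_polar_r.
  have k2 (a : R * R -> C) : continuous a (r, rho) -> bd phi1 r (a (r, rho)) ->
     continuous (fun q : R * R => kB phi2 (F (a q)) q.2) (r, rho).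
    move=> ca ha; apply: (continuous_ext (fun q : R * R => _ : C) _ (r, rho)) => [q|]; first by rewrite kBE.
    apply: cC_plus; [apply: cC_minus; [apply: cC_minus|]|]; (apply: cC_mult; last exact: cC_const);
      apply: cpt => //; try apply: cC_opp; try exact: c2.
    - exact: Or41.
    - exact: Or42.
    - exact: Or43.
    - exact: Or44.
  apply: (continuous_ext (fun q : R * R => _ : C) _ (r, rho)) => [q|]; first by rewrite /FF kBE.
  apply: cC_plus; [apply: cC_minus; [apply: cC_minus|]|]; (apply: cC_mult; last exact: cC_const).
  - by apply: (k2 (fun q : R * R => polar q.1 (- phi1))) => //; exact: Or41.
  - by apply: (k2 (fun q : R * R => polar q.1 phi1)) => //; exact: Or42.
  - by apply: (k2 (fun q : R * R => (- polar q.1 (- phi1))%C)); [apply: cC_opp; exact: c1|exact: Or43].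
  - by apply: (k2 (fun q : R * R => (- polar q.1 phi1)%C)); [apply: cC_opp; exact: c1|exact: Or44].
have i1 r : 0 < r -> cint (FF r) (kB phi1 G r).
  by move=> hr; apply: (kB_cint (K := fun s rho => kB phi2 (F s) rho)) => s hs; case: (hG r s hr hs).
have i2 rho : 0 < rho -> cint (fun r => FF r rho) (kB phi2 H rho).
  move=> hr.
  have := kB_cint (phi := phi2) (K := fun p r => kB phi1 (fun s => F s p) r) (G := H) (r := rho).
  move=> H1; apply: (cint_ext _ (H1 _)) => [r _|p hp]; first by rewrite /FF kB_swap.
  by case: (hH rho p hr hp).
have cG : cont_pos (kB phi1 G) by move=> r hr; apply: kB_cont => s hs; case: (hG r s hr hs).
have cH : cont_pos (kB phi2 H) by move=> r hr; apply: kB_cont => s hs; case: (hH r s hr hs).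
have iA' : Ipos (fun r => 16 * A r) (16 * LA) by exact: Ipos_mult.
have cA' : cont_pos (fun r => 16 * A r).
  by move=> r hr; apply: cR_mult; [exact: continuous_const|exact: cA].
have A0' r : 0 < r -> 0 <= 16 * A r by move=> /A0; lra.
case: iL => L1 L2; case: iM => M1 M2.
apply: injective_projections.
- apply: (Fubini_pos (F := fun r rho => Re (FF r rho)) (A := fun r => 16 * A r) (B := B)
    (G := fun r => Re (kB phi1 G r)) (H := fun r => Re (kB phi2 H r)) (LA := 16 * LA) (LB := LB)) => //.
  + by move=> r rho hr hrho; apply/continuity_2d_pt_filterlim; exact: (cC_Re (FFc r rho hr hrho)).
  + by move=> r hr; exact: (cC_Re (cG r hr)).
  + by move=> r hr; exact: (cC_Re (cH r hr)).
  + by move=> r rho hr hrho; apply: Rle_trans (re_le_Cmod _) _; exact: FFn.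
  + by move=> r hr; exact: (proj1 (i1 r hr)).
  + by move=> r hr; exact: (proj1 (i2 r hr)).
- apply: (Fubini_pos (F := fun r rho => Im (FF r rho)) (A := fun r => 16 * A r) (B := B)
    (G := fun r => Im (kB phi1 G r)) (H := fun r => Im (kB phi2 H r)) (LA := 16 * LA) (LB := LB)) => //.
  + by move=> r rho hr hrho; apply/continuity_2d_pt_filterlim; exact: (cC_Im (FFc r rho hr hrho)).
  + by move=> r hr; exact: (cC_Im (cG r hr)).
  + by move=> r hr; exact: (cC_Im (cH r hr)).
  + move=> r rho hr hrho; apply: Rle_trans (FFn r rho hr hrho).
    by apply: Rle_trans (Rmax_Cmod (FF r rho)); exact: Rmax_r.
  + by move=> r hr; exact: (proj2 (i1 r hr)).
  + by move=> r hr; exact: (proj2 (i2 r hr)).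
Qed.

Lemma hol1_opp_arg E d z : hol1 E d (- z)%C ->
  hol1 (fun s => E (- s)%C) (fun s => (d (- s) * (0 * s + - 1 * 1))%C) z.
Proof.
move=> h; have m1 := hol1_mult (hol1_const (- 1)%C z) (hol1_id z).
have e1 s : (- 1 * s)%C = (- s)%C by ring.
have := hol1_comp (g := E) m1; rewrite e1 => /(_ _ h) [H1 H2]; split.
  by move: H1; rewrite e1; apply: hol_ext_loc; apply: filter_forall => w; rewrite e1.
by apply: (continuous_ext _ _ _ _ H2) => w; rewrite e1.
Qed.

Section BisectorCauchy.
Variables (E d : C -> C) (phi th : R).
Hypothesis hphi : 0 < phi < th.
Hypothesis hth : th <= PI / 2.
Hypothesis hE : on_bisector th (hol1 E d).
Hypothesis mE : bmild th E.

Let dm s := (d (- s) * (0 * s + - 1 * 1))%C.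

(** On the left half, [s -> - s] turns the integrand into [E(- s) / (s - (- w))]. Both halves thus
    fall under the theorem for the right sector, with poles [w] and [- w] outside of it. *)
Lemma bisector_cauchy_zero (w : C) : w <> 0%C ->
  (forall r t, 0 < r -> - th < t < th -> polar r t <> w /\ polar r t <> (- w)%C) ->
  cint (kB phi (fun s => (E s / (s - w))%C)) 0%C.
Proof.
move=> w0 hw; case: mE => m1 m2.
have nw0 : (- w)%C <> 0%C by move=> e; apply: w0; have -> : w = (- - w)%C; [ring|rewrite e; ring].
have z1 : cint (kR phi (fun s => (E s / (s - w))%C)) 0%C.
  apply: (sector_cauchy (d := d_over_shift E d w) hphi).
    by move=> r t hr ht; apply: hol1_over_shift; [case: (hE hr ht)|case: (hw r t hr ht)].
  exact: mild_div.
have z2 : cint (kR phi (fun s => (E (- s) / (s - - w))%C)) 0%C.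
  apply: (sector_cauchy (d := d_over_shift (fun s => E (- s)%C) dm (- w)%C) hphi).
    move=> r t hr ht; apply: (hol1_over_shift (E := fun s => E (- s)%C)); last by case: (hw r t hr ht).
    by apply: hol1_opp_arg; case: (hE hr ht).
  exact: (mild_div (E := fun s => E (- s)%C)).
have := cint_plus z1 z2; rewrite Cplus_0_l; apply: cint_ext => r hr; rewrite /kB; congr Cplus.
rewrite /kR /ray.
have k t : t = - phi \/ t = phi -> (- (E (- polar r t) / (- polar r t - w)))%C = (E (- polar r t) / (polar r t - - w))%C.
  move=> ht; have ht' : - th < t < th by lra.
  have [_ n1] := hw r t hr ht'.
  have n2 : (polar r t - - w)%C <> 0%C by move=> /Csub_eq0.
  have n3 : (- polar r t - w)%C <> 0%C.
    by move=> e; apply: n2; have -> : (polar r t - - w = - (- polar r t - w))%C; [ring|rewrite e; ring].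
  by field.
by rewrite !k; [|right|left].
Qed.

(** Exactly one half of the double sector surrounds [p]; there Cauchy's formula applies, and the
    other half contributes 0. Reflection at 0 reduces the left half to the right one. *)
Lemma bisector_cauchy_formula (p : C) (rho psi : R) :
  0 < rho -> - phi < psi < phi -> p = polar rho psi \/ p = (- polar rho psi)%C ->
  cint (kB phi (fun s => (E s / (s - p))%C)) (2 * RtoC PI * Ci * E p)%C.
Proof.
move=> hrho hpsi hp; case: mE => m1 m2.
have hphi2 : phi < th by lra.
have repos r t : 0 < r -> - th < t < th -> 0 < Re (polar r t).
  by move=> hr ht; rewrite /polar /=; apply: Rmult_lt_0_compat => //; apply: cos_gt_0; lra.
have neg r t : 0 < r -> - th < t < th -> polar r t <> (- polar rho psi)%C.
  move=> hr ht e; have := repos r t hr ht; have hpsi' : - th < psi < th by lra.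
  by have := repos rho psi hrho hpsi'; rewrite e /=; lra.
have p0 : polar rho psi <> 0%C by exact: polar_neq0.
have np0 : (- polar rho psi)%C <> 0%C.
  by move=> e; apply: p0; have -> : polar rho psi = (- - polar rho psi)%C; [ring|rewrite e; ring].
have hEm : on_sector th (hol1 (fun s => E (- s)%C) dm).
  by move=> r t hr ht; apply: hol1_opp_arg; case: (hE hr ht).
have zero F dF : on_sector th (hol1 F dF) -> mild (- th) th F ->
    cint (kR phi (fun s => (F s / (s - - polar rho psi))%C)) 0%C.
  move=> hF mF; apply: (sector_cauchy (d := d_over_shift F dF (- polar rho psi)%C) hphi).
    by move=> r t hr ht; apply: hol1_over_shift; [exact: hF|exact: neg].
  exact: mild_div.
have form F dF : on_sector th (hol1 F dF) -> mild (- th) th F ->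
    cint (kR phi (fun s => (F s / (s - polar rho psi))%C)) (2 * RtoC PI * Ci * F (polar rho psi))%C.
  by move=> hF mF; apply: (sector_cauchy_formula (d := dF) (th := th)).
have hEp : on_sector th (hol1 E d) by move=> r t hr ht; case: (hE hr ht).
have npol t r : t = - phi \/ t = phi -> 0 < r -> polar r t <> polar rho psi.
  move=> ht hr; have hs : sin (t - psi) <> 0; last by case: (polar_neq hr hrho hs).
  have hpi := PI_RGT_0.
  case: ht => ->; [apply: Rlt_not_eq; apply: sin_lt_0_var; lra|apply: Rgt_not_eq; apply: sin_gt_0; lra].
have flip t r q : (- polar r t - q)%C <> 0%C ->
    (- (E (- polar r t) / (- polar r t - q)))%C = (E (- polar r t) / (polar r t - - q))%C.
  move=> n3; have n2 : (polar r t - - q)%C <> 0%C.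
    by move=> e; apply: n3; have -> : (- polar r t - q = - (polar r t - - q))%C; [ring|rewrite e; ring].
  by field.
case: hp => ->.
  have := cint_plus (form _ _ hEp m1) (zero _ _ hEm m2).
  rewrite Cplus_0_r; apply: cint_ext => r hr; rewrite /kB; congr Cplus; rewrite /kR /ray.
  have k t : t = - phi \/ t = phi -> (- polar r t - polar rho psi)%C <> 0%C.
    move=> ht /Csub_eq0 e; have ht' : - th < t < th by lra.
    by apply: (neg r t hr ht'); rewrite -e; ring.
  by rewrite !flip //; apply: k; [right|left].
have := cint_plus (zero _ _ hEp m1) (form _ _ hEm m2).
rewrite Cplus_0_l; apply: cint_ext => r hr; rewrite /kB; congr Cplus; rewrite /kR /ray.
have k t : t = - phi \/ t = phi -> (- polar r t - - polar rho psi)%C <> 0%C.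
  move=> ht /Csub_eq0 e; apply: (npol t r ht hr).
  have -> : polar r t = (- - polar r t)%C by ring.
  by rewrite e; ring.
have e3 s : (s - - - polar rho psi = s - polar rho psi)%C by ring.
by rewrite !flip ?e3 //; apply: k; [right|left].
Qed.

End BisectorCauchy.

(** Each of the four rays is rotated within its own band between the two contours, as [h] need not
    be holomorphic closer to the real axis, where the spectrum lies. *)
Lemma bisector_rotation (h d : C -> C) (lo hi phi1 phi2 : R) :
  lo < phi1 < hi -> lo < phi2 < hi ->
  (forall r t, 0 < r -> lo < t < hi \/ - hi < t < - lo ->
     hol1 h d (polar r t) /\ hol1 h d (- polar r t)%C) ->
  (forall a b, a = lo /\ b = hi \/ a = - hi /\ b = - lo ->
     vanishing a b h /\ vanishing a b (fun s => h (- s)%C)) ->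
  cint (fun r => (kB phi2 h r - kB phi1 h r)%C) 0%C.
Proof.
move=> h1 h2 hh hv.
have P1 : lo = lo /\ hi = hi \/ lo = - hi /\ hi = - lo by left.
have P2 : - hi = lo /\ - lo = hi \/ - hi = - hi /\ - lo = - lo by right.
have [v1 v2] := hv _ _ P1; have [v3 v4] := hv _ _ P2.
have rot a b x y F dF : a < x < b -> a < y < b ->
    (forall r t, 0 < r -> a < t < b -> hol1 F dF (polar r t)) -> vanishing a b F ->
    cint (fun r => (ray F y r - ray F x r)%C) 0%C.
  move=> hx hy hF vF; apply: (ray_rotation (lo := a) (hi := b) (rho := 0) (d := dF)) => //.
    by move=> r t hr ht; exact: hol1_cont (hF r t hr ht).
  by move=> r t hr _ ht; exact: hF.
pose hm s := h (- s)%C; pose dm s := (d (- s) * (0 * s + - 1 * 1))%C.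
have r1 : cint (fun r => (ray h phi2 r - ray h phi1 r)%C) 0%C.
  apply: (rot lo hi phi1 phi2 h d) => // r t hr ht.
  by have [] := hh r t hr (or_introl ht).
have r2 : cint (fun r => (ray h (- phi2) r - ray h (- phi1) r)%C) 0%C.
  apply: (rot (- hi) (- lo) (- phi1) (- phi2) h d) => //; try lra; move=> r t hr ht.
  by have [] := hh r t hr (or_intror ht).
have r3 : cint (fun r => (ray hm phi2 r - ray hm phi1 r)%C) 0%C.
  apply: (rot lo hi phi1 phi2 hm dm) => // r t hr ht.
  by apply: hol1_opp_arg; have [] := hh r t hr (or_introl ht).
have r4 : cint (fun r => (ray hm (- phi2) r - ray hm (- phi1) r)%C) 0%C.
  apply: (rot (- hi) (- lo) (- phi1) (- phi2) hm dm) => //; try lra; move=> r t hr ht.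
  by apply: hol1_opp_arg; have [] := hh r t hr (or_intror ht).
have := cint_minus (cint_plus r2 r3) (cint_plus r1 r4).
have -> : (0 + 0 - (0 + 0) = 0)%C by ring.
by apply: cint_ext => r hr; rewrite !kBE /ray /hm; ring.
Qed.

(** The same four rays, with reversed orientation, bound the double sector of half opening
    [PI / 2 - phi] around the imaginary axis; [s = i w] moves it to the real axis. *)
Lemma kB_complement phi h r :
  kB phi h r = (- kB (PI / 2 - phi) (fun s => Ci * h (Ci * s)) r)%C.
Proof.
have I2 : (Ci * Ci = - 1)%C by rewrite /Ci /Cmult /Copp /RtoC /=; congr pair; ring.
have e1 : (Ci * cis (PI / 2 - phi) = - cis (- phi))%C.
  rewrite /cis cos_shift sin_shift cos_neg sin_neg /Ci /Cmult /Copp /=; congr pair; ring.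
have e2 : (Ci * cis (- (PI / 2 - phi)) = cis phi)%C.
  rewrite /cis cos_neg sin_neg cos_shift sin_shift /Ci /Cmult /=; congr pair; ring.
rewrite !kBE !polarE.
have f1 : (Ci * (RtoC r * cis (PI / 2 - phi)) = - (RtoC r * cis (- phi)))%C.
  have -> : (Ci * (RtoC r * cis (PI / 2 - phi)) = RtoC r * (Ci * cis (PI / 2 - phi)))%C by ring.
  by rewrite e1; ring.
have f2 : (Ci * (RtoC r * cis (- (PI / 2 - phi))) = RtoC r * cis phi)%C.
  have -> : (Ci * (RtoC r * cis (- (PI / 2 - phi))) = RtoC r * (Ci * cis (- (PI / 2 - phi))))%C by ring.
  by rewrite e2.
have g1 : (Ci * - (RtoC r * cis (PI / 2 - phi)) = RtoC r * cis (- phi))%C.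
  have -> : (Ci * - (RtoC r * cis (PI / 2 - phi)) = - (Ci * (RtoC r * cis (PI / 2 - phi))))%C by ring.
  by rewrite f1; ring.
have g2 : (Ci * - (RtoC r * cis (- (PI / 2 - phi))) = - (RtoC r * cis phi))%C.
  have -> : (Ci * - (RtoC r * cis (- (PI / 2 - phi))) = - (Ci * (RtoC r * cis (- (PI / 2 - phi)))))%C by ring.
  by rewrite f2.
rewrite f1 f2 g1 g2.
have e3 : cis (- phi) = (- (Ci * cis (PI / 2 - phi)))%C by rewrite e1; ring.
have e4 : cis phi = (Ci * cis (- (PI / 2 - phi)))%C by rewrite e2.
move: (h _) (h _) (h _) (h _) => a b c e.
by rewrite e3 e4; ring.
Qed.

Import GRing.Theory.
Implicit Types (z : C).

(** * Slices of the Clifford algebra *)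

Section CliffordFacts.
Variable n : nat.
Implicit Types (x y s J : clifford n) (A B : {set 'I_n}).

(** [e_A e_B] is a multiple of 1 only when the symmetric difference of [A] and [B] is empty, that is
    for [A = B]. *)
Lemma Sc_mul x y : Sc (x * y)%R = (\sum_A coef x A * coef y A * blade_sign A A)%R.
Proof.
rewrite /Sc /GRing.mul /= /cl_mul Defs.coef_sum; apply: eq_bigr => A _.
rewrite Defs.coef_sum (bigD1 A) //= Defs.coefZ coef_blade symdiffxx eqxx mulr1 big1 ?addr0 // => B nB.
rewrite Defs.coefZ coef_blade; case: eqP => [e|_]; last by rewrite mulr0.
case/negP: nB; apply/eqP/setP => i.
by move/setP/(_ i): e; rewrite !inE; case: (i \in A); case: (i \in B).
Qed.

Lemma Sc_mulC x y : Sc (x * y)%R = Sc (y * x)%R.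
Proof. by rewrite !Sc_mul; apply: eq_bigr => A _; rewrite [(coef x A * _)%R]mulrC. Qed.

Lemma Sc_conj x : Sc (conj x) = Sc x.
Proof. by rewrite /Sc coef_conj blade_sign0l mulr1. Qed.

Lemma ScD x y : Sc (x + y)%R = Sc x + Sc y.
Proof. exact: Defs.coefD. Qed.

Lemma ScZ (a : R) x : Sc (a *: x)%R = a * Sc x.
Proof. exact: Defs.coefZ. Qed.

Lemma Sc1 : Sc (1 : clifford n)%R = 1.
Proof. by rewrite /Sc coef_blade eqxx. Qed.

Lemma sum_sqr_ge0 x : 0 <= (\sum_A coef x A ^+ 2)%R.
Proof.
apply: (big_ind (fun a : R => 0 <= a)); first exact: Rle_refl.
  by move=> a b; exact: Rplus_le_le_0_compat.
by move=> A _; rewrite expr2; exact: Rle_0_sqr.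
Qed.

Lemma cl_norm_ge0 x : 0 <= cl_norm x.
Proof. exact: sqrt_pos. Qed.

Lemma cl_norm_sqr x : cl_norm x * cl_norm x = Sc (conj x * x)%R.
Proof.
rewrite /cl_norm sqrt_sqrt; last exact: sum_sqr_ge0.
rewrite Sc_mul; apply: eq_bigr => A _; rewrite coef_conj.
have sgnK : (blade_sign A A * blade_sign A A = 1)%R.
  by rewrite /blade_sign -expr2 sqrr_sign.
by rewrite -[LHS]mulr1 -sgnK expr2 /GRing.mul /=; ring.
Qed.

(** Adding the double sum for [J * J] to its transpose cancels the off-diagonal terms by
    anticommutation and leaves [-2] times the sum of the squares. *)
Lemma sphere_sqr J : sphere J -> (J * J = - 1)%R.
Proof.
move=> [x [-> hx]]; set S := (\sum_i _)%R.
have SS : (S * S = \sum_i \sum_j (x i * x j) *: (gen i * gen j) :> clifford n)%R.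
  rewrite {1}/S mulr_suml; apply: eq_bigr => i _.
  by rewrite mulr_sumr; apply: eq_bigr => j _; rewrite -scalerAl -scalerAr scalerA.
have SS' : (S * S = \sum_i \sum_j (x i * x j) *: (gen j * gen i) :> clifford n)%R.
  rewrite SS exchange_big /=; apply: eq_bigr => i _; apply: eq_bigr => j _.
  by rewrite [(x j * x i)%R]mulrC.
have e2 : (S * S + S * S = - 1 - 1)%R.
  rewrite {1}SS SS' -big_split /=.
  transitivity (\sum_i (x i ^+ 2) *: (- 1 - 1) : clifford n)%R.
    apply: eq_bigr => i _; rewrite -big_split /= (bigD1 i) //= big1 ?addr0 => [|j nj].
      by rewrite -scalerDr gen_sqr expr2.
    by rewrite -scalerDr gen_anticomm 1?eq_sym // addNr scaler0.
  by rewrite -scaler_suml hx scale1r.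
have e3 : ((1 + 1) *: (S * S) = (1 + 1) *: (- 1) :> clifford n)%R.
  by rewrite !scalerDl !scale1r e2.
have n2 : (1 + 1 : R)%R != 0%R.
  by apply/eqP => h; have := R1_neq_R0; move: h; rewrite /GRing.add /GRing.zero /GRing.one /=; lra.
have := congr1 (fun y : clifford n => ((1 + 1)^-1 *: y)%R) e3.
by rewrite !scalerA mulVf // !scale1r.
Qed.

Lemma sphere_conj J : sphere J -> conj J = (- J)%R.
Proof.
move=> [x [-> _]]; rewrite conj_sum -sumrN; apply: eq_bigr => i _.
by rewrite conjZ conj_gen scalerN.
Qed.

Lemma sphere_Sc J : sphere J -> Sc J = 0.
Proof.
move=> /sphere_conj h; have := Sc_conj J; rewrite h /Sc Defs.coefN.
by rewrite /GRing.opp /=; lra.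
Qed.

Lemma conj1 : conj (1 : clifford n)%R = 1%R.
Proof.
by apply: Defs.coefE => A; rewrite coef_conj coef_blade; case: eqP => [->|_];
  rewrite ?blade_sign0l ?mulr1 ?mul0r.
Qed.

(** The isomorphism from C onto the slice C_J that sends [i] to [J]; it moves computations in a
    slice to the field C. *)
Definition emb J (z : C) : clifford n := slice J (Re z) (Im z).

Lemma embD J z w : emb J (z + w)%C = (emb J z + emb J w)%R.
Proof.
rewrite /emb /slice.
have -> : Re (z + w)%C = (Re z + Re w)%R by [].
have -> : Im (z + w)%C = (Im z + Im w)%R by [].
by rewrite !scalerDl addrACA.
Qed.

Lemma embM J z w : sphere J -> emb J (z * w)%C = (emb J z * emb J w)%R.
Proof.
move=> /sphere_sqr hJ; rewrite /emb /slice.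
rewrite mulrDl !mulrDr -!scalerAl !mul1r -!scalerAr !mulr1 hJ !scalerA.
rewrite scalerN -scaleNr.
have -> : Re (z * w)%C = (Re z * Re w + - (Im z * Im w))%R by [].
have -> : Im (z * w)%C = (Re z * Im w + Im z * Re w)%R by [].
rewrite !scalerDl -!addrA; congr (_ + _)%R.
rewrite addrC -!addrA; congr (_ + _)%R.
Qed.

Lemma emb1 J : emb J 1%C = 1%R.
Proof. by rewrite /emb /slice /= scale1r scale0r addr0. Qed.

Lemma emb_R J (a : R) : emb J (RtoC a) = (a%:A)%R.
Proof. by rewrite /emb /slice /= scale0r addr0. Qed.

Lemma embZ J (a : R) z : emb J (RtoC a * z)%C = (a *: emb J z)%R.
Proof.
rewrite /emb /slice scalerDr !scalerA; congr (_ *: _ + _ *: _)%R.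
  by rewrite /Re /= /GRing.mul /=; ring.
by rewrite /Im /= /GRing.mul /=; ring.
Qed.

Lemma embN J z : emb J (- z)%C = (- emb J z)%R.
Proof. by rewrite /emb /slice opprD -!scaleNr. Qed.

Lemma embCi J : emb J Ci = J.
Proof. by rewrite /emb /slice /= scale0r scale1r add0r. Qed.

Lemma emb_conj J z : sphere J -> conj (emb J z) = emb J (Cconj z).
Proof. by move=> hJ; rewrite /emb /slice conjD !conjZ conj1 sphere_conj // scalerN -scaleNr. Qed.

Lemma Sc_emb J z : sphere J -> Sc (emb J z) = Re z.
Proof. by move=> hJ; rewrite /emb /slice ScD !ScZ Sc1 sphere_Sc //; lra. Qed.

Lemma cl_norm_emb J z : sphere J -> cl_norm (emb J z) = Cmod z.
Proof.
move=> hJ; have := cl_norm_sqr (emb J z).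
rewrite emb_conj // -embM // Sc_emb // => e.
apply: Rsqr_inj; [exact: cl_norm_ge0|exact: Cmod_ge_0|].
rewrite /Rsqr e /Cmod sqrt_sqrt; last by nra.
by rewrite /=; ring.
Qed.

Lemma emb_paravector J z : sphere J -> paravector (emb J z).
Proof.
move=> [x [-> _]]; exists (Re z), (fun i => (Im z * x i)%R).
rewrite /emb /slice scaler_sumr; congr (_ + _)%R; apply: eq_bigr => i _.
by rewrite scalerA.
Qed.

Lemma sphere_gen (i : 'I_n) : sphere (gen i).
Proof.
exists (fun j => if j == i then 1 else 0); split.
  rewrite (bigD1 i) //= eqxx scale1r big1 ?addr0 // => j /negbTE ->; exact: scale0r.
by rewrite (bigD1 i) //= eqxx expr1n big1 ?addr0 // => j /negbTE ->; rewrite expr0n.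
Qed.

(** [J] is the normalised vector part of [s]. A real [s] lies in every slice, and [0 < n] provides a
    generator to take as [J]. *)
Lemma paravector_emb s : (0 < n)%N -> paravector s -> exists J z, [/\ sphere J, 0 <= Im z & s = emb J z].
Proof.
move=> hn [x0 [x ->]].
pose N := (\sum_i x i ^+ 2)%R : R.
have N0 : 0 <= N.
  apply: (big_ind (fun a : R => 0 <= a)); first exact: Rle_refl.
    by move=> a b; exact: Rplus_le_le_0_compat.
  by move=> A _; rewrite expr2; exact: Rle_0_sqr.
case: N0 => N0.
  pose k i : R := x i / sqrt N.
  exists (\sum_i k i *: gen i)%R, (x0, sqrt N).
  have s0 := sqrt_lt_R0 _ N0.
  split; last 1 first.
  - rewrite /emb /slice /Re /Im /= scaler_sumr; congr (_ + _)%R; apply: eq_bigr => i _.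
    rewrite scalerA; congr (_ *: _)%R; rewrite /k /GRing.mul /=; field; lra.
  - exists k; split=> //.
    transitivity (\sum_i (x i ^+ 2) * / N : R)%R.
      apply: eq_bigr => i _; rewrite !expr2 /k /GRing.mul /=.
      have aux (r a : R) : 0 < r -> a / r * (a / r) = a * a * / (r * r) by move=> hr; field; lra.
      by have := aux _ (x i) s0; rewrite sqrt_sqrt //; lra.
    by rewrite -mulr_suml; change (N * / N = 1); field; lra.
  - exact: sqrt_pos.
exists (gen (Ordinal hn)), (RtoC x0); split.
- exact: sphere_gen.
- exact: Rle_refl.
rewrite emb_R big1 ?addr0 // => i _.
have -> : x i = 0; last exact: scale0r.
apply: Rsqr_0_uniq; apply: Rle_antisym; last exact: Rle_0_sqr.
rewrite [X in _ <= X]N0 /N (bigD1 i) //= expr2.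
have := (big_ind (fun a : R => 0 <= a) (Rle_refl 0) (fun a b => @Rplus_le_le_0_compat a b)).
move=> H; have h : 0 <= (\sum_(j | j != i) x j ^+ 2)%R by apply: H => j _; rewrite expr2; exact: Rle_0_sqr.
move: h; move: (\sum_(j | _) _)%R => S h.
by rewrite /Rsqr /GRing.add /GRing.mul /=; lra.
Qed.

(** The passage from a nonnegative quadratic polynomial to the Cauchy-Schwarz inequality, used for
    the Clifford norm and for the scalar product of [V]. *)
Lemma discriminant (a b c : R) : 0 <= a -> 0 <= c ->
  (forall t, 0 <= a * (t * t) + 2 * b * t + c) -> b * b <= a * c.
Proof.
move=> ha hc h; case: ha => ha; last first.
  subst a; case: (Req_dec b 0) => [->|nb]; first by lra.
  (* For [a = 0] the polynomial is affine, and it takes the value [-1] here. *)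
  have := h (- (c + 1) / (2 * b)).
  have -> : 2 * b * (- (c + 1) / (2 * b)) = - (c + 1) by field.
  by lra.
have := h (- b / a).
have -> : a * (- b / a * (- b / a)) + 2 * b * (- b / a) + c = c - b * b / a by field; lra.
move=> h1; have : b * b / a <= c by lra.
by move/(Rle_div_l _ _ _ ha); lra.
Qed.

Lemma cl_norm_triangle x y : cl_norm (x + y)%R <= cl_norm x + cl_norm y.
Proof.
have nx := cl_norm_ge0 x; have ny := cl_norm_ge0 y.
have SC : Sc (conj x * y)%R = Sc (conj y * x)%R.
  by rewrite !Sc_mul; apply: eq_bigr => A _; rewrite !coef_conj /GRing.mul /=; ring.
have E (t : R) : cl_norm (t *: x + y)%R * cl_norm (t *: x + y)%R =
    cl_norm x * cl_norm x * (t * t) + 2 * Sc (conj x * y)%R * t + cl_norm y * cl_norm y.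
  rewrite !cl_norm_sqr conjD conjZ mulrDl !mulrDr -!scalerAl -!scalerAr !ScD !ScZ SC.
  move: (Sc (conj y * x)%R) (Sc (conj x * x)%R) (Sc (conj y * y)%R) => a b c; ring.
have D : Sc (conj x * y)%R * Sc (conj x * y)%R <= cl_norm x * cl_norm x * (cl_norm y * cl_norm y).
  apply: discriminant; try nra.
  by move=> t; rewrite -E; nra.
have D' : Sc (conj x * y)%R <= cl_norm x * cl_norm y by apply: Rsqr_incr_0_var; [rewrite /Rsqr; nra|nra].
have := E 1; rewrite scale1r => E1.
apply: Rsqr_incr_0_var; [rewrite /Rsqr E1; nra|lra].
Qed.

Lemma Sc_le_norm x : Rabs (Sc x) <= cl_norm x.
Proof.
rewrite -(Rabs_pos_eq (cl_norm x)); last exact: cl_norm_ge0.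
apply: Rsqr_le_abs_0; rewrite /Rsqr /cl_norm sqrt_sqrt; last exact: sum_sqr_ge0.
rewrite (bigD1 set0) //= expr2.
have H : 0 <= (\sum_(A | A != set0) coef x A ^+ 2)%R.
  apply: (big_ind (fun a : R => 0 <= a)); first exact: Rle_refl.
    by move=> a b; exact: Rplus_le_le_0_compat.
  by move=> A _; rewrite expr2; exact: Rle_0_sqr.
move: H; move: (\sum_(A | _) _)%R => S H.
by rewrite /Sc /GRing.add /GRing.mul /=; lra.
Qed.

End CliffordFacts.

(** * Polar form, sectors and double sectors inside a slice *)

Lemma Cmod_Re_le (z : C) : Rabs (Re z) <= Cmod z.
Proof. exact: re_le_Cmod. Qed.

Lemma Cmod_sqr (z : C) : Cmod z * Cmod z = Re z * Re z + Im z * Im z.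
Proof. rewrite /Cmod sqrt_sqrt; [by rewrite /Re /Im /=; ring|by nra]. Qed.

Lemma polar_form (z : C) : z <> 0%C -> exists t, - PI <= t <= PI /\ z = polar (Cmod z) t.
Proof.
move=> /Cmod_gt_0 hz; have hR := Cmod_Re_le z.
pose c := Re z / Cmod z.
have hc : -1 <= c <= 1.
  move/Rabs_le_between: hR => hR.
  by split; rewrite /c; [apply/Rle_div_r => //; lra|apply/Rle_div_l => //; lra].
have cE : Cmod z * c = Re z by rewrite /c; field; lra.
have [b0 b1] := acos_bound c; have eC := cos_acos c hc.
have eS := sin_acos c hc.
have sE : Cmod z * sin (acos c) = Rabs (Im z).
  apply: Rsqr_inj; [|exact: Rabs_pos|].
    by apply: Rmult_le_pos; [lra|apply: sin_ge_0; lra].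
  rewrite -Rsqr_abs /Rsqr.
  have -> : Cmod z * sin (acos c) * (Cmod z * sin (acos c)) =
      Cmod z * Cmod z * (sin (acos c) * sin (acos c)) by ring.
  rewrite eS sqrt_sqrt; last by rewrite /Rsqr; nra.
  have -> : Cmod z * Cmod z * (1 - Rsqr c) = Cmod z * Cmod z - (Cmod z * c) * (Cmod z * c) by rewrite /Rsqr; ring.
  by rewrite cE Cmod_sqr; ring.
case: (Rle_dec 0 (Im z)) => hi.
  exists (acos c); split; first lra.
  rewrite Rabs_pos_eq // in sE.
  by rewrite /polar eC cE sE; case: (z).
exists (- acos c); split; first lra.
rewrite Rabs_left in sE; last lra.
rewrite /polar cos_neg sin_neg eC cE.
have -> : Cmod z * - sin (acos c) = Im z by rewrite -[RHS]Ropp_involutive -sE; ring.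
by case: (z).
Qed.

Lemma cos_lt_abs t th : 0 < th <= PI -> - th < t < th -> cos th < cos t.
Proof.
move=> hth ht; case: (Rle_dec 0 t) => h; first by apply: cos_decreasing_1; lra.
by rewrite -(cos_neg t); apply: cos_decreasing_1; lra.
Qed.

Section Sectors.
Variables (n : nat) (J : clifford n).
Hypothesis hJ : sphere J.

Lemma emb0 : emb J 0%C = 0%R.
Proof. by rewrite emb_R scale0r. Qed.

Lemma emb_eq0 z : emb J z = 0%R -> z = 0%C.
Proof. by move=> e; apply: Cmod_eq_0; rewrite -(cl_norm_emb _ hJ) e -emb0 cl_norm_emb // Cmod_0. Qed.

(** Monotonicity of the cosine replaces [Arg] by an inequality between [Re z] and [|z|], which
    behaves well under limits and under squaring. *)
Lemma sector_emb th z : 0 < th <= PI ->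
  sector th (emb J z) <-> z <> 0%C /\ cos th * Cmod z < Re z.
Proof.
move=> hth; rewrite /sector /Arg Sc_emb // cl_norm_emb //.
have key : z <> 0%C -> (acos (Re z / Cmod z) < th <-> cos th * Cmod z < Re z).
  move=> /Cmod_gt_0 hz; have hR := Cmod_Re_le z.
  have hc : -1 <= Re z / Cmod z <= 1.
    move/Rabs_le_between: hR => hR.
    by split; [apply/Rle_div_r => //; lra|apply/Rle_div_l => //; lra].
  have [b0 b1] := acos_bound (Re z / Cmod z).
  split=> h.
    apply/Rlt_div_r => //; rewrite -(cos_acos _ hc).
    by apply: cos_decreasing_1; lra.
  have {}h : cos th < Re z / Cmod z by apply/Rlt_div_r.
  rewrite -(cos_acos _ hc) in h.
  by apply: cos_decreasing_0; lra.
split.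
  move=> [_ [h1 h2]]; have z0 : z <> 0%C by move=> e; apply: h1; rewrite e emb0.
  by split=> //; apply/key.
move=> [h1 h2]; split; first exact: emb_paravector.
by split; [move/emb_eq0|apply/key].
Qed.

Lemma bisector_emb th z : 0 < th <= PI ->
  bisector th (emb J z) <-> z <> 0%C /\ cos th * Cmod z < Rabs (Re z).
Proof.
move=> hth; rewrite /bisector -embN !sector_emb // Cmod_opp.
split.
  move=> [[h1 h2]|[h1 h2]].
    by split=> //; apply: Rlt_le_trans h2 _; exact: Rle_abs.
  split; first by move=> e; apply: h1; rewrite e; ring.
  apply: Rlt_le_trans h2 _; rewrite -Rabs_Ropp; exact: Rle_abs.
move=> [h1 h2]; case: (Rle_dec 0 (Re z)) => h.
  by left; split=> //; rewrite Rabs_pos_eq in h2.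
right; split.
  by move=> e; apply: h1; have -> : z = (- - z)%C; [ring|rewrite e; ring].
by rewrite Rabs_left in h2 => //=; lra.
Qed.

Lemma sector_polar th r t : 0 < th <= PI -> 0 < r -> - th < t < th -> sector th (emb J (polar r t)).
Proof.
move=> hth hr ht; apply/sector_emb => //; split; first exact: polar_neq0.
by rewrite Cmod_polar // /polar /=; have := cos_lt_abs hth ht; nra.
Qed.

Lemma bisector_polar th r t : 0 < th <= PI -> 0 < r -> - th < t < th ->
  bisector th (emb J (polar r t)) /\ bisector th (emb J (- polar r t)%C).
Proof.
move=> hth hr ht; have h := sector_polar hth hr ht.
by split; [left|right]; rewrite -?embN //; have -> : (- - polar r t)%C = polar r t by ring.
Qed.

(** Adding a small positive real number makes the inequality strict, since [|cos th| < 1]; this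
    covers the vertex 0 as well. *)
Lemma closure_sector z th : 0 < th < PI -> cos th * Cmod z <= Re z ->
  cl_closure (@sector n th) (emb J z).
Proof.
move=> hth hz; split; first exact: emb_paravector.
move=> eps heps; exists (emb J (z + RtoC (eps / 2))%C); split; last first.
  have -> : (emb J z - emb J (z + RtoC (eps / 2))%C)%R = emb J (- RtoC (eps / 2))%C.
    by rewrite -embN -embD; congr emb; ring.
  by rewrite cl_norm_emb // Cmod_opp Cmod_R Rabs_pos_eq; lra.
have h1 := Cmod_triangle z (RtoC (eps / 2)).
have h2 := Cmod_sub_ge z (- RtoC (eps / 2))%C.
have h3 : Cmod (RtoC (eps / 2)) = eps / 2 by rewrite Cmod_R Rabs_pos_eq; lra.
rewrite Cmod_opp h3 in h2; rewrite h3 in h1.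
have e : (z - - RtoC (eps / 2))%C = (z + RtoC (eps / 2))%C by ring.
rewrite e in h2.
have c1 : cos th < 1 by rewrite -cos_0; apply: cos_decreasing_1; lra.
have c2 : -1 < cos th by rewrite -cos_PI; apply: cos_decreasing_1; lra.
have key : cos th * Cmod (z + RtoC (eps / 2)) < Re (z + RtoC (eps / 2))%C.
  have -> : Re (z + RtoC (eps / 2))%C = Re z + eps / 2 by [].
  case: (Rle_dec 0 (cos th)) => hc; nra.
apply/sector_emb; first lra.
by split=> // e0; rewrite e0 Cmod_0 /= in key; lra.
Qed.

(** The approximating points may lie in other slices. Only their scalar part and their norm matter,
    and both are Lipschitz for the Clifford norm. *)
Lemma closure_bisector (hn : (0 < n)%N) z th : 0 < th < PI ->
  cl_closure (@bisector n th) (emb J z) -> cos th * Cmod z <= Rabs (Re z).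
Proof.
move=> hth [_ h].
have c1 : cos th < 1 by rewrite -cos_0; apply: cos_decreasing_1; lra.
have c2 : -1 < cos th by rewrite -cos_PI; apply: cos_decreasing_1; lra.
apply: le_epsilon => eps heps; have heps2 : 0 < eps / 2 by lra.
have [t [ht hd]] := h _ heps2.
have pt : paravector t.
  case: ht => [[] //|[[x0 [x ex]] _]].
  exists (- x0)%R, (fun i => (- x i)%R); rewrite -[LHS]opprK ex opprD -scaleNr; congr (_ + _)%R.
  by rewrite -sumrN; apply: eq_bigr => i _; rewrite scaleNr.
have [J' [y [hJ' _ et]]] := paravector_emb hn pt; rewrite et in ht hd.
have ht' : y <> 0%C /\ cos th * Cmod y < Rabs (Re y).
  move: ht; rewrite /bisector -embN /sector /Arg !Sc_emb // !cl_norm_emb // Cmod_opp.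
  have main (u : C) : Cmod u = Cmod y -> emb J' u <> 0%R -> acos (Re u / Cmod y) < th -> u <> 0%C /\ cos th * Cmod y < Re u.
    move=> eu nu hu; have u0 : u <> 0%C by move=> e; apply: nu; rewrite e emb_R scale0r.
    split=> //; move/Cmod_gt_0: (u0) => hu0; rewrite eu in hu0.
    have hR := Cmod_Re_le u; rewrite eu in hR.
    have hc : -1 <= Re u / Cmod y <= 1.
      move/Rabs_le_between: hR => hR.
      by split; [apply/Rle_div_r => //; lra|apply/Rle_div_l => //; lra].
    have [b0 b1] := acos_bound (Re u / Cmod y).
    apply/Rlt_div_r => //; rewrite -(cos_acos _ hc).
    by apply: cos_decreasing_1; lra.
  move=> [[_ [h1 h2]]|[_ [h1 h2]]].
    have [k1 k2] := main y erefl h1 h2; split=> //.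
    by apply: Rlt_le_trans k2 _; exact: Rle_abs.
  have [k1 k2] := main (- y)%C (Cmod_opp y) h1 h2; split.
    by move=> e; apply: k1; rewrite e; ring.
  by apply: Rlt_le_trans k2 _; rewrite -Rabs_Ropp; exact: Rle_abs.
have d1 : Rabs (Re z - Re y) <= cl_norm (emb J z - emb J' y)%R.
  apply: Rle_trans (Sc_le_norm _).
  have -> : Sc (emb J z - emb J' y)%R = Re z - Re y; last exact: Rle_refl.
  by rewrite -embN ScD !Sc_emb.
have d2 : Cmod z - Cmod y <= cl_norm (emb J z - emb J' y)%R.
  have := cl_norm_triangle (emb J z - emb J' y)%R (emb J' y).
  by rewrite subrK !cl_norm_emb //; lra.
have d3 : Cmod y - Cmod z <= cl_norm (emb J z - emb J' y)%R.
  have := cl_norm_triangle (emb J' y - emb J z)%R (emb J z).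
  rewrite subrK !cl_norm_emb //.
  have -> : cl_norm (emb J' y - emb J z)%R = cl_norm (emb J z - emb J' y)%R; last by lra.
  rewrite -opprB /cl_norm; congr sqrt; apply: eq_bigr => A _.
  by rewrite Defs.coefN sqrrN.
have d4 := Rabs_triang (Re z) (- (Re z - Re y)); rewrite Rabs_Ropp in d4.
have e4 : Re z + - (Re z - Re y) = Re y by ring.
rewrite e4 in d4.
case: (Rle_dec 0 (cos th)) => hc; nra.
Qed.

End Sectors.

(** * Testing against slice-linear functionals *)

Section Module.
Variables (n : nat) (V : rightHilbertModule n) (J : clifford n).
Hypothesis hJ : sphere J.
Implicit Types (v x : V).

Definition rm v z : V := rmul v (emb J z).

Lemma rmDl v v' z : rm (plus v v') z = plus (rm v z) (rm v' z).
Proof. exact: rmulDl. Qed.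

Lemma rmDr v z w : rm v (z + w)%C = plus (rm v z) (rm v w).
Proof. by rewrite /rm embD rmulDr. Qed.

Lemma rmM v z w : rm (rm v z) w = rm v (z * w)%C.
Proof. by rewrite /rm -rmulM embM. Qed.

Lemma rm_R v (a : R) : rm v (RtoC a) = scal a v.
Proof. by rewrite /rm emb_R rmul_real. Qed.

Lemma rmE v z : rm v z = plus (scal (Re z) v) (scal (Im z) (rm v Ci)).
Proof.
rewrite -!rm_R rmM -rmDr; congr rm.
by apply: injective_projections; rewrite /Re /Im /=; ring.
Qed.

Definition ell x v : R := Sc (ip x v).

Lemma ellD x v v' : ell x (plus v v') = ell x v + ell x v'.
Proof. by rewrite /ell ipDr ScD. Qed.

Lemma ellZ x v (a : R) : ell x (scal a v) = a * ell x v.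
Proof. by rewrite /ell -rmul_real ip_rmulr -scalerAr mulr1 ScZ. Qed.

Lemma ellC x v : ell x v = ell v x.
Proof. by rewrite /ell -ip_conj Sc_conj. Qed.

Lemma ell_norm v : ell v v = norm v * norm v.
Proof. by rewrite /ell -ip_norm /=; ring. Qed.

Lemma ell_bound x v : Rabs (ell x v) <= norm x * norm v.
Proof.
have nx := norm_ge_0 x; have nv := norm_ge_0 v.
rewrite -(Rabs_pos_eq (norm x * norm v)); last exact: Rmult_le_pos.
apply: Rsqr_le_abs_0; rewrite /Rsqr.
have -> : norm x * norm v * (norm x * norm v) = norm x * norm x * (norm v * norm v) by ring.
apply: discriminant; try nra.
move=> t.
have -> : norm x * norm x * (t * t) + 2 * ell x v * t + norm v * norm v =
   ell (plus (scal t x) v) (plus (scal t x) v).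
  rewrite ellD ellZ (ellC (plus (scal t x) v) x) (ellC (plus (scal t x) v) v) !ellD !ellZ !ell_norm (ellC v x); ring.
by rewrite ell_norm; nra.
Qed.

Lemma ell_linear x : is_linear (K := R_AbsRing) (V := R_NormedModule) (ell x).
Proof.
split.
- by move=> v v'; rewrite ellD.
- by move=> k v; rewrite ellZ.
- have nx := norm_ge_0 x; exists (norm x + 1); split; first lra.
  move=> v; apply: Rle_trans (ell_bound x v) _.
  by apply: Rmult_le_compat_r; [exact: norm_ge_0|lra].
Qed.

(** [Sc] is a trace, so the two scalars that leave the inner product meet as [z] times its
    conjugate, the real number [|z|^2]. *)
Lemma norm_rm v z : norm (rm v z) = Cmod z * norm v.
Proof.
apply: Rsqr_inj; [exact: norm_ge_0| |].
  by apply: Rmult_le_pos; [exact: Cmod_ge_0|exact: norm_ge_0].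
rewrite /Rsqr -ell_norm /ell /rm ip_rmull ip_rmulr mulrA Sc_mulC mulrA.
rewrite emb_conj // -embM //.
have -> : (z * Cconj z)%C = RtoC (Cmod z * Cmod z).
  by rewrite Cmod_sqr; apply: injective_projections; rewrite /Re /Im /=; ring.
by rewrite emb_R -scalerAl mul1r ScZ -/(ell v v) ell_norm; ring.
Qed.

Lemma rm_linear z : is_linear (K := R_AbsRing) (fun v => rm v z).
Proof.
split.
- by move=> v v'; rewrite rmDl.
- by move=> k v; rewrite -!rm_R !rmM Cmult_comm.
- have nx := Cmod_ge_0 z; exists (Cmod z + 1); split; first lra.
  move=> v; rewrite norm_rm.
  by apply: Rmult_le_compat_r; [exact: norm_ge_0|lra].
Qed.

(* The C_J-linear functional with real part Sc <x, .>. *)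
Definition Lam x v : C := (ell x v, - ell x (rm v Ci)).

Lemma LamD x v v' : Lam x (plus v v') = (Lam x v + Lam x v')%C.
Proof. by rewrite /Lam rmDl !ellD /Cplus /=; congr pair; ring. Qed.

Lemma LamM x v z : Lam x (rm v z) = (Lam x v * z)%C.
Proof.
have I2 : (Ci * Ci)%C = RtoC (- 1) by apply: injective_projections => /=; ring.
rewrite /Lam (rmE v z) rmDl !ellD -!rm_R !rmM.
have -> : (RtoC (Re z) * Ci = Ci * RtoC (Re z))%C by ring.
have -> : (Ci * RtoC (Im z) * Ci = (Ci * Ci) * RtoC (Im z))%C by ring.
rewrite I2 -RtoC_mult -!rmM !rm_R !ellZ.
by apply: injective_projections; rewrite /Re /Im /=; ring.
Qed.

Lemma LamZ x v (a : R) : Lam x (scal a v) = (RtoC a * Lam x v)%C.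
Proof. by rewrite -rm_R LamM Cmult_comm. Qed.

Lemma scal_opp1 v : opp v = scal (- 1) v.
Proof. by rewrite (scal_opp_l (V := V) 1 v) scal_one. Qed.

Lemma LamN x v : Lam x (opp v) = (- Lam x v)%C.
Proof.
rewrite scal_opp1 LamZ.
have -> : RtoC (- 1) = (- RtoC 1)%C by apply: injective_projections => /=; ring.
by ring.
Qed.

Lemma LamB x v v' : Lam x (minus v v') = (Lam x v - Lam x v')%C.
Proof. by rewrite /minus LamD LamN. Qed.

(** Testing with [x = v - v'] gives [|v - v'|^2 = 0]. With this, identities between vectors with
    slice scalars become identities in C, within reach of [ring] and [field]. *)
Lemma weak_eq v v' : (forall x, Lam x v = Lam x v') -> v = v'.
Proof.
move=> h.
have e : ell (minus v v') (minus v v') = 0.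
  have := h (minus v v'); move/(congr1 fst) => /= h1.
  by rewrite {2}/minus ellD scal_opp1 ellZ h1; ring.
rewrite ell_norm in e; have n0 : norm (minus v v') = 0 by nra.
have m0 := norm_eq_zero _ n0.
by rewrite -(plus_zero_r v') -m0 /minus (plus_comm v) plus_assoc plus_opp_r plus_zero_l.
Qed.

Lemma Lam0 x : Lam x zero = 0%C.
Proof.
have -> : (zero : V) = scal 0 zero by rewrite scal_zero_l.
by rewrite LamZ; ring.
Qed.

Lemma Lam_bound x v : Cmod (Lam x v) <= 2 * norm x * norm v.
Proof.
apply: Rle_trans (Cmod_2Rmax _) _.
have h1 := ell_bound x v; have h2 := ell_bound x (rm v Ci).
rewrite norm_rm Cmod_Ci Rmult_1_l in h2.
have nx := norm_ge_0 x; have nv := norm_ge_0 v.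
have s2 : sqrt 2 <= 2 by rewrite -{2}(sqrt_square 2); [apply: sqrt_le_1; lra|lra].
have s0 := sqrt_pos 2.
have m : Rmax (Rabs (Lam x v).1) (Rabs (Lam x v).2) <= norm x * norm v.
  by apply: Rmax_lub; rewrite /Lam /= ?Rabs_Ropp.
have m0 : 0 <= Rmax (Rabs (Lam x v).1) (Rabs (Lam x v).2).
  by apply: Rle_trans (Rmax_l _ _); exact: Rabs_pos.
by nra.
Qed.

Lemma Lam_linear1 x : is_linear (K := R_AbsRing) (V := R_NormedModule) (fun v => Re (Lam x v)).
Proof. exact: ell_linear. Qed.

Lemma Lam_linear2 x : is_linear (K := R_AbsRing) (V := R_NormedModule) (fun v => Im (Lam x v)).
Proof.
have h := is_linear_comp (fun v => rm v Ci) (ell x) (rm_linear Ci) (ell_linear x).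
exact: (is_linear_comp _ _ h (is_linear_opp (K := R_AbsRing) (V := R_NormedModule))).
Qed.

Lemma continuous_Lam x (U : UniformSpace) (F : U -> V) u : continuous F u -> continuous (fun y => Lam x (F y)) u.
Proof.
move=> c; apply: cC_pair.
  apply: (continuous_comp F (fun v => Re (Lam x v)) u c).
  exact: (linear_cont (U := V) (V := R_NormedModule) _ _ (Lam_linear1 x)).
apply: (continuous_comp F (fun v => Im (Lam x v)) u c).
exact: (linear_cont (U := V) (V := R_NormedModule) _ _ (Lam_linear2 x)).
Qed.

Lemma continuous_rm (U : UniformSpace) (F : U -> V) (c : U -> C) u :
  continuous F u -> continuous c u -> continuous (fun y => rm (F y) (c y)) u.
Proof.
move=> cF cc.
apply: (continuous_ext (fun y => plus (scal (Re (c y)) (F y)) (scal (Im (c y)) (rm (F y) Ci)))) => [y|].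
  by rewrite -rmE.
apply: (continuous_plus (V := V)).
  by apply: (continuous_scal (V := V)) => //; exact: cC_Re.
apply: (continuous_scal (V := V)); first exact: cC_Im.
apply: (continuous_comp F (fun v => rm v Ci) u cF).
exact: (linear_cont (U := V) (V := V) _ _ (rm_linear Ci)).
Qed.

Lemma Ipos_Lam x (F : R -> V) l : Ipos F l -> cint (fun r => Lam x (F r)) (Lam x l).
Proof.
move=> h; split.
  exact: (@Ipos_linear V R_CompleteNormedModule _ _ _ (Lam_linear1 x) h).
exact: (@Ipos_linear V R_CompleteNormedModule _ _ _ (Lam_linear2 x) h).
Qed.

End Module.

(** * Resolvents of a bisectorial operator *)

Section RightLinear.
Variables (n : nat) (V : rightHilbertModule n) (J : clifford n) (T : operator V).
Hypothesis hT : right_linear T.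

Lemma op_fun v w w' : T v w -> T v w' -> w = w'.
Proof. by case: hT => h _ _ _; exact: h. Qed.

Lemma op_D v v' w w' : T v w -> T v' w' -> T (plus v v') (plus w w').
Proof. by case: hT => _ _ h _; exact: h. Qed.

Lemma op_rm v w z : T v w -> T (rm J v z) (rm J w z).
Proof. by case: hT => _ _ _ h; exact: h. Qed.

Lemma op_Z v w (a : R) : T v w -> T (scal a v) (scal a w).
Proof. by rewrite -!rmul_real; case: hT => _ _ _ h; exact: h. Qed.

Lemma op_B v v' w w' : T v w -> T v' w' -> T (minus v v') (minus w w').
Proof. by move=> h h'; rewrite /minus !scal_opp1; apply: op_D => //; exact: op_Z. Qed.

End RightLinear.

Section Resolvent.
Variables (n : nat) (hn : (0 < n)%N) (V : rightHilbertModule n) (J : clifford n).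
Variables (T : operator V) (omega : R).
Hypothesis hJ : sphere J.
Hypothesis hT : bisectorial omega T.
Implicit Types (v : V).

(** The complement of the closed double sector of angle [omega], where all resolvents exist; it does
    not contain 0. *)
Definition good z : Prop := Rabs (Re z) < cos omega * Cmod z.

Lemma omega_bounds : 0 < omega < PI / 2.
Proof. by case: hT. Qed.

Lemma bis_rl : right_linear T.
Proof. by case: hT => -[]. Qed.

Lemma cos_omega_pos : 0 < cos omega.
Proof. by apply: cos_gt_0; have := omega_bounds; lra. Qed.

Lemma good_neq0 z : good z -> z <> 0%C.
Proof. by rewrite /good => h e; rewrite e Cmod_0 Rmult_0_r in h; have := Rabs_pos (Re 0%C); lra. Qed.

Lemma region_good phi z : omega < phi < PI / 2 -> z <> 0%C ->
  Rabs (Re z) <= cos phi * Cmod z -> good z.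
Proof.
move=> hphi /Cmod_gt_0 hz h; have ho := omega_bounds.
apply: Rle_lt_trans h _; apply: Rmult_lt_compat_r => //.
by apply: cos_decreasing_1; lra.
Qed.

(** The resolvent bound is uniform only outside some larger double sector. Its angle is the arc
    cosine of the midpoint [c] between [|Re z| / |z|] and [cos omega]. *)
Lemma good_region z : good z ->
  exists phi, omega < phi < PI / 2 /\ Rabs (Re z) <= cos phi * Cmod z.
Proof.
move=> h; have z0 := proj1 (Cmod_gt_0 z) (good_neq0 h); have ho := omega_bounds.
have hc := cos_omega_pos; have hpi := PI_RGT_0.
have hr : 0 <= Rabs (Re z) / Cmod z < cos omega.
  split; last by apply/Rlt_div_l.
  by apply: Rdiv_le_0_compat => //; exact: Rabs_pos.
pose c := (Rabs (Re z) / Cmod z + cos omega) / 2.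
have hc1 : cos omega <= 1 by have := COS_bound omega; lra.
have cb : -1 <= c <= 1 by rewrite /c; lra.
have [b0 b1] := acos_bound c; have e := cos_acos c cb.
exists (acos c); split; last first.
  rewrite e; apply: (Rle_trans _ (Rabs (Re z) / Cmod z * Cmod z)).
    by right; field; lra.
  by apply: Rmult_le_compat_r; rewrite ?/c; lra.
split.
  by apply: cos_decreasing_0; try lra; rewrite e /c; lra.
apply: cos_decreasing_0; try lra.
by rewrite e cos_PI2 /c; lra.
Qed.

Lemma good_resolvent_set z : good z -> S_resolvent_set T (emb J z).
Proof.
move=> h; apply: Classical_Prop.NNPP => hn'.
have [_ _ hs _] := hT.
have hsp : S_spectrum T (emb J z) by split=> //; exact: emb_paravector.
have ho := omega_bounds.
have hpi : 0 < omega < PI by lra.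
have := closure_bisector hJ hn hpi (hs _ hsp); rewrite /good in h; lra.
Qed.

(** With [w = Q_s[T]^{-1} v], the vector [w zbar - T w] is a preimage of [v], because
    [z + zbar = 2 Re z] and [z zbar = |z|^2]. This is the usual formula for the S-resolvent. *)
Lemma pencil_surj z v : good z -> exists w, pencil (emb J z) T w v.
Proof.
move=> /good_resolvent_set [_ [_ ht _]].
have [w [u [z' [h1 [h2 e]]]]] := ht v.
exists (minus (rm J w (Cconj z)) u), (minus (rm J u (Cconj z)) z'); split.
  by apply: (op_B bis_rl) => //; apply: op_rm => //; exact: bis_rl.
rewrite -/(rm J _ z) e; apply: (weak_eq (J := J)) => x.
rewrite !(LamD, LamB hJ, LamZ hJ, LamM hJ) Sc_emb // cl_norm_emb //.
have e1 : (Cconj z * z)%C = RtoC (Cmod z ^ 2).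
  have -> : Cmod z ^ 2 = Cmod z * Cmod z by ring.
  by rewrite Cmod_sqr; apply: injective_projections; rewrite /Re /Im /=; ring.
have e2 : RtoC (2 * Re z) = (z + Cconj z)%C.
  by apply: injective_projections; rewrite /Re /=; ring.
by rewrite -e1 e2; ring.
Qed.

Lemma pencilB z v v' w w' : pencil (emb J z) T v w -> pencil (emb J z) T v' w' ->
  pencil (emb J z) T (minus v v') (minus w w').
Proof.
move=> [u [h1 ->]] [u' [h1' ->]]; exists (minus u u'); split; first exact: (op_B bis_rl).
rewrite -!/(rm J _ z); apply: (weak_eq (J := J)) => x.
by rewrite !(LamB hJ, LamM hJ); ring.
Qed.

Lemma pencilD z v v' w w' : pencil (emb J z) T v w -> pencil (emb J z) T v' w' ->
  pencil (emb J z) T (plus v v') (plus w w').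
Proof.
move=> [u [h1 ->]] [u' [h1' ->]]; exists (plus u u'); split; first exact: (op_D bis_rl).
rewrite -!/(rm J _ z); apply: (weak_eq (J := J)) => x.
by rewrite !(LamB hJ, LamD, LamM hJ); ring.
Qed.

Lemma pencil_rm z c v w : pencil (emb J z) T v w ->
  pencil (emb J z) T (rm J v c) (rm J w c).
Proof.
move=> [u [h1 ->]]; exists (rm J u c); split; first by apply: op_rm => //; exact: bis_rl.
rewrite -!/(rm J _ z); apply: (weak_eq (J := J)) => x.
by rewrite !(LamB hJ, LamM hJ); ring.
Qed.

Lemma region_bound phi : omega < phi < PI / 2 -> exists K, 0 <= K /\
  forall z, z <> 0%C -> Rabs (Re z) <= cos phi * Cmod z ->
  forall v w, pencil (emb J z) T w v -> norm w <= K / Cmod z * norm v.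
Proof.
move=> hphi; have [_ ho _ hb] := hT; have [K [K0 hK]] := hb phi hphi.
exists K; split=> // z z0 hz v w hp.
rewrite -(cl_norm_emb z hJ); apply: (hK (emb J z) (emb_paravector z hJ)) => //.
  by move=> e; apply: z0; exact: emb_eq0 e.
have hpp : 0 < phi <= PI by have := PI_RGT_0; lra.
by move/(bisector_emb hJ z hpp) => [_]; lra.
Qed.

(** The resolvent estimate is a statement about the relation [op_inv (pencil _ T)]; it bounds every
    preimage of 0 by 0. *)
Lemma pencil_inj z v w w' : good z ->
  pencil (emb J z) T w v -> pencil (emb J z) T w' v -> w = w'.
Proof.
move=> hz h1 h2; have := pencilB h1 h2; rewrite minus_eq_zero => h.
have [phi [hphi hr]] := good_region hz.
have [K [K0 hK]] := region_bound hphi.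
have := hK z (good_neq0 hz) hr _ _ h; rewrite norm_zero Rmult_0_r => h3.
have m0 : minus w w' = zero by apply: norm_eq_zero; have := norm_ge_0 (minus w w'); lra.
by rewrite -(plus_zero_r w') -m0 /minus (plus_comm w) plus_assoc plus_opp_r plus_zero_l.
Qed.

Definition res z v : V := resolvent (emb J z) T v.

Lemma res_spec z v : good z -> pencil (emb J z) T (res z v) v.
Proof.
move=> hz; rewrite /res /resolvent.
apply: (iota_correct (fun w => pencil (emb J z) T w v)).
have [w hw] := pencil_surj v hz; exists w; split=> // w' hw'.
exact: (pencil_inj hz hw hw').
Qed.

Lemma res_uniq z v w : good z -> pencil (emb J z) T w v -> w = res z v.
Proof. by move=> hz h; exact: (pencil_inj hz h (res_spec v hz)). Qed.

Lemma res_T z v : good z -> T (res z v) (minus (rm J (res z v) z) v).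
Proof.
move=> hz; have [u [h1 e]] := res_spec v hz.
suff -> : minus (rm J (res z v) z) v = u by [].
rewrite {2}e -/(rm J _ z); apply: (weak_eq (J := J)) => x; rewrite !(LamB hJ, LamM hJ); ring.
Qed.

Lemma resD z v v' : good z -> res z (plus v v') = plus (res z v) (res z v').
Proof. by move=> hz; symmetry; apply: res_uniq => //; apply: pencilD; exact: res_spec. Qed.

Lemma res_rm z c v : good z -> res z (rm J v c) = rm J (res z v) c.
Proof. by move=> hz; symmetry; apply: res_uniq => //; apply: pencil_rm; exact: res_spec. Qed.

Lemma res_bound phi : omega < phi < PI / 2 -> exists K, 0 <= K /\
  forall z, z <> 0%C -> Rabs (Re z) <= cos phi * Cmod z ->
  forall v, norm (res z v) <= K / Cmod z * norm v.
Proof.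
move=> hphi; have [K [K0 hK]] := region_bound hphi; exists K; split=> // z z0 hz v.
by apply: hK => //; apply: res_spec; exact: region_good hz.
Qed.

Lemma res_linear z : good z -> is_linear (K := R_AbsRing) (res z).
Proof.
move=> hz; have [phi [hphi hr]] := good_region hz.
have z0 := proj1 (Cmod_gt_0 z) (good_neq0 hz).
have [K [K0 hK]] := res_bound hphi; split.
- by move=> v v'; exact: resD.
- by move=> k v; rewrite -!(rm_R J) res_rm.
- have k0 : 0 <= K / Cmod z by apply: Rdiv_le_0_compat.
  exists (K / Cmod z + 1); split; first lra.
  move=> v; apply: Rle_trans (hK z (good_neq0 hz) hr v) _.
  by apply: Rmult_le_compat_r; [exact: norm_ge_0|lra].
Qed.

Lemma res_identity z (w : C) v : good z -> good w ->
  minus (res z v) (res w v) = rm J (res z (res w v)) (w - z)%C.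
Proof.
move=> hz hw; suff : plus (res w v) (rm J (res z (res w v)) (w - z)%C) = res z v.
  move=> <-; apply: (weak_eq (J := J)) => x; rewrite !(LamB hJ, LamD, LamM hJ); ring.
apply: res_uniq => //.
set a := res w v; set b := res z a.
exists (plus (minus (rm J a w) v) (rm J (minus (rm J b z) a) (w - z)%C)); split.
  apply: (op_D bis_rl); first exact: res_T.
  by apply: op_rm; [exact: bis_rl|exact: res_T].
rewrite -!/(rm J _ z); apply: (weak_eq (J := J)) => x.
by rewrite !(LamB hJ, LamD, LamM hJ); ring.
Qed.

Lemma good_open z : good z -> locally z (fun w => good w).
Proof.
move=> hz.
have c : continuous (fun w : C => cos omega * Cmod w - Rabs (Re w)) z.
  apply: cR_minus.
    apply: cR_mult; first exact: continuous_const.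
    apply: (continuous_ext (fun w : C => sqrt (Re w * Re w + Im w * Im w))) => [w|].
      by rewrite -Cmod_sqr sqrt_square //; exact: Cmod_ge_0.
    apply: (continuous_comp (fun w : C => Re w * Re w + Im w * Im w) sqrt).
      apply: cR_plus; apply: cR_mult; try exact: (cC_Re (continuous_id z)); exact: (cC_Im (continuous_id z)).
    exact: continuous_sqrt.
  apply: (continuous_comp (fun w : C => Re w) Rabs); first exact: (cC_Re (continuous_id z)).
  exact: continuous_Rabs.
have h0 : 0 < cos omega * Cmod z - Rabs (Re z) by rewrite /good in hz; lra.
have h1 : locally z (fun w : C => 0 < cos omega * Cmod w - Rabs (Re w)) := c _ (open_gt 0 _ h0).
by apply: filter_imp h1 => w; rewrite /good; lra.
Qed.

End Resolvent.

(** * The square of a bisectorial operator *)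

Lemma Csqrt_exists z : exists y : C, (y * y)%C = z.
Proof.
have [->|z0] := C_dec z 0%C; first by exists 0%C; ring.
have [t [_ ->]] := polar_form z0; have hz := proj1 (Cmod_gt_0 z) z0.
exists (polar (sqrt (Cmod z)) (t / 2)).
have e := sqrt_sqrt (Cmod z) (Cmod_ge_0 z).
have -> : polar (Cmod z) t = polar (sqrt (Cmod z) * sqrt (Cmod z)) (2 * (t / 2)).
  by rewrite e; congr polar; field.
rewrite /polar cos_2a sin_2a; apply: injective_projections => /=; ring.
Qed.

Lemma Cmod_mul_self (y : C) : Cmod (y * y) = Cmod y * Cmod y.
Proof. exact: Cmod_mult. Qed.

Lemma Re_mul_self (y : C) : Re (y * y)%C = 2 * (Re y * Re y) - Cmod y * Cmod y.
Proof. by rewrite Cmod_sqr /Re /Im /=; ring. Qed.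

(** With [Re (y^2) = 2 (Re y)^2 - |y|^2] and [cos (2 th) = 2 cos(th)^2 - 1], the left inequality is
    the square of the right one. *)
Lemma Re_sqr_lt (y : C) th : 0 <= cos th ->
  Re (y * y)%C < cos (2 * th) * Cmod (y * y) <-> Rabs (Re y) < cos th * Cmod y.
Proof.
move=> hc; rewrite Re_mul_self Cmod_mul_self cos_2a_cos.
have hy := Cmod_ge_0 y; have ha := Rabs_pos (Re y).
have e : Re y * Re y = Rabs (Re y) * Rabs (Re y).
  by rewrite -[LHS]/(Rsqr (Re y)) (Rsqr_abs (Re y)).
rewrite e; split=> h; last by nra.
by apply: Rsqr_incrst_0; rewrite /Rsqr; nra.
Qed.

Lemma Re_sqr_le (y : C) th : 0 <= cos th ->
  Re (y * y)%C <= cos (2 * th) * Cmod (y * y) <-> Rabs (Re y) <= cos th * Cmod y.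
Proof.
move=> hc; rewrite Re_mul_self Cmod_mul_self cos_2a_cos.
have hy := Cmod_ge_0 y; have ha := Rabs_pos (Re y).
have e : Re y * Re y = Rabs (Re y) * Rabs (Re y).
  by rewrite -[LHS]/(Rsqr (Re y)) (Rsqr_abs (Re y)).
rewrite e; split=> h; last by nra.
by apply: Rsqr_incr_0; rewrite /Rsqr; nra.
Qed.

Lemma op_sq_injective (n : nat) (V : rightHilbertModule n) (T : operator V) :
  op_injective T -> op_injective (op_sq T).
Proof. by move=> h v v' w [u [h1 h2]] [u' [h1' h2']]; have e := h _ _ _ h2 h2'; subst u'; exact: h h1 h1'. Qed.

Lemma op_sq_right_linear (n : nat) (V : rightHilbertModule n) (T : operator V) :
  right_linear T -> right_linear (op_sq T).
Proof.
move=> [h1 h2 h3 h4]; split.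
- by move=> v w w' [u [a b]] [u' [a' b']]; have e := h1 _ _ _ a a'; subst u'; exact: h1 b b'.
- by exists zero.
- move=> v v' w w' [u [a b]] [u' [a' b']]; exists (plus u u'); split; exact: h3.
- move=> v w s [u [a b]]; exists (rmul u s); split; exact: h4.
Qed.

Section Square.
Variables (n : nat) (hn : (0 < n)%N) (V : rightHilbertModule n).
Variables (T : operator V) (omega : R).
Hypothesis hT : bisectorial omega T.
Implicit Types (v : V).

Let rlT := bis_rl hT.

Section Slice.
Variables (J : clifford n).
Hypothesis hJ : sphere J.

Lemma good_Ci : good omega Ci /\ good omega (- Ci)%C.
Proof.
have h := cos_omega_pos hT; rewrite /good Cmod_opp Cmod_Ci /=.
by rewrite Ropp_0 Rabs_R0; lra.
Qed.

(** [T^2 v = w] means [(1 + T^2) v = v + w], and [1 + T^2 = (i - T) (- i - T)]. This describes the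
    graph of [T^2] by bounded operators. *)
Lemma op_sq_res v w : op_sq T v w <->
  v = res J T (- Ci)%C (res J T Ci (plus v w)).
Proof.
have [g1 g2] := good_Ci.
have I2 : (Ci * Ci)%C = RtoC (- 1) by apply: injective_projections => /=; ring.
split.
  move=> [u [h1 h2]].
  have p1 : pencil (emb J (- Ci)%C) T v (minus (rm J v (- Ci)%C) u) by exists u.
  have p2 : pencil (emb J Ci) T (minus (rm J v (- Ci)%C) u) (plus v w).
    exists (minus (rm J u (- Ci)%C) w); split.
      by apply: (op_B rlT) => //; exact: op_rm.
    rewrite -/(rm J _ Ci); apply: (weak_eq (J := J)) => x.
    rewrite !(LamB hJ, LamD, LamM hJ).
    have -> : ((Lam J x v * - Ci - Lam J x u) * Ci - (Lam J x u * - Ci - Lam J x w) =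
      - (Lam J x v * (Ci * Ci)) + Lam J x w)%C by ring.
    rewrite I2; have -> : RtoC (- 1) = (- RtoC 1)%C by apply: injective_projections => /=; ring.
    by ring.
  by rewrite -(res_uniq hn hJ hT g1 p2) -(res_uniq hn hJ hT g2 p1).
set a := res J T Ci (plus v w); set b := res J T (- Ci)%C a => e.
have ha := res_T hn hJ hT (plus v w) g1; rewrite -/a in ha.
have hb := res_T hn hJ hT a g2; rewrite -/b -e in hb.
exists (minus (rm J v (- Ci)%C) a); split=> //.
have := op_B rlT (op_rm J rlT (- Ci)%C hb) ha.
congr T; apply: (weak_eq (J := J)) => x.
rewrite !(LamB hJ, LamD, LamM hJ).
have -> : ((Lam J x v * - Ci - Lam J x a) * - Ci - (Lam J x a * Ci - (Lam J x v + Lam J x w)) =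
   Lam J x v * (Ci * Ci) + (Lam J x v + Lam J x w))%C by ring.
rewrite I2; have -> : RtoC (- 1) = (- RtoC 1)%C by apply: injective_projections => /=; ring.
by ring.
Qed.
End Slice.

Lemma op_sq_closed : closed_operator (op_sq T).
Proof.
split; first exact: op_sq_right_linear.
have hJ := sphere_gen (Ordinal hn); set J := gen _ in hJ.
have [g1 g2] := good_Ci.
(* The graph of [T^2] is the zero set of the continuous map [g], hence closed. *)
pose g (p : V * V) : V := minus p.1 (res J T (- Ci)%C (res J T Ci (plus p.1 p.2))).
have cg (p : V * V) : continuous g p.
  have c1 : continuous (fun p : V * V => p.1) p by destruct p as [a b]; exact: continuous_fst.
  have c2 : continuous (fun p : V * V => p.2) p by clear c1; destruct p as [a b]; exact: continuous_snd.
  apply: (continuous_minus (V := V)) => //.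
  apply: (continuous_comp (fun p : V * V => plus p.1 p.2) (fun y => res J T (- Ci)%C (res J T Ci y))).
    exact: (continuous_plus (V := V)).
  apply: (continuous_comp (res J T Ci) (res J T (- Ci)%C)).
    exact: (linear_cont (U := V) (V := V) _ _ (res_linear hn hJ hT g1)).
  exact: (linear_cont (U := V) (V := V) _ _ (res_linear hn hJ hT g2)).
move=> p hp; apply/(op_sq_res hJ); apply: Classical_Prop.NNPP => ne; apply: hp.
have gp : g p <> zero.
  move=> e; apply: ne; apply: (weak_eq (J := J)) => x.
  have := congr1 (Lam J x) e; rewrite /g (LamB hJ) (Lam0 hJ); exact: Csub_eq0.
have np : 0 < norm (g p).
  by case: (norm_ge_0 (g p)) => // e; case: gp; apply: norm_eq_zero.
have cn : continuous (fun q => norm (g q)) p.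
  by apply: (continuous_comp g norm) => //; exact: (filterlim_norm (V := V)).
have hl : locally p (fun q => 0 < norm (g q)) := cn _ (open_gt 0 _ np).
apply: filter_imp hl => q hq /(op_sq_res hJ) e.
by move: hq; rewrite /g {1}e minus_eq_zero norm_zero; lra.
Qed.

End Square.

Section Square2.
Variables (n : nat) (hn : (0 < n)%N) (V : rightHilbertModule n).
Variables (T : operator V) (omega : R).
Hypothesis hT : bisectorial omega T.
Implicit Types (v : V).

Let rlT := bis_rl hT.

(* T^4 - 2 Re(y^2) T^2 + |y|^4 = (T^2 - 2 Re(y) T + |y|^2) (T^2 + 2 Re(y) T + |y|^2). *)
Lemma Q_op_sq (J : clifford n) (y : C) v w : sphere J ->
  Q (emb J (y * y)%C) (op_sq T) v w <->
  exists m, Q (emb J (- y)%C) T v m /\ Q (emb J y) T m w.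
Proof.
move=> hJ; rewrite /Q !Sc_emb // !cl_norm_emb // Cmod_opp.
have rI (a b : R) : a = b -> RtoC a = RtoC b by move=> ->.
set p := Re y; set q := Cmod y.
have eS : Re (y * y)%C = 2 * (p * p) - q * q by exact: Re_mul_self.
have eN : Cmod (y * y) ^ 2 = q * q * (q * q) by rewrite Cmod_mul_self -/q; ring.
have eP : Re (- y)%C = - p by [].
rewrite eS eN eP; clearbody p q; clear eS eN eP rI.
split.
- move=> [u [z' [[a [Tva Tau]] [[b [Tub Tbz]] ->]]]].
  pose m := plus (minus u (scal (2 * - p) a)) (scal (q ^ 2) v).
  have Tm : T m (plus (minus b (scal (2 * - p) u)) (scal (q ^ 2) a)).
    by apply: (op_D rlT); [apply: (op_B rlT) => //|]; exact: op_Z.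
  have TTm : T (plus (minus b (scal (2 * - p) u)) (scal (q ^ 2) a))
     (plus (minus z' (scal (2 * - p) b)) (scal (q ^ 2) u)).
    by apply: (op_D rlT); [apply: (op_B rlT) => //|]; exact: op_Z.
  exists m; split; first by exists a, u.
  eexists; eexists; split; first exact: Tm.
  split; first exact: TTm.
  apply: (weak_eq (J := J)) => x; rewrite /m !(LamD, LamB hJ, LamZ hJ).
  rewrite !(RtoC_mult, RtoC_minus, RtoC_opp, RtoC_pow) /=; ring.
- move=> [m [[a [u [Tva [Tau em]]]] [c [d [Tmc [Tcd ->]]]]]].
  (* A question of domains: [u = T^2 v] is a combination of [m], [a] and [v], which all lie in
     [dom T]; the same argument then puts [b = T u] into [dom T]. *)
  have eu : u = minus (plus m (scal (2 * - p) a)) (scal (q ^ 2) v).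
    by rewrite em; apply: (weak_eq (J := J)) => x; rewrite !(LamD, LamB hJ, LamZ hJ); ring.
  pose b := minus (plus c (scal (2 * - p) u)) (scal (q ^ 2) a).
  have Tub : T u b.
    by rewrite eu /b; apply: (op_B rlT); [apply: (op_D rlT) => //|]; try exact: op_Z; rewrite -eu; exact: op_Z.
  pose z' := minus (plus d (scal (2 * - p) b)) (scal (q ^ 2) u).
  have Tbz : T b z'.
    by apply: (op_B rlT); [apply: (op_D rlT) => //|]; exact: op_Z.
  exists u, z'; split; first by exists a.
  split; first by exists b.
  apply: (weak_eq (J := J)) => x; rewrite /z' /b em !(LamD, LamB hJ, LamZ hJ).
  rewrite !(RtoC_mult, RtoC_minus, RtoC_opp, RtoC_pow) /=; ring.
Qed.

Lemma bounded_operator_comp (A B D : operator V) :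
  bounded_operator A -> bounded_operator B ->
  (forall v w, D v w <-> exists m, A v m /\ B m w) -> bounded_operator D.
Proof.
move=> [[a1 a2 a3 a4] a5 [ca a6]] [[b1 b2 b3 b4] b5 [cb b6]] h; split.
- split.
  + by move=> v w w' /h [m [h1 h2]] /h [m' [h1' h2']]; have e := a1 _ _ _ h1 h1'; subst m'; exact: b1 h2 h2'.
  + by apply/h; exists zero.
  + move=> v v' w w' /h [m [h1 h2]] /h [m' [h1' h2']]; apply/h; exists (plus m m'); split.
      exact: a3.
    exact: b3.
  + by move=> v w s /h [m [h1 h2]]; apply/h; exists (rmul m s); split; [exact: a4|exact: b4].
- by move=> v; have [m hm] := a5 v; have [w hw] := b5 m; exists w; apply/h; exists m.
(* The constant in [op_bound] carries no sign condition, hence the absolute values. *)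
- exists (Rabs ca * Rabs cb) => v w /h [m [h1 h2]].
  have k1 := a6 _ _ h1; have k2 := b6 _ _ h2.
  have nv := norm_ge_0 v; have nm := norm_ge_0 m.
  have l1 := Rle_abs ca; have l2 := Rle_abs cb; have l3 := Rabs_pos ca; have l4 := Rabs_pos cb.
  have k3 : norm w <= Rabs cb * norm m by nra.
  have k4 : norm m <= Rabs ca * norm v by nra.
  nra.
Qed.

(** A point [z] off the closed sector is [y^2] with [y] and [- y] off the closed double sector.
    There [Q] for [T^2] at [z] is a product of two boundedly invertible [Q] for [T]. For the
    estimate, [y^2 - T^2] splits into the factors [y - T] and [y + T], whose bounds [K / |y|]
    multiply to [K^2 / |z|]. *)
Lemma op_sq_sectorial : sectorial (2 * omega) (op_sq T).
Proof.
have ho := omega_bounds hT; have hpi := PI_RGT_0.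
have co := cos_omega_pos hT.
split.
- exact: (op_sq_closed hn hT).
- lra.
- move=> s [ps hs]; have [J [z [hJ _ es]]] := paravector_emb hn ps; rewrite es in hs *.
  have [h|h] := Rle_lt_dec (cos (2 * omega) * Cmod z) (Re z).
    by apply: closure_sector => //; lra.
  case: hs; have [y ey] := Csqrt_exists z; rewrite -ey in h *.
  have gy : good omega y by apply/(Re_sqr_lt y); [lra|].
  have gy' : good omega (- y)%C.
    by move: gy; rewrite /good Cmod_opp /= Rabs_Ropp.
  split; first exact: emb_paravector.
  have [_ b1] := good_resolvent_set hn hJ hT gy.
  have [_ b2] := good_resolvent_set hn hJ hT gy'.
  apply: (bounded_operator_comp b1 b2) => v w; rewrite /op_inv Q_op_sq //.
  by split=> -[m [h1 h2]]; exists m.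
- move=> phi hphi; have hphi2 : omega < phi / 2 < PI / 2 by lra.
  have cphi : 0 < cos (phi / 2) by apply: cos_gt_0; lra.
  have [_ _ _ hb] := hT; have [K [K0 hK]] := hb _ hphi2.
  exists (K * K); split; first nra.
  move=> s ps s0 ns; have [J [z [hJ _ es]]] := paravector_emb hn ps.
  rewrite es in s0 ns *; have [y ey] := Csqrt_exists z.
  have z0 : z <> 0%C by move=> e; apply: s0; rewrite e emb0.
  have y0 : y <> 0%C by move=> e; apply: z0; rewrite -ey e; ring.
  have hyr : Rabs (Re y) <= cos (phi / 2) * Cmod y.
    apply/(Re_sqr_le y); first lra.
    have -> : 2 * (phi / 2) = phi by field.
    rewrite ey; apply: Rnot_lt_le => h; apply: ns; apply/sector_emb => //; lra.
  have hyn := proj1 (Cmod_gt_0 y) y0.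
  have bnd (y' : C) : Rabs (Re y') <= cos (phi / 2) * Cmod y' -> Cmod y' = Cmod y ->
      forall w v, pencil (emb J y') T w v -> norm w <= K / Cmod y * norm v.
    move=> hy' en w v hp; rewrite -en -(cl_norm_emb y' hJ).
    apply: (hK (emb J y') (emb_paravector y' hJ)) => //.
      by move/(emb_eq0 hJ) => e; rewrite e Cmod_0 in en; lra.
    by move/(bisector_emb hJ) => /(_ _) [|_]; lra.
  move=> v w [u [[a [Twa Tau]] ev]].
  rewrite cl_norm_emb // -ey Cmod_mul_self.
  pose b := minus (rm J w y) a.
  have p1 : pencil (emb J y) T w b by exists a.
  have p2 : pencil (emb J (- y)%C) T b (opp v).
    exists (minus (rm J a y) u); split; first by apply: (op_B rlT) => //; exact: op_rm.
    rewrite ev -!/(rm J _ _) -ey /b; apply: (weak_eq (J := J)) => x.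
    by rewrite !(LamN hJ, LamB hJ, LamM hJ); ring.
  have k1 := bnd y hyr erefl _ _ p1.
  have hyr' : Rabs (Re (- y)%C) <= cos (phi / 2) * Cmod (- y) by rewrite Cmod_opp /= Rabs_Ropp.
  have k2 := bnd (- y)%C hyr' (Cmod_opp y) _ _ p2; rewrite norm_opp in k2.
  have -> : K * K / (Cmod y * Cmod y) = K / Cmod y * (K / Cmod y) by field; lra.
  have k0 : 0 <= K / Cmod y by apply: Rdiv_le_0_compat.
  apply: Rle_trans k1 _; rewrite Rmult_assoc; exact: Rmult_le_compat_l.
Qed.

End Square2.

(** * Continuity and holomorphy of the resolvent *)

Lemma cC_eps (k : C -> C) z :
  continuous k z <-> forall eps, 0 < eps -> locally z (fun w : C => Cmod (k w - k z) < eps).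
Proof.
split.
- move=> c eps heps; have heps2 : 0 < eps / 2 by lra.
  have h : locally z (fun w : C => ball (k z) (mkposreal _ heps2) (k w)) := c _ (locally_ball (k z) (mkposreal _ heps2)).
  apply: filter_imp h => w [h1 h2].
  have {}h1 : Rabs (Re (k w - k z)%C) < eps / 2 by exact: h1.
  have {}h2 : Rabs (Im (k w - k z)%C) < eps / 2 by exact: h2.
  have s0 := sqrt_pos 2; have s2 : sqrt 2 < 2.
    by rewrite -{2}(sqrt_square 2); [apply: sqrt_lt_1; lra|lra].
  apply: Rle_lt_trans (Cmod_2Rmax _) _.
  have m : Rmax (Rabs (k w - k z)%C.1) (Rabs (k w - k z)%C.2) < eps / 2 by apply: Rmax_lub_lt.
  have m0 : 0 <= Rmax (Rabs (k w - k z)%C.1) (Rabs (k w - k z)%C.2).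
    by apply: Rle_trans (Rmax_l _ _); exact: Rabs_pos.
  by nra.
- move=> h P [eps hP].
  have := h eps (cond_pos eps); apply: filter_imp => w hw; apply: hP.
  split; [change (Rabs (Re (k w - k z)%C) < eps)|change (Rabs (Im (k w - k z)%C) < eps)]; apply: Rle_lt_trans hw.
    exact: Cmod_Re_le.
  by apply: Rle_trans (Rmax_Cmod _); exact: Rmax_r.
Qed.

Lemma locally_Cmod z d : 0 < d -> locally z (fun w : C => Cmod (w - z) < d).
Proof. by move=> hd; apply: (proj1 (cC_eps (fun w => w) z)) => //; exact: continuous_id. Qed.

Section ResCont.
Variables (n : nat) (hn : (0 < n)%N) (V : rightHilbertModule n) (J : clifford n).
Variables (T : operator V) (omega : R).
Hypothesis hJ : sphere J.
Hypothesis hT : bisectorial omega T.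
Implicit Types (v x : V).

(** The intermediate angle [psi] puts [z] into the interior of a region with a uniform estimate
    [K / |w|], and [|w| >= |z| / 2] near [z]. *)
Lemma res_loc_bound z : good omega z -> exists M, 0 < M /\
  locally z (fun w : C => good omega w /\ forall v, norm (res J T w v) <= M * norm v).
Proof.
move=> hz; have ho := omega_bounds hT.
have z0 := proj1 (Cmod_gt_0 z) (good_neq0 hz).
have [phi [hphi hr]] := good_region hT hz.
pose psi := (omega + phi) / 2.
have hpsi : omega < psi < PI / 2 by rewrite /psi; lra.
have [K [K0 hK]] := res_bound hn hJ hT hpsi.
have gpsi : good psi z.
  apply: Rle_lt_trans hr _; apply: Rmult_lt_compat_r => //.
  by apply: cos_decreasing_1; rewrite /psi; have := PI_RGT_0; lra.
exists (2 * K / Cmod z + 1); split.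
  have : 0 <= 2 * K / Cmod z by apply: Rdiv_le_0_compat; lra.
  lra.
have z2 : 0 < Cmod z / 2 by lra.
have gopen : locally z (fun w : C => good psi w).
  have c : continuous (fun w : C => cos psi * Cmod w - Rabs (Re w)) z.
    apply: cR_minus.
      apply: cR_mult; first exact: continuous_const.
      apply: (continuous_ext (fun w : C => sqrt (Re w * Re w + Im w * Im w))) => [w|].
        by rewrite -Cmod_sqr sqrt_square //; exact: Cmod_ge_0.
      apply: (continuous_comp (fun w : C => Re w * Re w + Im w * Im w) sqrt).
        apply: cR_plus; apply: cR_mult; try exact: (cC_Re (continuous_id z)); exact: (cC_Im (continuous_id z)).
      exact: continuous_sqrt.
    apply: (continuous_comp (fun w : C => Re w) Rabs); first exact: (cC_Re (continuous_id z)).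
    exact: continuous_Rabs.
  have h0 : 0 < cos psi * Cmod z - Rabs (Re z) by rewrite /good in gpsi; lra.
  have h1 : locally z (fun w : C => 0 < cos psi * Cmod w - Rabs (Re w)) := c _ (open_gt 0 _ h0).
  by apply: filter_imp h1 => w; rewrite /good; lra.
apply: filter_imp (filter_and _ _ gopen (locally_Cmod z z2)) => w [gw hw].
have hw2 : Cmod z / 2 <= Cmod w.
  by have := Cmod_sub_ge z w; rewrite Cmod_sub_sym; lra.
have w0 : w <> 0%C by move=> e; rewrite e Cmod_0 in hw2; lra.
have gr : Rabs (Re w) <= cos psi * Cmod w by rewrite /good in gw; lra.
split; first exact: (region_good hT hpsi w0 gr).
move=> v; apply: Rle_trans (hK w w0 gr v) _.
have nv := norm_ge_0 v; apply: Rmult_le_compat_r => //.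
suff : K / Cmod w <= 2 * K / Cmod z by lra.
apply/Rle_div_l; first lra.
have -> : 2 * K / Cmod z * Cmod w = K * (Cmod w / (Cmod z / 2)) by field; lra.
rewrite -{1}(Rmult_1_r K); apply: Rmult_le_compat_l => //.
by apply/Rle_div_r; lra.
Qed.

(** The difference splits into [R(w) (g w - g z)] and, by the resolvent identity,
    [R(w) R(z) (g z) (z - w)]. The vector is allowed to vary because the derivative of the resolvent
    is of the form [- R(w) R(w) v]. *)
Lemma res_cont_gen (g : C -> V) z : good omega z -> continuous g z ->
  continuous (fun w : C => res J T w (g w)) z.
Proof.
move=> hz cg; have [M [M0 hM]] := res_loc_bound hz.
apply/(filterlim_locally_ball_norm (K := R_AbsRing)) => eps.
pose N := norm (res J T z (g z)).
have N0 : 0 <= N by exact: norm_ge_0.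
have e1 : 0 < eps / (2 * M) by apply: Rdiv_lt_0_compat; [exact: cond_pos|lra].
have e2 : 0 < eps / (2 * M * (N + 1)) by apply: Rdiv_lt_0_compat; [exact: cond_pos|nra].
have l1 : locally z (fun w : C => norm (minus (g w) (g z)) < eps / (2 * M)).
  exact: (proj1 (filterlim_locally_ball_norm (K := R_AbsRing) g (g z)) cg (mkposreal _ e1)).
have l2 := locally_Cmod z e2.
apply: filter_imp (filter_and _ _ hM (filter_and _ _ l1 l2)) => w [[gw hw] [k1 k2]].
rewrite /ball_norm.
have -> : minus (res J T w (g w)) (res J T z (g z)) =
    plus (res J T w (minus (g w) (g z))) (rm J (res J T w (res J T z (g z))) (z - w)%C).
  rewrite -(res_identity hn hJ hT (g z) gw hz).
  have lin := res_linear hn hJ hT gw.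
  rewrite {2}/minus (linear_plus _ lin) scal_opp1 (linear_scal _ lin) -scal_opp1 -/(minus _ _).
  by rewrite -minus_trans.
apply: Rle_lt_trans (norm_triangle _ _) _.
rewrite (norm_rm hJ) Cmod_sub_sym.
have a1 := hw (minus (g w) (g z)); have a2 := hw (res J T z (g z)); rewrite -/N in a2.
have eps0 := cond_pos eps.
have b1 : M * norm (minus (g w) (g z)) < eps / 2.
  have -> : eps / 2 = M * (eps / (2 * M)) by field; lra.
  exact: Rmult_lt_compat_l.
have b2 : Cmod (w - z) * (M * N) <= eps / (2 * M * (N + 1)) * (M * N).
  by apply: Rmult_le_compat_r; [nra|lra].
have b3 : eps / (2 * M * (N + 1)) * (M * N) <= eps / 2.
  have -> : eps / (2 * M * (N + 1)) * (M * N) = eps / 2 * (N / (N + 1)) by field; lra.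
  rewrite -{2}(Rmult_1_r (eps / 2)); apply: Rmult_le_compat_l; first lra.
  by apply/Rle_div_l; lra.
have b4 : Cmod (w - z) * norm (res J T w (res J T z (g z))) <= Cmod (w - z) * (M * N).
  by apply: Rmult_le_compat_l => //; exact: Cmod_ge_0.
lra.
Qed.

Lemma res_cont v z : good omega z -> continuous (fun w : C => res J T w v) z.
Proof. by move=> hz; apply: (res_cont_gen (g := fun _ => v)) => //; exact: continuous_const. Qed.

Definition L (x v : V) z : C := Lam J x (res J T z v).

(** The resolvent identity is already a decomposition as required by [hol], with the slope
    [w -> - <x, R(w) R(z) v>]. *)
Lemma hol1_L x v z : good omega z ->
  hol1 (L x v) (fun w => (- Lam J x (res J T w (res J T w v)))%C) z.
Proof.
move=> hz; split.
  exists (fun w => (- Lam J x (res J T w (res J T z v)))%C); split=> //.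
    by apply: cC_opp; apply: continuous_Lam => //; exact: res_cont.
  apply: filter_imp (good_open hz) => w gw.
  have := congr1 (Lam J x) (res_identity hn hJ hT v gw hz).
  rewrite (LamB hJ) (LamM hJ) -/(L x v w) -/(L x v z) => e.
  have -> : L x v w = (L x v z + (L x v w - L x v z))%C by ring.
  by rewrite e; Cring.
apply: cC_opp; apply: continuous_Lam => //.
by apply: (res_cont_gen (g := fun w => res J T w v)) => //; exact: res_cont.
Qed.

Lemma L_bound phi : omega < phi < PI / 2 -> exists K, 0 <= K /\
  forall x v z, z <> 0%C -> Rabs (Re z) <= cos phi * Cmod z ->
  Cmod (L x v z) <= K / Cmod z * (norm x * norm v).
Proof.
move=> hphi; have [K [K0 hK]] := res_bound hn hJ hT hphi; exists (2 * K); split; first lra.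
move=> x v z z0 hz; apply: Rle_trans (Lam_bound hJ x _) _.
have h := hK z z0 hz v; have nx := norm_ge_0 x.
have -> : 2 * K / Cmod z * (norm x * norm v) = 2 * norm x * (K / Cmod z * norm v) by rewrite /Rdiv; ring.
by apply: Rmult_le_compat_l => //; lra.
Qed.

End ResCont.

(** * Representatives of intrinsic functions on the slices *)

Lemma hol_eps (F : C -> C) z (d : C) : hol F z d <-> forall eps, 0 < eps ->
  locally z (fun w : C => Cmod (F w - F z - d * (w - z)) <= eps * Cmod (w - z)).
Proof.
split.
- move=> [k [ck kz hk]] eps heps.
  apply: filter_imp (filter_and _ _ hk (proj1 (cC_eps k z) ck eps heps)) => w [-> h].
  have -> : (F z + k w * (w - z) - F z - d * (w - z) = (k w - k z) * (w - z))%C by rewrite kz; Cring.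
  by rewrite Cmod_mult; apply: Rmult_le_compat_r; [exact: Cmod_ge_0|lra].
- move=> h.
  pose k w := if C_dec w z then d else ((F w - F z) / (w - z))%C.
  have kz : k z = d by rewrite /k; destruct (C_dec z z).
  have ke w : F w = (F z + k w * (w - z))%C.
    rewrite /k; destruct (C_dec w z) as [->|ne] => /=; first by ring.
    by field => /Csub_eq0.
  exists k; split=> //; last by apply: filter_forall => w; exact: ke.
  apply/cC_eps => eps heps; have heps2 : 0 < eps / 2 by lra.
  apply: filter_imp (h _ heps2) => w hw; rewrite kz /k.
  destruct (C_dec w z) as [e|ne] => /=.
    have -> : (d - d)%C = 0%C by ring.
    by rewrite Cmod_0.
  have n0 : (w - z)%C <> 0%C by move=> /Csub_eq0.
  have hp := proj1 (Cmod_gt_0 _) n0.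
  have -> : ((F w - F z) / (w - z) - d)%C = ((F w - F z - d * (w - z)) / (w - z))%C.
    by Cfield.
  by rewrite Cmod_div //; apply/Rlt_div_l => //; nra.
Qed.

Lemma Cmod_le_max z : Cmod z <= 2 * Rmax (Rabs (Re z)) (Rabs (Im z)).
Proof.
apply: Rle_trans (Cmod_2Rmax z) _.
have s2 : sqrt 2 <= 2 by rewrite -{2}(sqrt_square 2); [apply: sqrt_le_1; lra|lra].
apply: Rmult_le_compat_r => //.
by apply: Rle_trans (Rmax_l _ _); exact: Rabs_pos.
Qed.

(** Multiplication by [d] is the real linear map with rows [(Re d, - Im d)] and [(Im d, Re d)]; this
    translates between slopes and the Cauchy-Riemann equations in [intrinsic]. *)
Lemma hol_differentiable (F : C -> C) z (d : C) : hol F z d <->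
  differentiable_pt_lim (fun x y => Re (F (x, y))) (Re z) (Im z) (Re d) (- Im d) /\
  differentiable_pt_lim (fun x y => Im (F (x, y))) (Re z) (Im z) (Im d) (Re d).
Proof.
have ez : (Re z, Im z) = z by case: (z).
split.
- move/hol_eps => h.
  have H (eps : posreal) : locally_2d (fun u v => Cmod (F (u, v) - F z - d * ((u, v) - z)) <=
      eps / 2 * Cmod ((u, v) - z)) (Re z) (Im z).
    have heps2 : 0 < eps / 2 by have := cond_pos eps; lra.
    apply/locally_2d_locally; rewrite ez.
    by have := h _ heps2; apply: filter_imp => -[u v].
  split=> eps; have [del hd] := H eps; exists del => u v hu hv; have {}hd := hd u v hu hv;
    have m : Cmod ((u, v) - z) <= 2 * Rmax (Rabs (u - Re z)) (Rabs (v - Im z)) := Cmod_le_max ((u, v) - z)%C; have e0 := cond_pos eps; rewrite ez.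
  + apply: (Rle_trans _ (Cmod (F (u, v) - F z - d * ((u, v) - z)))); last by apply: Rle_trans hd _; nra.
    apply: Rle_trans (Cmod_Re_le _); right; congr Rabs.
    by rewrite /Re /Im /=; ring.
  + apply: (Rle_trans _ (Cmod (F (u, v) - F z - d * ((u, v) - z)))); last by apply: Rle_trans hd _; nra.
    apply: Rle_trans (Rmax_Cmod _); apply: Rle_trans (Rmax_r _ _); right; congr Rabs.
    by rewrite /Re /Im /=; ring.
- move=> [h1 h2]; apply/hol_eps => eps heps.
  have heps2 : 0 < eps / 2 by lra.
  have := locally_2d_and _ _ _ _ (h1 (mkposreal _ heps2)) (h2 (mkposreal _ heps2)).
  move/locally_2d_locally; rewrite ez; apply: filter_imp => -[u v] /= [k1 k2].
  apply: Rle_trans (Cmod_le_max _) _.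
  have m : Rmax (Rabs (u - Re z)) (Rabs (v - Im z)) <= Cmod ((u, v) - z).
    exact: (Rmax_Cmod ((u, v) - z)%C).
  have l1 : Rabs (Re (F (u, v) - F z - d * ((u, v) - z))%C) <= eps / 2 * Cmod ((u, v) - z).
    apply: Rle_trans (Rmult_le_compat_l _ _ _ (Rlt_le _ _ heps2) m).
    apply: Rle_trans k1; right; congr Rabs; rewrite /Re /Im /=; ring.
  have l2 : Rabs (Im (F (u, v) - F z - d * ((u, v) - z))%C) <= eps / 2 * Cmod ((u, v) - z).
    apply: Rle_trans (Rmult_le_compat_l _ _ _ (Rlt_le _ _ heps2) m).
    apply: Rle_trans k2; right; congr Rabs; rewrite /Re /Im /=; ring.
  have fin X M : M <= eps / 2 * X -> 2 * M <= eps * X by lra.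
  by apply: fin; exact: Rmax_lub.
Qed.

Lemma continuous_2d (d : C -> C) z : continuous d z <->
  continuity_2d_pt (fun x y => Re (d (x, y))) (Re z) (Im z) /\
  continuity_2d_pt (fun x y => Im (d (x, y))) (Re z) (Im z).
Proof.
have ez : (Re z, Im z) = z by case: (z).
have e2 (p : R * R) : (p.1, p.2) = p by case: p.
split.
- move=> c; split; apply/continuity_2d_pt_filterlim; rewrite ez.
    apply: (filterlim_ext (fun p : R * R => Re (d p))) => [p|]; first by rewrite e2.
    exact (cC_Re c).
  apply: (filterlim_ext (fun p : R * R => Im (d p))) => [p|]; first by rewrite e2.
  exact (cC_Im c).
- move=> [/continuity_2d_pt_filterlim h1 /continuity_2d_pt_filterlim h2]; rewrite ez in h1 h2.
  apply: cC_pair.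
    by apply: (filterlim_ext (fun p : R * R => Re (d (p.1, p.2)))) h1 => p; rewrite e2.
  by apply: (filterlim_ext (fun p : R * R => Im (d (p.1, p.2)))) h2 => p; rewrite e2.
Qed.

Section Representation.
Variable n : nat.
Hypothesis hn : (0 < n)%N.
Implicit Types (U : clifford n -> Prop) (f g : clifford n -> clifford n) (J : clifford n).

(** One function [F] on C serves all slices at once, as [alpha] and [beta] do not depend on [J];
    their parity becomes compatibility with conjugation. *)
Definition crep U f (F dF : C -> C) : Prop :=
  forall J z, sphere J -> U (emb J z) ->
    [/\ f (emb J z) = emb J (F z), hol1 F dF z & F (Cconj z) = Cconj (F z)].

Lemma crep_intrinsic U f F dF : crep U f F dF -> intrinsic U f.
Proof.
move=> h; exists (fun x y => Re (F (x, y))), (fun x y => Im (F (x, y))),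
  (fun x y => Re (dF (x, y))), (fun x y => - Im (dF (x, y))) => x y J hJ hU.
have [e [h1 h2] hc] := h J (x, y) hJ hU.
have [d1 d2] := proj1 (hol_differentiable _ _ _) h1.
have [c1 c2] := proj1 (continuous_2d _ _) h2.
split=> //.
- by move: hc; rewrite /Cconj /= => hc; rewrite hc.
- by rewrite Ropp_involutive.
- by split=> //; exact: continuity_2d_pt_opp.
Qed.

Lemma intrinsic_crep U f : intrinsic U f -> exists F dF, crep U f F dF.
Proof.
move=> [al [be [a [b h]]]].
exists (fun z => (al (Re z) (Im z), be (Re z) (Im z))), (fun z => (a (Re z) (Im z), - b (Re z) (Im z))).
move=> J [x y] hJ hU; have [e [e1 e2] d1 d2 [c1 c2]] := h x y J hJ hU.
split.
- by rewrite e.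
- split.
    by apply/hol_differentiable; rewrite /= Ropp_involutive; split.
  by apply/continuous_2d; split=> //=; exact: continuity_2d_pt_opp.
- by rewrite /Cconj /= e1 e2.
Qed.

Lemma crep_mult U f g F dF G dG : crep U f F dF -> crep U g G dG ->
  crep U (fun s => f s * g s)%R (fun z => (F z * G z)%C) (fun z => (dF z * G z + F z * dG z)%C).
Proof.
move=> hf hg J z hJ hU; have [e1 h1 c1] := hf J z hJ hU; have [e2 h2 c2] := hg J z hJ hU.
split.
- by rewrite e1 e2 embM.
- exact: hol1_mult.
- by rewrite c1 c2 Cmult_conj.
Qed.

Lemma rep_of_N0 U f : Defs.N0 U f -> exists F dF al K, [/\ crep U f F dF, 0 < al, 0 <= K &
  forall J z, sphere J -> U (emb J z) ->
    Cmod (F z) <= K * (Rpower (Cmod z) al / (1 + Rpower (Cmod z) (2 * al)))].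
Proof.
move=> [/intrinsic_crep [F [dF hF]] [al [K [h1 [h2 h3]]]]].
exists F, dF, al, K; split=> // J z hJ hU.
have [e _ _] := hF J z hJ hU.
by have := h3 _ hU; rewrite e !cl_norm_emb.
Qed.

Lemma N0_of_rep U f F dF al K : (forall s, U s -> paravector s) -> crep U f F dF -> 0 < al -> 0 <= K ->
  (forall J z, sphere J -> U (emb J z) ->
    Cmod (F z) <= K * (Rpower (Cmod z) al / (1 + Rpower (Cmod z) (2 * al)))) -> Defs.N0 U f.
Proof.
move=> hU hF h1 h2 h3; split; first exact: crep_intrinsic hF.
exists al, K; split=> //; split=> // s us.
have [J [z [hJ _ es]]] := paravector_emb hn (hU s us); rewrite es in us *.
have [e _ _] := hF J z hJ us.
by rewrite e !cl_norm_emb //; exact: h3 us.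
Qed.

Lemma rep_of_Npoly U f : Npoly U f -> exists F dF k K, [/\ crep U f F dF, 0 <= k, 0 <= K &
  forall J z, sphere J -> U (emb J z) ->
    Cmod (F z) <= K * (Rpower (Cmod z) k + Rpower (Cmod z) (- k))].
Proof.
move=> [/intrinsic_crep [F [dF hF]] [k [K [h1 [h2 h3]]]]].
exists F, dF, k, K; split=> // J z hJ hU.
have [e _ _] := hF J z hJ hU.
by have := h3 _ hU; rewrite e !cl_norm_emb.
Qed.

Lemma Npoly_of_rep U f F dF k K : (forall s, U s -> paravector s) -> crep U f F dF -> 0 <= k -> 0 <= K ->
  (forall J z, sphere J -> U (emb J z) ->
    Cmod (F z) <= K * (Rpower (Cmod z) k + Rpower (Cmod z) (- k))) -> Npoly U f.
Proof.
move=> hU hF h1 h2 h3; split; first exact: crep_intrinsic hF.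
exists k, K; split=> //; split=> // s us.
have [J [z [hJ _ es]]] := paravector_emb hn (hU s us); rewrite es in us *.
have [e _ _] := hF J z hJ us.
by rewrite e !cl_norm_emb //; exact: h3 us.
Qed.

Lemma sector_paravector th (s : clifford n) : sector th s -> paravector s.
Proof. by case. Qed.

Lemma bisector_paravector th (s : clifford n) : bisector th s -> paravector s.
Proof.
case=> [[] //|[[x0 [x ex]] _]].
exists (- x0)%R, (fun i => (- x i)%R); rewrite -[LHS]opprK ex opprD -scaleNr; congr (_ + _)%R.
by rewrite -sumrN; apply: eq_bigr => i _; rewrite scaleNr.
Qed.

Lemma bisector_sqr th J z : sphere J -> 0 < th < PI / 2 ->
  bisector th (emb J z) -> sector (2 * th) (emb J (z * z)%C).
Proof.
move=> hJ hth; have hpi := PI_RGT_0.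
move/(bisector_emb hJ) => H; have {H} [|z0 h] := H _; first lra.
apply/sector_emb => //; first lra.
split; first exact: Cmult_neq_0.
apply: Rnot_le_lt => /Re_sqr_le h2.
have : Rabs (Re z) <= cos th * Cmod z by apply: h2; apply: Rlt_le; apply: cos_gt_0; lra.
lra.
Qed.

Lemma crep_sqr th f F dF : 0 < th < PI / 2 -> crep (@sector n (2 * th)) f F dF ->
  crep (@bisector n th) (fun s => f (s * s)%R) (fun z => F (z * z)%C)
    (fun z => (dF (z * z) * (1 * z + z * 1))%C).
Proof.
move=> hth hf J z hJ hU; have hU2 := bisector_sqr hJ hth hU.
have [e h c] := hf J _ hJ hU2; split.
- by rewrite -embM.
- apply: (hol1_comp (f := fun w : C => (w * w)%C) (d := fun w : C => (1 * w + w * 1)%C) (g := F)) => //.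
  by apply: hol1_mult; exact: hol1_id.
- by rewrite -Cmult_conj.
Qed.

End Representation.

(** * The calculus for functions with decay *)

Lemma bdP phi r s : 0 < phi < PI / 2 -> 0 < r -> bd phi r s ->
  [/\ s <> 0%C, Cmod s = r & Rabs (Re s) = cos phi * r].
Proof.
move=> hphi hr hs; split; [exact: bd_neq0 hs|exact: Cmod_bd hs|].
have hc : 0 < cos phi by apply: cos_gt_0; lra.
by case: hs => ->; rewrite /= ?cos_neg ?Rabs_Ropp Rabs_pos_eq; nra.
Qed.

Lemma bd_bisector phi r s : bd phi r s -> exists t, (t = phi \/ t = - phi) /\ (s = polar r t \/ s = (- polar r t)%C).
Proof. by case=> ->; [exists (- phi)|exists phi|exists (- phi)|exists phi]; split; auto. Qed.

Section Calculus.
Variables (n : nat) (hn : (0 < n)%N) (V : rightHilbertModule n).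
Variables (T : operator V) (omega theta : R).
Hypothesis hT : bisectorial omega T.
Hypothesis hth : omega < theta < PI / 2.
Implicit Types (v x : V) (J : clifford n) (f : clifford n -> clifford n).

Definition brep f (F dF : C -> C) (al K : R) : Prop :=
  [/\ crep (@bisector n theta) f F dF, 0 < al, 0 <= K &
  forall J z, sphere J -> bisector theta (emb J z) ->
    Cmod (F z) <= K * (Rpower (Cmod z) al / (1 + Rpower (Cmod z) (2 * al)))].

Let ho := omega_bounds hT.
Let hpi := PI_RGT_0.

Lemma theta_le_PI : 0 < theta <= PI. Proof. by have := (ho, hpi); lra. Qed.

Lemma brep_on f F dF al K : brep f F dF al K ->
  on_bisector theta (fun z => [/\ hol1 F dF z, F (Cconj z) = Cconj (F z) &
     Cmod (F z) <= K * (Cmod z * dom al (Cmod z))]).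
Proof.
move=> [hF ha hK hb] r t hr ht.
have hJ := sphere_gen (Ordinal hn); set J := gen _ in hJ.
have [b1 b2] := bisector_polar hJ theta_le_PI hr ht.
have H z : z <> 0%C -> bisector theta (emb J z) -> [/\ hol1 F dF z, F (Cconj z) = Cconj (F z) &
     Cmod (F z) <= K * (Cmod z * dom al (Cmod z))].
  move=> z0 hz; have [_ h1 h2] := hF J z hJ hz; split=> //.
  have := hb J z hJ hz; have hp := proj1 (Cmod_gt_0 z) z0.
  have -> : Rpower (Cmod z) al / (1 + Rpower (Cmod z) (2 * al)) = Cmod z * dom al (Cmod z).
    by have h := Rpower_pos (Cmod z) (2 * al); rewrite /dom; field; split; lra.
  by [].
split; apply: H => //; first exact: polar_neq0.
by move=> e; apply: (polar_neq0 (r := r) (t := t) hr); have -> : polar r t = (- - polar r t)%C; [ring|rewrite e; ring].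
Qed.

Lemma brep_bd f F dF al K phi r s : brep f F dF al K -> 0 < phi < theta -> 0 < r -> bd phi r s ->
  [/\ hol1 F dF s, F (Cconj s) = Cconj (F s) & Cmod (F s) <= K * (r * dom al r)].
Proof.
move=> hf hphi hr hs; have e := Cmod_bd hr hs; rewrite -e.
have [t [ht hst]] := bd_bisector hs.
have ht' : - theta < t < theta by case: ht => ->; lra.
by case: (brep_on hf hr ht'); case: hst => ->.
Qed.

Lemma bd_good phi r s : omega < phi < theta -> 0 < r -> bd phi r s -> good omega s.
Proof.
move=> hphi hr hs; have hphi' : 0 < phi < PI / 2 by have := ho; lra.
have [s0 e1 e2] := bdP hphi' hr hs.
by apply: (region_good hT (phi := phi)); rewrite ?e2 ?e1; try lra.
Qed.

Section Slice.
Variable J : clifford n.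
Hypothesis hJ : sphere J.

(** The integrand at the contour point [z]; the constant [u] stands for [ds_J / dr] on the ray, up
    to the sign of its orientation. *)
Definition vpt (F : C -> C) v z (u : C) : V := rm J (res J T z v) (F z * u)%C.

Lemma ray_integral_right f F dF t v I : crep (@bisector n theta) f F dF -> - theta < t < theta ->
  is_ray_integral T f J (cl_exp J t) v I <-> Ipos (fun r => vpt F v (polar r t) (- (cis t * Ci))%C) I.
Proof.
move=> hf ht.
have E r : 0 < r -> rmul (rmul (resolvent (r *: cl_exp J t)%R T v) (f (r *: cl_exp J t)%R)) (- (cl_exp J t * J))%R =
    vpt F v (polar r t) (- (cis t * Ci))%C.
  move=> hr; have [b _] := bisector_polar hJ theta_le_PI hr ht.
  have e1 : cl_exp J t = emb J (cis t) by [].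
  rewrite e1 -embZ -polarE; have [-> _ _] := hf J _ hJ b.
  have e3 : (emb J (cis t) * J)%R = emb J (cis t * Ci)%C by rewrite embM // embCi.
  rewrite e3 -embN /vpt.
  by rewrite -[rmul (rmul _ _) _]/(rm J (rm J (res J T (polar r t) v) _) _) rmM.
split; first by apply: Ipos_ext => r hr; exact: E.
by apply: Ipos_ext => r hr; rewrite E.
Qed.

Lemma ray_integral_left f F dF t v I : crep (@bisector n theta) f F dF -> - theta < t < theta ->
  is_ray_integral T f J (- cl_exp J t)%R v I <-> Ipos (fun r => vpt F v (- polar r t)%C (cis t * Ci)%C) I.
Proof.
move=> hf ht.
have E r : 0 < r -> rmul (rmul (resolvent (r *: - cl_exp J t)%R T v) (f (r *: - cl_exp J t)%R)) (- (- cl_exp J t * J))%R =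
    vpt F v (- polar r t)%C (cis t * Ci)%C.
  move=> hr; have [_ b] := bisector_polar hJ theta_le_PI hr ht.
  have e1 : (- cl_exp J t)%R = emb J (- cis t)%C by rewrite embN.
  have e2 : (RtoC r * - cis t = - polar r t)%C by rewrite polarE; ring.
  rewrite e1 -embZ e2; have [-> _ _] := hf J _ hJ b.
  have e3 : (emb J (- cis t)%C * J)%R = emb J (- cis t * Ci)%C by rewrite embM // embCi.
  rewrite e3 -embN /vpt.
  have -> : (- (- cis t * Ci) = cis t * Ci)%C by ring.
  by rewrite -[rmul (rmul _ _) _]/(rm J (rm J (res J T (- polar r t)%C v) _) _) rmM.
split; first by apply: Ipos_ext => r hr; exact: E.
by apply: Ipos_ext => r hr; rewrite E.
Qed.

(** The bound [K r dom al r] of [f] times the bound [Kr / r] of the resolvent is a constant times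
    the integrable function [dom al]. *)
Lemma vpt_exists f F dF al K v phi (Z : R -> C) (u : C) : brep f F dF al K ->
  omega < phi < theta -> Cmod u = 1 ->
  (forall r, 0 < r -> bd phi r (Z r) /\ continuous Z r) ->
  cont_pos (fun r => vpt F v (Z r) u) /\ exists I, Ipos (fun r => vpt F v (Z r) u) I.
Proof.
move=> hf hphi hu hZ; have hphi' : 0 < phi < theta by have := ho; lra.
have hphi2 : omega < phi < PI / 2 by lra.
have hphi3 : 0 < phi < PI / 2 by have := ho; lra.
have cv : cont_pos (fun r => vpt F v (Z r) u).
  move=> r hr; have [b cZ] := hZ r hr; have [h1 _ _] := brep_bd hf hphi' hr b.
  apply: (continuous_rm hJ).
    apply: (continuous_comp (V := C_UniformSpace) Z (fun z => res J T z v) r cZ).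
    by apply: (res_cont hn hJ hT); exact: bd_good hphi hr b.
  apply: cC_mult; last exact: cC_const.
  by apply: (cC_comp (f := Z)) => //; exact: hol1_cont h1.
split=> //.
have [Kr [Kr0 hKr]] := res_bound hn hJ hT hphi2.
have [_ ha hK _] := hf; have [LL hLL] := Ipos_dom ha.
apply: (@Ipos_dominated V _ (fun r => (K * Kr * norm v) * dom al r) ((K * Kr * norm v) * LL)) => //.
- by move=> r hr; apply: cR_mult; [exact: continuous_const|exact: cont_pos_dom].
- move=> r hr; have [b _] := hZ r hr; have [_ _ h3] := brep_bd hf hphi' hr b.
  have [s0 s1 s2] := bdP hphi3 hr b.
  rewrite /vpt (norm_rm hJ) Cmod_mult hu Rmult_1_r.
  have s3 : Rabs (Re (Z r)) <= cos phi * Cmod (Z r) by rewrite s1 s2; exact: Rle_refl.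
  have k := hKr (Z r) s0 s3 v.
  rewrite s1 in k.
  have nv := norm_ge_0 v; have d0 := dom_pos al hr.
  have k0 : 0 <= Kr / r * norm v by apply: Rmult_le_pos => //; apply: Rdiv_le_0_compat.
  apply: (Rle_trans _ (K * (r * dom al r) * (Kr / r * norm v))).
    by apply: Rmult_le_compat => //; [exact: Cmod_ge_0|exact: norm_ge_0].
  by right; field; lra.
- exact: Ipos_mult.
Qed.

Definition vsum (F : C -> C) (phi : R) v (r : R) : V :=
  plus (minus (vpt F v (polar r (- phi)) (- (cis (- phi) * Ci))%C) (vpt F v (polar r phi) (- (cis phi * Ci))%C))
    (minus (vpt F v (- polar r (- phi))%C (cis (- phi) * Ci)%C) (vpt F v (- polar r phi)%C (cis phi * Ci)%C)).

Lemma Cmod_unit t : Cmod (- (cis t * Ci)) = 1 /\ Cmod (cis t * Ci) = 1.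
Proof. by rewrite Cmod_opp Cmod_mult Cmod_cis Cmod_Ci Rmult_1_r. Qed.

Lemma four_rays f F dF al K v phi : brep f F dF al K -> omega < phi < theta ->
  exists I1 I2 I3 I4,
  [/\ is_ray_integral T f J (cl_exp J (- phi)) v I1, is_ray_integral T f J (cl_exp J phi) v I2,
      is_ray_integral T f J (- cl_exp J (- phi))%R v I3 & is_ray_integral T f J (- cl_exp J phi)%R v I4].
Proof.
move=> hf hphi; have [hc _ _ _] := hf.
have hp1 : - theta < phi < theta by have := ho; lra.
have hp2 : - theta < - phi < theta by have := ho; lra.
have [u1 u2] := Cmod_unit phi; have [u3 u4] := Cmod_unit (- phi).
have cm t r : continuous (fun r => (- polar r t)%C) r by apply: cC_opp; exact: continuous_polar_r.
have [|_ [I1 h1]] := vpt_exists v hf hphi u3 (Z := fun r => polar r (- phi)).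
  by move=> r hr; split; [exact: Or41|exact: continuous_polar_r].
have [|_ [I2 h2]] := vpt_exists v hf hphi u1 (Z := fun r => polar r phi).
  by move=> r hr; split; [exact: Or42|exact: continuous_polar_r].
have [|_ [I3 h3]] := vpt_exists v hf hphi u4 (Z := fun r => (- polar r (- phi))%C).
  by move=> r hr; split; [exact: Or43|exact: cm].
have [|_ [I4 h4]] := vpt_exists v hf hphi u2 (Z := fun r => (- polar r phi)%C).
  by move=> r hr; split; [exact: Or44|exact: cm].
exists I1, I2, I3, I4; split.
- exact/(ray_integral_right v I1 hc hp2).
- exact/(ray_integral_right v I2 hc hp1).
- exact/(ray_integral_left v I3 hc hp2).
- exact/(ray_integral_left v I4 hc hp1).
Qed.

Lemma bisector_total f F dF al K v phi : brep f F dF al K -> omega < phi < theta ->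
  exists I, is_bisector_integral T f phi J v I.
Proof.
move=> hf hphi; have [I1 [I2 [I3 [I4 [h1 h2 h3 h4]]]]] := four_rays v hf hphi.
exists (plus (minus I1 I2) (minus I3 I4)), (minus I1 I2), I3, I4; split=> //.
by exists I1, I2.
Qed.

Lemma bisector_sum f F dF v phi I : crep (@bisector n theta) f F dF -> omega < phi < theta ->
  is_bisector_integral T f phi J v I -> Ipos (vsum F phi v) I.
Proof.
move=> hc hphi [I1 [I3 [I4 [[J1 [J2 [h1 h2 ->]]] h3 h4 ->]]]].
have hp1 : - theta < phi < theta by have := ho; lra.
have hp2 : - theta < - phi < theta by have := ho; lra.
apply: is_RInt_gen_plus; apply: is_RInt_gen_minus.
- exact/(ray_integral_right v J1 hc hp2).
- exact/(ray_integral_right v J2 hc hp1).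
- exact/(ray_integral_left v I3 hc hp2).
- exact/(ray_integral_left v I4 hc hp1).
Qed.

(** As [ds_J = ds / J], multiplication by [i] removes the denominator and leaves an ordinary complex
    contour integral. *)
Lemma bisector_weak f F dF v phi I x : crep (@bisector n theta) f F dF -> omega < phi < theta ->
  is_bisector_integral T f phi J v I -> cint (kB phi (fun z => L J T x v z * F z)%C) (Ci * Lam J x I)%C.
Proof.
move=> hc hphi /(bisector_sum hc hphi) /(Ipos_Lam hJ x) /(cint_mult Ci).
have I2 : (Ci * Ci)%C = (- RtoC 1)%C by apply: injective_projections => /=; ring.
apply: cint_ext => r hr; rewrite /vsum !(LamD, LamB hJ) /vpt !(LamM hJ) kBE -!/(L J T x v _).
set a := L _ _ _ _ _; set b := L _ _ _ _ _; set c := L _ _ _ _ _; set d := L _ _ _ _ _.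
set a' := F _; set b' := F _; set c' := F _; set d' := F _.
transitivity ((- (Ci * Ci)) * (a * a' * cis (- phi) - b * b' * cis phi - c * c' * cis (- phi) + d * d' * cis phi))%C.
  by ring.
by rewrite I2; ring.
Qed.

End Slice.
End Calculus.

Lemma r_dom al r : 0 < r -> r * dom al r = Rpower r al / (1 + Rpower r (2 * al)).
Proof. by move=> hr; have h := Rpower_pos r (2 * al); rewrite /dom; field; lra. Qed.

Lemma dom_vanishing al M eps : 0 < al -> 0 <= M -> 0 < eps -> exists x0 y0, 0 < x0 < y0 /\
  forall r, 0 < r -> r < x0 \/ y0 < r -> r * (M * dom al r) <= eps.
Proof.
move=> hal hM heps; have he : 0 < eps / (M + 1) by apply: Rdiv_lt_0_compat; lra.
have [a0 [ha0 h0]] := Rpower_small hal he.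
have [b0 [hb0 h1]] := Rpower_large hal (Rinv_0_lt_compat _ he).
exists a0, (Rmax b0 (a0 + 1)); have m1 := Rmax_l b0 (a0 + 1); have m2 := Rmax_r b0 (a0 + 1).
split; first lra.
move=> r hr hr'; have -> : r * (M * dom al r) = M * (r * dom al r) by ring.
rewrite r_dom // Rpower_2; set p := Rpower r al; have hp : 0 < p by exact: Rpower_pos.
suff H : p / (1 + p * p) <= eps / (M + 1).
  apply: (Rle_trans _ (M * (eps / (M + 1)))); first by apply: Rmult_le_compat_l.
  have -> : M * (eps / (M + 1)) = M * eps / (M + 1) by rewrite /Rdiv; ring.
  by apply/Rle_div_l; nra.
apply/Rle_div_l; first nra.
case: hr' => hr'.
  have : p < eps / (M + 1) by apply: h0; lra.
  nra.
have h : / (eps / (M + 1)) < p by apply: h1; lra.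
have {}h : 1 < eps / (M + 1) * p.
  by have := Rmult_lt_compat_l _ _ _ he h; rewrite Rinv_r; lra.
nra.
Qed.

(** * Independence of the angle and of the slice *)

Section Independence.
Variables (n : nat) (hn : (0 < n)%N) (V : rightHilbertModule n).
Variables (T : operator V) (omega theta : R).
Hypothesis hT : bisectorial omega T.
Hypothesis hth : omega < theta < PI / 2.
Implicit Types (v x : V) (J : clifford n) (f : clifford n -> clifford n).

Let ho := omega_bounds hT.
Let hpi := PI_RGT_0.

Lemma good_conj z : good omega z -> good omega (Cconj z).
Proof. by rewrite /good Cmod_conj. Qed.

(** [Q_s[T]] only depends on [Re z] and [|z|], so [y = Q_s[T]^{-1} v] and [a = T y] are the same in
    every slice and for [z] and its conjugate. *)
Lemma res_slices z v : good omega z -> exists y a : V, forall J, sphere J ->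
  res J T z v = minus (rm J y (Cconj z)) a /\ res J T (Cconj z) v = minus (rm J y z) a.
Proof.
move=> hz; have hJ0 := sphere_gen (Ordinal hn); set J0 := gen _ in hJ0.
have [_ [_ ht _]] := good_resolvent_set hn hJ0 hT hz.
have [y [a [b [h1 [h2 e]]]]] := ht v.
rewrite Sc_emb // cl_norm_emb // in e.
exists y, a => J hJ.
have H z' : good omega z' -> Re z' = Re z -> Cmod z' = Cmod z ->
    res J T z' v = minus (rm J y (Cconj z')) a.
  move=> gz' eR eM; symmetry; apply: (res_uniq hn hJ hT) => //.
  exists (minus (rm J a (Cconj z')) b); split.
    by apply: (op_B (bis_rl hT)) => //; apply: op_rm => //; exact: bis_rl hT.
  rewrite -/(rm J _ z') e; apply: (weak_eq (J := J)) => x.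
  rewrite !(LamD, LamB hJ, LamZ hJ, LamM hJ) -eR -eM.
  have e1 : (Cconj z' * z')%C = RtoC (Cmod z' ^ 2).
    have -> : Cmod z' ^ 2 = Cmod z' * Cmod z' by ring.
    by rewrite Cmod_sqr; apply: injective_projections; rewrite /Re /Im /=; ring.
  have e2 : RtoC (2 * Re z') = (z' + Cconj z')%C.
    by apply: injective_projections; rewrite /Re /=; ring.
  by rewrite -e1 e2; ring.
split; first exact: H.
by rewrite -{2}(Cconj_conj z); apply: H; [exact: good_conj| |exact: Cmod_conj].
Qed.

(** In terms of [y] and [a] from the previous lemma, the contributions of [z] and its conjugate are
    conjugate to each other up to the factor [i]; since [F] is intrinsic, their difference has real
    coefficients and [J] disappears. *)
Lemma pair_indep (F : C -> C) z (w : C) v : good omega z -> F (Cconj z) = Cconj (F z) ->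
  exists u : V, forall J, sphere J ->
    minus (vpt T J F v z (w * Ci)%C) (vpt T J F v (Cconj z) (Cconj w * Ci)%C) = u.
Proof.
move=> hz hF; have [y [a H]] := res_slices v hz.
pose c := (Cconj z * F z * w)%C; pose d := (F z * w)%C.
exists (plus (scal (- 2 * Im c) y) (scal (2 * Im d) a)) => J hJ.
have [e1 e2] := H J hJ; rewrite /vpt e1 e2 hF.
have k (q : C) : RtoC (2 * Im q) = ((Cconj q - q) * Ci)%C.
  by apply: injective_projections; rewrite /Im /=; ring.
apply: (weak_eq (J := J)) => x; rewrite !(LamD, LamB hJ, LamZ hJ, LamM hJ).
have -> : RtoC (- 2 * Im c) = (- RtoC (2 * Im c))%C by rewrite -RtoC_opp; congr RtoC; ring.
rewrite !k /c /d !Cmult_conj Cconj_conj; ring.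
Qed.

Lemma cis_conj t : cis (- t) = Cconj (cis t).
Proof. by rewrite /cis cos_neg sin_neg. Qed.

Lemma polar_conj r t : polar r (- t) = Cconj (polar r t).
Proof. by rewrite /polar cos_neg sin_neg /Cconj /=; congr pair; ring. Qed.

Lemma vsum_indep f F dF al K v phi r J J' : brep theta f F dF al K -> omega < phi < theta -> 0 < r ->
  sphere J -> sphere J' -> vsum T J F phi v r = vsum T J' F phi v r.
Proof.
move=> hf hphi hr hJ hJ'; have hphi' : 0 < phi < theta by lra.
have b1 : bd phi r (polar r (- phi)) by exact: Or41.
have b3 : bd phi r (- polar r (- phi))%C by exact: Or43.
have [_ c1 _] := brep_bd hn hT hth hf hphi' hr b1.
have [_ c3 _] := brep_bd hn hT hth hf hphi' hr b3.
have g1 := bd_good hT hth hphi hr b1; have g3 := bd_good hT hth hphi hr b3.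
have [u1 h1] := pair_indep (- cis (- phi))%C v g1 c1.
have [u3 h3] := pair_indep (cis (- phi)) v g3 c3.
have E1 : Cconj (polar r (- phi)) = polar r phi by rewrite polar_conj Cconj_conj.
have E3 : Cconj (- polar r (- phi)) = (- polar r phi)%C by rewrite Copp_conj E1.
have F1 : (- cis (- phi) * Ci = - (cis (- phi) * Ci))%C by ring.
have F2 : (Cconj (- cis (- phi)) * Ci = - (cis phi * Ci))%C by rewrite Copp_conj cis_conj Cconj_conj; ring.
have F3 : Cconj (cis (- phi)) = cis phi by rewrite cis_conj Cconj_conj.
rewrite E1 F1 F2 in h1; rewrite E3 F3 in h3.
by rewrite /vsum !h1 // !h3.
Qed.

Lemma LF_region f F dF al K lo J : brep theta f F dF al K -> omega < lo < theta -> sphere J ->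
  forall x v, exists M, 0 <= M /\ forall r t, 0 < r -> lo < t < theta \/ - theta < t < - lo ->
    forall s, s = polar r t \/ s = (- polar r t)%C ->
    hol1 (fun z => L J T x v z * F z)%C
      (fun w => - Lam J x (res J T w (res J T w v)) * F w + L J T x v w * dF w)%C s /\
    Cmod (L J T x v s * F s) <= M * dom al r.
Proof.
move=> hf hlo hJ x v; have hlo' : omega < lo < PI / 2 by lra.
have [KL [KL0 hKL]] := L_bound hn hJ hT hlo'.
have [_ ha hK _] := hf; have nx := norm_ge_0 x; have nv := norm_ge_0 v.
exists (KL * (norm x * norm v) * K); split.
  by apply: Rmult_le_pos => //; apply: Rmult_le_pos => //; exact: Rmult_le_pos.
move=> r t hr ht s hs.
have ht' : - theta < t < theta by case: ht; lra.
have es : Cmod s = r by case: hs => ->; rewrite ?Cmod_opp Cmod_polar.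
have s0 : s <> 0%C by move=> e; rewrite e Cmod_0 in es; lra.
have sR : Rabs (Re s) <= cos lo * Cmod s.
  have c0 : 0 <= cos t by apply: cos_ge_0; lra.
  have -> : Rabs (Re s) = r * cos t.
    by case: hs => ->; rewrite /= ?Rabs_Ropp Rabs_pos_eq //; apply: Rmult_le_pos; lra.
  rewrite es Rmult_comm; apply: Rmult_le_compat_r; first lra.
  apply: Rlt_le; case: ht => ht; first by apply: cos_decreasing_1; lra.
  by rewrite -(cos_neg t); apply: cos_decreasing_1; lra.
have [h1 _ h3] : [/\ hol1 F dF s, F (Cconj s) = Cconj (F s) & Cmod (F s) <= K * (Cmod s * dom al (Cmod s))].
  by case: (brep_on hn hT hth hf hr ht') => A B; case: hs => ->.
split.
  by apply: hol1_mult => //; apply: (hol1_L hn hJ hT); exact: (region_good hT hlo' s0 sR).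
rewrite Cmod_mult; have := hKL x v s s0 sR; rewrite es in h3 *.
move=> k; apply: (Rle_trans _ (KL / r * (norm x * norm v) * (K * (r * dom al r)))).
  by apply: Rmult_le_compat => //; exact: Cmod_ge_0.
by right; field; lra.
Qed.

(** The slice is changed at a fixed angle, where the integrands agree pointwise; the angle is then
    changed inside one slice, by rotation of the rays. *)
Lemma bisector_indep f F dF al K v phi phi' J J' I I' : brep theta f F dF al K ->
  omega < phi < theta -> omega < phi' < theta -> sphere J -> sphere J' ->
  is_bisector_integral T f phi J v I -> is_bisector_integral T f phi' J' v I' -> I = I'.
Proof.
move=> hf hphi hphi' hJ hJ' hI hI'; have [hc ha hK _] := hf.
have [I'' hI''] := bisector_total hn hT hth hJ' v hf hphi.
have -> : I = I''.
  have s1 := bisector_sum hT hth hJ hc hphi hI; have s2 := bisector_sum hT hth hJ' hc hphi hI''.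
  apply: (Ipos_unique (V := V) _ s2); apply: Ipos_ext s1 => r hr.
  exact: (vsum_indep v hf hphi hr hJ hJ').
apply: (weak_eq (J := J')) => x.
have w1 := bisector_weak hT hth hJ' x hc hphi hI''.
have w2 := bisector_weak hT hth hJ' x hc hphi' hI'.
(* Strictly between [omega] and both angles: the bands bounded by [lo] and [theta] contain both
   contours and stay away from the spectrum. *)
pose lo := (omega + Rmin phi phi') / 2.
have hlo : omega < lo < theta /\ lo < phi /\ lo < phi'.
  rewrite /lo; have := Rmin_l phi phi'; have := Rmin_r phi phi'.
  have : omega < Rmin phi phi' by apply: Rmin_glb_lt; lra.
  lra.
have [M [M0 hM]] := LF_region hf (proj1 hlo) hJ' x v.
have rot := @bisector_rotation (fun z => L J' T x v z * F z)%C
  (fun w => - Lam J' x (res J' T w (res J' T w v)) * F w + L J' T x v w * dF w)%C lo theta phi phi'.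
have r0 : cint (fun r => (kB phi' (fun z => L J' T x v z * F z) r - kB phi (fun z => L J' T x v z * F z) r)%C) 0%C.
  apply: rot; try lra.
    move=> r t hr ht; split.
      by case: (hM r t hr ht _ (or_introl erefl)).
    by case: (hM r t hr ht _ (or_intror erefl)).
  move=> a b hab.
  have hab' t : a < t < b -> lo < t < theta \/ - theta < t < - lo by case: hab => -[-> ->]; auto.
  split=> eps heps; have [x0 [y0 [h0 h1]]] := dom_vanishing ha M0 heps; exists x0, y0; split=> // r t /hab' ht hr hr';
    apply: Rle_trans (h1 r hr hr'); apply: Rmult_le_compat_l; try lra.
    by case: (hM r t hr ht _ (or_introl erefl)).
  by case: (hM r t hr ht _ (or_intror erefl)).
have e := cint_unique r0 (cint_minus w2 w1).
have e2 : (Ci * (Lam J' x I'' - Lam J' x I') = 0)%C.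
  transitivity (- (Ci * Lam J' x I' - Ci * Lam J' x I''))%C; first by ring.
  by rewrite -e; ring.
apply: Csub_eq0.
transitivity (- (Ci * (Ci * (Lam J' x I'' - Lam J' x I'))))%C; last by rewrite e2; ring.
have I2 : (Ci * Ci)%C = (- RtoC 1)%C by apply: injective_projections => /=; ring.
transitivity (- ((Ci * Ci) * (Lam J' x I'' - Lam J' x I')))%C; last by ring.
by rewrite I2; ring.
Qed.

(** The angle and the slice are existentially quantified in [calc_N0_bisector]; independence of them
    makes the relation single-valued. *)
Lemma calc_bisector_fun f F dF al K v w w' : brep theta f F dF al K ->
  calc_N0_bisector omega theta T f v w -> calc_N0_bisector omega theta T f v w' -> w = w'.
Proof.
move=> hf [phi [J [I [h1 h2 h3 ->]]]] [phi' [J' [I' [h1' h2' h3' ->]]]].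
by rewrite (bisector_indep hf h1 h1' h2 h2' h3 h3').
Qed.

Lemma calc_bisector_spec f F dF al K v w phi J : brep theta f F dF al K ->
  omega < phi < theta -> sphere J -> calc_N0_bisector omega theta T f v w ->
  exists I, is_bisector_integral T f phi J v I /\ w = scal (/ (2 * PI)) I.
Proof.
move=> hf hphi hJ [phi' [J' [I' [h1' h2' h3' ->]]]].
have [I hI] := bisector_total hn hT hth hJ v hf hphi; exists I; split=> //.
by rewrite (bisector_indep hf hphi h1' hJ h2' hI h3').
Qed.

Lemma calc_bisector_total f F dF al K v : brep theta f F dF al K ->
  exists w, calc_N0_bisector omega theta T f v w.
Proof.
move=> hf; have hphi : omega < (omega + theta) / 2 < theta by lra.
have hJ := sphere_gen (Ordinal hn); set J := gen _ in hJ.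
have [I hI] := bisector_total hn hT hth hJ v hf hphi.
by exists (scal (/ (2 * PI)) I), ((omega + theta) / 2), J, I.
Qed.

Lemma calc_bisector_weak f F dF al K v w phi J x : brep theta f F dF al K ->
  omega < phi < theta -> sphere J -> calc_N0_bisector omega theta T f v w ->
  cint (kB phi (fun z => L J T x v z * F z)%C) (2 * RtoC PI * Ci * Lam J x w)%C.
Proof.
move=> hf hphi hJ hw; have [hc _ _ _] := hf.
have [I [hI ->]] := calc_bisector_spec hf hphi hJ hw.
have := bisector_weak hT hth hJ x hc hphi hI.
rewrite (LamZ hJ).
suff -> : (2 * RtoC PI * Ci * (RtoC (/ (2 * PI)) * Lam J x I) = Ci * Lam J x I)%C by [].
transitivity (RtoC (2 * PI * / (2 * PI)) * (Ci * Lam J x I))%C; first by rewrite !RtoC_mult; ring.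
by rewrite Rinv_r; [ring|lra].
Qed.

End Independence.

(** * Multiplicativity *)

Lemma bd_off_sector phi r s : 0 < phi < PI / 2 -> 0 < r -> bd phi r s ->
  forall r' t, 0 < r' -> - phi < t < phi -> polar r' t <> s /\ polar r' t <> (- s)%C.
Proof.
move=> hphi hr hs r' t hr' ht.
have [s0 e1 e2] := bdP hphi hr hs.
have hp : 0 < phi <= PI by have := PI_RGT_0; lra.
have c := cos_lt_abs hp ht.
have c0 : 0 < cos phi by apply: cos_gt_0; lra.
have H (q : C) : Cmod q = r -> Rabs (Re q) = cos phi * r -> polar r' t <> q.
  move=> q1 q2 e; rewrite -e Cmod_polar // in q1; rewrite -e -q1 /= Rabs_pos_eq in q2.
    have ct : cos t = cos phi by apply: (Rmult_eq_reg_l r'); lra.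
    lra.
  by apply: Rmult_le_pos; lra.
split; apply: H => //; first by rewrite Cmod_opp.
by rewrite /= Rabs_Ropp.
Qed.

(** [|s - p|] is at least [r - rho] and at least [cos(phi2) rho - cos(phi1) r]; adding [cos(phi2)]
    times the first bound to the second eliminates [rho]. *)
Lemma bd_dist phi1 phi2 r rho s p : 0 < phi2 < phi1 -> phi1 < PI / 2 -> 0 < r -> 0 < rho ->
  bd phi1 r s -> bd phi2 rho p ->
  (cos phi2 - cos phi1) / (1 + cos phi2) * r <= Cmod (s - p).
Proof.
move=> h1 h2 hr hrho hs hp.
have h1' : 0 < phi1 < PI / 2 by lra.
have h2' : 0 < phi2 < PI / 2 by lra.
have [_ a1 a2] := bdP h1' hr hs; have [_ b1 b2] := bdP h2' hrho hp.
have c2 : 0 < cos phi2 by apply: cos_gt_0; lra.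
have k1 := Cmod_sub_ge s p; rewrite a1 b1 in k1.
have k2 := Cmod_Re_le (s - p)%C; rewrite /Re /= -/(Re s) -/(Re p) in k2.
have k3 := Rabs_triang_inv (Re p) (Re s).
rewrite (Rabs_minus_sym (Re p)) in k3.
have -> : (cos phi2 - cos phi1) / (1 + cos phi2) * r = (cos phi2 - cos phi1) * r / (1 + cos phi2).
  by rewrite /Rdiv; ring.
apply/Rle_div_l; first lra.
have k4 : Rabs (Re s - Re p) <= Cmod (s - p) by exact: k2.
nra.
Qed.

Section Product.
Variables (n : nat) (hn : (0 < n)%N) (V : rightHilbertModule n).
Variables (T : operator V) (omega theta : R).
Hypothesis hT : bisectorial omega T.
Hypothesis hth : omega < theta < PI / 2.
Implicit Types (v x : V) (J : clifford n) (f : clifford n -> clifford n).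

Let ho := omega_bounds hT.
Let hpi := PI_RGT_0.

Lemma brep_bmild f F dF al K th : brep theta f F dF al K -> 0 < th <= theta -> bmild th F.
Proof.
move=> hf hle; have [_ ha hK _] := hf.
have H (Z : C -> C) : (Z = id \/ Z = Copp) -> mild (- th) th (fun s => F (Z s)).
  move=> hZ eps heps; have [x0 [y0 [h0 h1]]] := dom_vanishing ha hK heps.
  exists (Rmin x0 1), y0; have m1 := Rmin_l x0 1; have m2 := Rmin_r x0 1.
  split; first by split; [apply: Rmin_pos|]; lra.
  move=> r t ht hr; have ht' : - theta < t < theta by lra.
  have [[_ _ b1] [_ _ b2]] := brep_on hn hT hth hf hr ht'.
  have b : Cmod (F (Z (polar r t))) <= r * (K * dom al r).
    rewrite Cmod_polar // in b1; rewrite Cmod_opp Cmod_polar // in b2.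
    have e : r * (K * dom al r) = K * (r * dom al r) by ring.
    by rewrite e; case: hZ => ->.
  have c0 := Cmod_ge_0 (F (Z (polar r t))).
  split=> hr'.
    have : r * (K * dom al r) <= eps by apply: h1 => //; left; lra.
    nra.
  by apply: Rle_trans b _; apply: h1 => //; right.
by split; [apply: (H id); left|apply: (H Copp); right].
Qed.

(** [R(s)] is bounded and commutes with right multiplication by slice scalars, so it passes under
    the integral that defines [y]. *)
Lemma res_weak f F dF al K v y phi J s x : brep theta f F dF al K ->
  omega < phi < theta -> sphere J -> good omega s -> calc_N0_bisector omega theta T f v y ->
  cint (kB phi (fun z => Lam J x (res J T s (res J T z v)) * F z)%C) (2 * RtoC PI * Ci * L J T x y s)%C.
Proof.
move=> hf hphi hJ gs hy; have [hc _ _ _] := hf.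
have [I [hI ->]] := calc_bisector_spec hn hT hth hf hphi hJ hy.
have lin := res_linear hn hJ hT gs.
have := Ipos_Lam hJ x (Ipos_linear lin (bisector_sum hT hth hJ hc hphi hI)).
move/(cint_mult Ci).
pose w0 : V := scal (/ (2 * PI)) I; rewrite -/w0.
have -> : (Ci * Lam J x (res J T s I) = 2 * RtoC PI * Ci * L J T x w0 s)%C.
  rewrite /L /w0 (linear_scal _ lin) (LamZ hJ).
  transitivity (RtoC (2 * PI * / (2 * PI)) * (Ci * Lam J x (res J T s I)))%C; last by rewrite !RtoC_mult; ring.
  by rewrite Rinv_r; [ring|lra].
have I2 : (Ci * Ci)%C = (- RtoC 1)%C by apply: injective_projections => /=; ring.
apply: cint_ext => r hr; rewrite /vsum.
have lB a b : res J T s (minus a b) = minus (res J T s a) (res J T s b).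
  by rewrite /minus (linear_plus _ lin) scal_opp1 (linear_scal _ lin) -scal_opp1.
rewrite (linear_plus _ lin) !lB !(LamD, LamB hJ) /vpt !(res_rm hn hJ hT _ _ gs) !(LamM hJ) kBE.
set a := Lam _ _ _; set b := Lam _ _ _; set c := Lam _ _ _; set d := Lam _ _ _.
set a' := F _; set b' := F _; set c' := F _; set d' := F _.
transitivity ((- (Ci * Ci)) * (a * a' * cis (- phi) - b * b' * cis phi - c * c' * cis (- phi) + d * d' * cis phi))%C.
  by ring.
by rewrite I2; ring.
Qed.

Lemma LF_bd f F dF al K phi J : brep theta f F dF al K -> omega < phi < theta -> sphere J ->
  forall x v, exists M, 0 <= M /\ forall r s, 0 < r -> bd phi r s ->
    Cmod (L J T x v s * F s) <= M * dom al r.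
Proof.
move=> hf hphi hJ x v; have hphi' : omega < phi < PI / 2 by lra.
have hphi2 : 0 < phi < PI / 2 by lra.
have hphi3 : 0 < phi < theta by lra.
have [KL [KL0 hKL]] := L_bound hn hJ hT hphi'.
have [_ ha hK _] := hf; have nx := norm_ge_0 x; have nv := norm_ge_0 v.
exists (KL * (norm x * norm v) * K); split.
  by apply: Rmult_le_pos => //; apply: Rmult_le_pos => //; exact: Rmult_le_pos.
move=> r s hr hs; have [s0 e1 e2] := bdP hphi2 hr hs.
have [_ _ b] := brep_bd hn hT hth hf hphi3 hr hs.
have sR : Rabs (Re s) <= cos phi * Cmod s by rewrite e1 e2; exact: Rle_refl.
rewrite Cmod_mult; have := hKL x v s s0 sR; rewrite e1.
move=> k; apply: (Rle_trans _ (KL / r * (norm x * norm v) * (K * (r * dom al r)))).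
  by apply: Rmult_le_compat => //; exact: Cmod_ge_0.
by right; field; lra.
Qed.

Lemma two_pi_i_neq0 : (2 * RtoC PI * Ci)%C <> 0%C.
Proof.
move=> e; have := congr1 Cmod e; rewrite !Cmod_mult Cmod_Ci Cmod_0 !Cmod_R !Rabs_pos_eq; lra.
Qed.

(* Multiplicativity: <x, f(T) g(T) v> is a double contour integral, the contour of f lying outside
   the one of g; by the resolvent identity its integrand is <x, R(p) v> g(p) f(s) / (s - p) up to a
   term killed by Cauchy's theorem, and Fubini and Cauchy's formula for f give <x, (f g)(T) v>. *)
Lemma calc_bisector_mult f F dF al K g G dG be K' h H dH ga K'' v y u :
  brep theta f F dF al K -> brep theta g G dG be K' -> brep theta h H dH ga K'' ->
  on_bisector theta (fun z => H z = (F z * G z)%C) ->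
  calc_N0_bisector omega theta T g v y -> calc_N0_bisector omega theta T f y u ->
  calc_N0_bisector omega theta T h v u.
Proof.
move=> hf hg hh hH hy hu.
have [u' hu'] := calc_bisector_total hn hT hth v hh.
suff -> : u = u' by [].
have hJ := sphere_gen (Ordinal hn); set J := gen _ in hJ.
(* Thirds of the admissible interval; the gap between the angles keeps the kernel [1 / (s - p)] away
   from its singularity. *)
pose phi2 := omega + (theta - omega) / 3; pose phi1 := omega + 2 * (theta - omega) / 3.
have h21 : phi2 < phi1 by rewrite /phi1 /phi2; lra.
have hp2 : omega < phi2 < theta by rewrite /phi2; lra.
have hp1 : omega < phi1 < theta by rewrite /phi1; lra.
have q1 : 0 < phi1 < PI / 2 by lra.
have q2 : 0 < phi2 < PI / 2 by lra.
have q12 : 0 < phi2 < phi1 by lra.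
have q1' : 0 < phi1 < theta by lra.
have q2' : 0 < phi2 < theta by lra.
have [_ ha hK _] := hf; have [_ hb hK' _] := hg.
apply: (weak_eq (J := J)) => x.
have wu := calc_bisector_weak hn hT hth x hf hp1 hJ hu.
have wu' := calc_bisector_weak hn hT hth x hh hp2 hJ hu'.
pose F2 (s p : C) := (L J T x v p * G p * (F s / (s - p)))%C.
have spn0 r rho s p : 0 < r -> 0 < rho -> bd phi1 r s -> bd phi2 rho p -> s <> p.
  move=> hr hrho hs hp e; have := bd_dist q12 (proj2 q1) hr hrho hs hp.
  rewrite e; have -> : (p - p)%C = 0%C by ring.
  rewrite Cmod_0 => k.
  have c12 : cos phi1 < cos phi2 by apply: cos_decreasing_1; lra.
  have c1 : 0 < cos phi1 by apply: cos_gt_0; lra.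
  have : 0 < (cos phi2 - cos phi1) / (1 + cos phi2) by apply: Rdiv_lt_0_compat; lra.
  nra.
have inner r s : 0 < r -> bd phi1 r s ->
    cint (kB phi2 (fun p => L J T x v p * G p / (s - p))%C) (2 * RtoC PI * Ci * L J T x y s)%C.
  move=> hr hs; have gs := bd_good hT hth hp1 hr hs.
  have r1 := res_weak x hg hp2 hJ gs hy.
  (* The pole [s] lies on the boundary of the double sector of angle [phi1], hence outside its
     interior, which contains the contour of [p]. *)
  have z1 : cint (kB phi2 (fun p => G p / (p - s))%C) 0%C.
    apply: (bisector_cauchy_zero (d := dG) (th := phi1)); try lra.
    - move=> r' t hr' ht; have ht' : - theta < t < theta by lra.
      by have [[? _ _] [? _ _]] := brep_on hn hT hth hg hr' ht'.
    - by apply: brep_bmild hg _; lra.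
    - exact: bd_neq0 hs.
    - exact: bd_off_sector hs.
  have := cint_minus r1 (cint_mult (L J T x v s) z1).
  have -> : (2 * RtoC PI * Ci * L J T x y s - L J T x v s * 0 = 2 * RtoC PI * Ci * L J T x y s)%C by ring.
  apply: cint_ext => rho hrho; rewrite -kB_mult -kB_minus; apply: kB_ext => p hp.
  have gp := bd_good hT hth hp2 hrho hp.
  have nsp := spn0 r rho s p hr hrho hs hp.
  have n1 : (s - p)%C <> 0%C by move=> /Csub_eq0.
  have n2 : (p - s)%C <> 0%C by move=> /Csub_eq0 e; apply: nsp.
  have := congr1 (Lam J x) (res_identity hn hJ hT v gs gp).
  rewrite (LamB hJ) (LamM hJ) -/(L J T x v s) -/(L J T x v p) => e.
  have -> : Lam J x (res J T s (res J T p v)) = ((L J T x v s - L J T x v p) / (p - s))%C.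
    by rewrite e; field.
  by field; split.
have outer rho p : 0 < rho -> bd phi2 rho p ->
    cint (kB phi1 (fun s => F s / (s - p))%C) (2 * RtoC PI * Ci * F p)%C.
  move=> hrho hp; have [t [ht hpt]] := bd_bisector hp.
  apply: (@bisector_cauchy_formula F dF phi1 theta _ _ _ _ p rho t) => //; try lra.
  - move=> r' t' hr' ht'.
    by have [[? _ _] [? _ _]] := brep_on hn hT hth hf hr' ht'.
  - by apply: brep_bmild hf _; lra.
(* From [|s - p| >= c r] the factor [F(s) / (s - p)] is bounded by a function of [r] alone, so that
   the dominating function has product form. *)
pose c := (cos phi2 - cos phi1) / (1 + cos phi2).
have hc : 0 < c.
  have c12 : cos phi1 < cos phi2 by apply: cos_decreasing_1; lra.
  have c1 : 0 < cos phi1 by apply: cos_gt_0; lra.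
  by apply: Rdiv_lt_0_compat; lra.
have [M [M0 hM]] := LF_bd hg hp2 hJ x v.
have [LA iA] := Ipos_dom ha; have [LB iB] := Ipos_dom hb.
have e : (2 * RtoC PI * Ci * (2 * RtoC PI * Ci * Lam J x u) = 2 * RtoC PI * Ci * (2 * RtoC PI * Ci * Lam J x u'))%C.
  apply: (@kB_fubini phi1 phi2 F2 (fun r => K / c * dom al r) (fun r => M * dom be r) (K / c * LA) (M * LB)
    (fun s => 2 * RtoC PI * Ci * (L J T x y s * F s))%C (fun p => 2 * RtoC PI * Ci * (L J T x v p * H p))%C).
  - move=> r rho s p hr hrho hs hp; split.
      have n1 : (s - p)%C <> 0%C by move=> /Csub_eq0; exact: spn0 hs hp.
      have p1 : continuous (fun q : C * C => q.1) (s, p) by exact: (continuous_fst (U := C_UniformSpace) (V := C_UniformSpace)).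
      have p2 : continuous (fun q : C * C => q.2) (s, p) by exact: (continuous_snd (U := C_UniformSpace) (V := C_UniformSpace)).
      have gp := bd_good hT hth hp2 hrho hp.
      have [hG _ _] := brep_bd hn hT hth hg q2' hrho hp.
      have [hF _ _] := brep_bd hn hT hth hf q1' hr hs.
      apply: cC_mult; [apply: cC_mult|apply: cC_mult].
      + apply: (cC_comp (f := fun q : C * C => q.2) (h := L J T x v)) => //.
        exact: (hol1_cont (hol1_L hn hJ hT x v gp)).
      + by apply: (cC_comp (f := fun q : C * C => q.2)) => //; exact: hol1_cont hG.
      + by apply: (cC_comp (f := fun q : C * C => q.1)) => //; exact: hol1_cont hF.
      + by apply: cC_inv => //; exact: cC_minus.
    have n1 : (s - p)%C <> 0%C by move=> /Csub_eq0; exact: spn0 hs hp.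
    rewrite /F2 Cmod_mult Cmod_div // Rmult_comm.
    have d1 := bd_dist q12 (proj2 q1) hr hrho hs hp; rewrite -/c in d1.
    have [_ _ bF] := brep_bd hn hT hth hf q1' hr hs.
    have np := proj1 (Cmod_gt_0 _) n1.
    apply: Rmult_le_compat; [| exact: Cmod_ge_0 | |exact: hM].
      by apply: Rdiv_le_0_compat => //; exact: Cmod_ge_0.
    apply/Rle_div_l => //; apply: Rle_trans bF _.
    have -> : K * (r * dom al r) = K / c * dom al r * (c * r) by field; lra.
    apply: Rmult_le_compat_l => //.
    apply: Rmult_le_pos; first by apply: Rdiv_le_0_compat.
    by apply: Rlt_le; exact: dom_pos.
  - by move=> r hr; apply: cR_mult; [exact: continuous_const|exact: cont_pos_dom].
  - by move=> r hr; apply: cR_mult; [exact: continuous_const|exact: cont_pos_dom].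
  - move=> r hr; apply: Rmult_le_pos; first by apply: Rdiv_le_0_compat.
    by apply: Rlt_le; exact: dom_pos.
  - by move=> r hr; apply: Rmult_le_pos => //; apply: Rlt_le; exact: dom_pos.
  - exact: Ipos_mult.
  - exact: Ipos_mult.
  - move=> r s hr hs; split.
      have := cint_mult (F s) (inner r s hr hs).
      have -> : (F s * (2 * RtoC PI * Ci * L J T x y s) = 2 * RtoC PI * Ci * (L J T x y s * F s))%C by ring.
      by apply: cint_ext => rho hrho; rewrite -kB_mult; apply: kB_ext => p hp; rewrite /F2 /Cdiv; ring.
    have gs := bd_good hT hth hp1 hr hs; have [hF _ _] := brep_bd hn hT hth hf q1' hr hs.
    apply: cC_mult; first exact: cC_const.
    by apply: cC_mult; [exact: (hol1_cont (hol1_L hn hJ hT x y gs))|exact: hol1_cont hF].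
  - move=> rho p hrho hp; split.
      have [t [ht hpt]] := bd_bisector hp.
      have ht' : - theta < t < theta by case: ht => ->; lra.
      have eH : H p = (F p * G p)%C by have [k1 k2] := hH rho t hrho ht'; case: hpt => ->.
      have := cint_mult (L J T x v p * G p)%C (outer rho p hrho hp).
      have -> : (L J T x v p * G p * (2 * RtoC PI * Ci * F p) = 2 * RtoC PI * Ci * (L J T x v p * H p))%C by rewrite eH; ring.
      by apply: cint_ext => r hr; rewrite -kB_mult.
    have gp := bd_good hT hth hp2 hrho hp; have [hH1 _ _] := brep_bd hn hT hth hh q2' hrho hp.
    apply: cC_mult; first exact: cC_const.
    by apply: cC_mult; [exact: (hol1_cont (hol1_L hn hJ hT x v gp))|exact: hol1_cont hH1].
  - by apply: (cint_ext _ (cint_mult (2 * RtoC PI * Ci) wu)) => r hr; rewrite -kB_mult.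
  - by apply: (cint_ext _ (cint_mult (2 * RtoC PI * Ci) wu')) => r hr; rewrite -kB_mult.
have nz := two_pi_i_neq0; set k := (2 * RtoC PI * Ci)%C in e nz.
transitivity (k * (k * Lam J x u) / (k * k))%C; first by field.
by rewrite e; field.
Qed.

End Product.

(** * Injectivity of the regularizers *)

(** For [Re w = cos(2 th) |w|], the worst case, the difference of the squares is
    [(1 - cos(th)^2) (1 - |w|)^2], which is nonnegative. *)
Lemma one_plus_lower (w : C) th : 0 <= cos th -> cos (2 * th) * Cmod w <= Re w ->
  cos th * (1 + Cmod w) <= Cmod (1 + w).
Proof.
move=> hc h; have hw := Cmod_ge_0 w.
apply: Rsqr_incr_0; [|by apply: Rmult_le_pos; lra|exact: Cmod_ge_0].
rewrite /Rsqr Cmod_sqr.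
have e : Re (1 + w)%C * Re (1 + w)%C + Im (1 + w)%C * Im (1 + w)%C = 1 + 2 * Re w + Cmod w * Cmod w.
  by rewrite Cmod_sqr /Re /Im /=; ring.
rewrite e; rewrite cos_2a_cos in h.
have hc1 : 0 <= 1 - cos th * cos th by have := COS_bound th; nra.
have := Rmult_le_pos _ _ hc1 (Rle_0_sqr (1 - Cmod w)); rewrite /Rsqr; nra.
Qed.

Definition rbis (z : C) : C := (z / (1 + z * z))%C.

Section FirstPower.
Variables (n : nat) (hn : (0 < n)%N) (V : rightHilbertModule n).
Variables (T : operator V) (omega theta : R).
Hypothesis hT : bisectorial omega T.
Hypothesis hth : omega < theta < PI / 2.
Implicit Types (v x : V) (J : clifford n) (f : clifford n -> clifford n).

Let ho := omega_bounds hT.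
Let hpi := PI_RGT_0.

(* The part of the contour integral of R(z) v z/(1+z^2) around the pole sg i. *)
Lemma pole_integral J x v phi (sg : C) : sphere J -> omega < phi < PI / 2 -> sg = Ci \/ sg = (- Ci)%C ->
  cint (kR (PI / 2 - phi) (fun s => (L J T x v (sg * s) * s / (s + 1) / (s - 1))%C))
    (RtoC PI * Ci * L J T x v sg)%C.
Proof.
move=> hJ hphi hsg; pose lo := (omega + phi) / 2.
have hlo : omega < lo < PI / 2 by rewrite /lo; lra.
have hlo2 : lo < phi by rewrite /lo; lra.
(* After the rotation by [sg] the denominator is [1 + (sg s)^2 = - (s + 1) (s - 1)]. Only the pole 1
   lies in the right half plane, and [E] collects the other factors. *)
pose E s := (L J T x v (sg * s) * s / (s - - 1))%C.
have reg r t : 0 < r -> - (PI / 2 - lo) < t < PI / 2 - lo ->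
    Cmod (sg * polar r t) = r /\ Rabs (Re (sg * polar r t)%C) <= cos lo * r.
  move=> hr ht; split.
    by rewrite Cmod_mult Cmod_polar //; case: hsg => ->; rewrite ?Cmod_opp Cmod_Ci; ring.
  have -> : Rabs (Re (sg * polar r t)%C) = r * Rabs (sin t).
    transitivity (Rabs (r * sin t)); last by rewrite Rabs_mult Rabs_pos_eq; lra.
    by case: hsg => ->; rewrite /Re /Im /=; [rewrite -Rabs_Ropp|]; congr Rabs; ring.
  rewrite Rmult_comm; apply: Rmult_le_compat_r; first lra.
  rewrite -(sin_shift lo); apply: Rabs_le; split.
    by rewrite -sin_neg; apply: sin_incr_1; lra.
  by apply: sin_incr_1; lra.
have nm1 r t : 0 < r -> - (PI / 2 - lo) < t < PI / 2 - lo -> polar r t <> (- 1)%C.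
  move=> hr ht e; have := congr1 Re e; rewrite /polar /= => e2.
  have : 0 < r * cos t by apply: Rmult_lt_0_compat => //; apply: cos_gt_0; lra.
  lra.
have polar10 : polar 1 0 = 1%C.
  by rewrite /polar cos_0 sin_0; apply: injective_projections => /=; ring.
have sgood r t : 0 < r -> - (PI / 2 - lo) < t < PI / 2 - lo -> good omega (sg * polar r t)%C.
  move=> hr ht; have [e1 e2] := reg r t hr ht.
  have n0 : (sg * polar r t)%C <> 0%C by move=> e; rewrite e Cmod_0 in e1; lra.
  by apply: (region_good hT hlo n0); rewrite e1.
pose d1 w := (- Lam J x (res J T w (res J T w v)))%C.
pose dL w := (d1 (sg * w) * (0 * w + sg * 1))%C.
pose dE := d_over_shift (fun s => (L J T x v (sg * s) * s)%C) (fun w => (dL w * w + L J T x v (sg * w) * 1)%C) (- 1)%C.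
have hE : on_sector (PI / 2 - lo) (hol1 E dE).
  move=> r t hr ht; apply: (hol1_over_shift (E := fun s => (L J T x v (sg * s) * s)%C)); last exact: nm1.
  apply: hol1_mult; last exact: hol1_id.
  apply: (hol1_comp (f := fun s => (sg * s)%C) (d := fun w => (0 * w + sg * 1)%C)).
    by apply: hol1_mult; [exact: hol1_const|exact: hol1_id].
  by apply: (hol1_L hn hJ hT); exact: sgood.
(* The resolvent estimate cancels the factor [s], so [E] is bounded by a multiple of
   [1 / |s + 1|]. *)
have mE : mild (- (PI / 2 - lo)) (PI / 2 - lo) E.
  have [K [K0 hK]] := L_bound hn hJ hT hlo.
  pose M := K * (norm x * norm v).
  have M0 : 0 <= M by rewrite /M; apply: Rmult_le_pos => //; apply: Rmult_le_pos; exact: norm_ge_0.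
  have n1 : RtoC 1 <> 0%C by move=> [e]; lra.
  move=> eps heps; have [x0 [y0 [h0 h1]]] := @mild_inv (- (PI / 2 - lo)) (PI / 2 - lo) 1%C (RtoC M) n1 eps heps.
  exists x0, y0; split=> // r t ht hr; have [k1 k2] := h1 r t ht hr.
  have bnd : Cmod (E (polar r t)) <= Cmod (RtoC M / (polar r t + 1)).
    rewrite /E; have e1 : (polar r t - - 1 = polar r t + 1)%C by ring.
    have nz : (polar r t + 1)%C <> 0%C.
      by move=> e; apply: (nm1 r t hr ht); apply: Csub_eq0; rewrite e1.
    rewrite e1 !Cmod_div // Cmod_mult Cmod_polar // Cmod_R Rabs_pos_eq //.
    apply: Rmult_le_compat_r; first by apply: Rlt_le; apply: Rinv_0_lt_compat; apply/Cmod_gt_0.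
    have [e2 e3] := reg r t hr ht.
    have n0 : (sg * polar r t)%C <> 0%C by move=> e; rewrite e Cmod_0 in e2; lra.
    have := hK x v _ n0; rewrite e2 => /(_ e3) k.
    apply: (Rle_trans _ (K / r * (norm x * norm v) * r)); first by apply: Rmult_le_compat_r; lra.
    by rewrite /M; right; field; lra.
  split=> hr'; first by apply: Rle_trans (k1 hr'); apply: Rmult_le_compat_l; lra.
  by apply: Rle_trans (k2 hr').
have := @sector_cauchy_formula E dE 1 0 (PI / 2 - phi) (PI / 2 - lo) _ _ _ _ hE mE.
rewrite polar10 => H; have {H} : cint (kR (PI / 2 - phi) (fun s => (E s / (s - 1))%C)) (2 * RtoC PI * Ci * E 1)%C.
  by apply: H; lra.
have -> : (2 * RtoC PI * Ci * E 1 = RtoC PI * Ci * L J T x v sg)%C.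
  rewrite /E; have -> : (sg * 1 = sg)%C by ring.
  have -> : (1 - - 1 = RtoC 2)%C by apply: injective_projections => /=; ring.
  field; move=> [e]; lra.
apply: cint_ext => r hr; rewrite /kR /ray /E.
by have e s : (s - - 1 = s + 1)%C; [ring|rewrite !e].
Qed.

(** Seen from the complementary double sector, the contour surrounds only the poles [i] and [- i]
    and no spectrum. The reversed orientation gives the minus sign, and
    [- (R(i) + R(- i)) / 2 = T (1 + T^2)^{-1}]. *)
Lemma first_power_value f F dF al K v w : brep theta f F dF al K ->
  on_bisector theta (fun z => F z = rbis z) -> calc_N0_bisector omega theta T f v w ->
  forall J, sphere J -> w = scal (- / 2) (plus (res J T Ci v) (res J T (- Ci)%C v)).
Proof.
move=> hf hF hw J hJ; apply: (weak_eq (J := J)) => x.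
pose phi := (omega + theta) / 2.
have hphi : omega < phi < theta by rewrite /phi; lra.
have hphi2 : omega < phi < PI / 2 by lra.
have hphi3 : 0 < phi < PI / 2 by lra.
have h1 := calc_bisector_weak hn hT hth x hf hphi hJ hw.
have i1 := pole_integral x v hJ hphi2 (or_introl (erefl Ci)).
have i2 := pole_integral x v hJ hphi2 (or_intror (erefl (- Ci)%C)).
have I2 : (Ci * Ci)%C = (- RtoC 1)%C by apply: injective_projections => /=; ring.
have h2 : cint (kB phi (fun z => L J T x v z * F z)%C)
   (- (RtoC PI * Ci * L J T x v Ci + RtoC PI * Ci * L J T x v (- Ci)))%C.
  have := cint_mult (- 1)%C (cint_plus i1 i2).
  have -> : (- 1 * (RtoC PI * Ci * L J T x v Ci + RtoC PI * Ci * L J T x v (- Ci)) =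
    - (RtoC PI * Ci * L J T x v Ci + RtoC PI * Ci * L J T x v (- Ci)))%C by ring.
  apply: cint_ext => r hr.
  have -> : kB phi (fun z => L J T x v z * F z)%C r = kB phi (fun z => L J T x v z * rbis z)%C r.
    apply: kB_ext => s hs; have [t [ht hst]] := bd_bisector hs.
    have ht' : - theta < t < theta by case: ht => ->; lra.
    by have [k1 k2] := hF r t hr ht'; congr Cmult; case: hst => ->.
  rewrite kB_complement /kB.
  have key t : t = - (PI / 2 - phi) \/ t = PI / 2 - phi ->
    ray (fun s => L J T x v (Ci * s) * s / (s + 1) / (s - 1))%C t r =
      ray (fun s => Ci * (L J T x v (Ci * s) * rbis (Ci * s)))%C t r /\
    ray (fun s => L J T x v (- Ci * s) * s / (s + 1) / (s - 1))%C t r =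
      ray (fun s => - (Ci * (L J T x v (Ci * - s) * rbis (Ci * - s))))%C t r.
    move=> ht; have nn (q : C) : q = 1%C \/ q = (- 1)%C -> polar r t <> q.
      have st : sin t <> 0.
        by case: ht => ->; [apply: Rlt_not_eq; apply: sin_lt_0_var; lra|apply: Rgt_not_eq; apply: sin_gt_0; lra].
      move=> hq e; have := congr1 Im e; rewrite /polar /=.
      have -> : Im q = 0 by case: hq => ->; rewrite /=; ring.
      by move/Rmult_integral => [|//]; lra.
    have n1 : (polar r t - 1)%C <> 0%C by move=> /Csub_eq0; apply: nn; left.
    have n2 : (polar r t + 1)%C <> 0%C.
      move=> e; apply: (nn (- 1)%C); first by right.
      by apply: Csub_eq0; rewrite -e; ring.
    rewrite /ray /rbis; set p := polar r t in n1 n2 *.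
    have d1 : (1 + Ci * p * (Ci * p) = - ((p + 1) * (p - 1)))%C.
      by transitivity (1 + (Ci * Ci) * (p * p))%C; [ring|rewrite I2; ring].
    have d2 : (1 + Ci * - p * (Ci * - p) = - ((p + 1) * (p - 1)))%C.
      by transitivity (1 + (Ci * Ci) * (p * p))%C; [ring|rewrite I2; ring].
    have e4 : (Ci * - p = - Ci * p)%C by ring.
    rewrite d1 d2 e4; split.
      transitivity (- (Ci * Ci) * (L J T x v (Ci * p) * p / (p + 1) / (p - 1) * cis t))%C; first by rewrite I2; ring.
      by field; split.
    transitivity (- (Ci * Ci) * (L J T x v (- Ci * p) * p / (p + 1) / (p - 1) * cis t))%C; first by rewrite I2; ring.
    by field; split.
  have [a1 a2] := key _ (or_introl erefl); have [b1 b2] := key _ (or_intror erefl).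
  by rewrite /kR a1 a2 b1 b2; ring.
have e := cint_unique h1 h2.
rewrite (LamZ hJ) LamD -/(L J T x v Ci) -/(L J T x v (- Ci)%C).
have nz := two_pi_i_neq0.
have hPI : RtoC PI <> 0%C by move=> [q]; lra.
have e2 : RtoC (- / 2) = (- / RtoC 2)%C.
  by rewrite RtoC_opp RtoC_inv //; lra.
rewrite e2.
have n2 : RtoC 2 <> 0%C by move=> [q]; lra.
have nCi : Ci <> 0%C by move=> [q]; lra.
transitivity (2 * RtoC PI * Ci * Lam J x w / (2 * RtoC PI * Ci))%C; first by field.
by rewrite e; field.
Qed.

(** Here [c = (1 + T^2)^{-1} v], so that [w = T c] and [v = c + T w]. If [T] is injective, [w]
    determines [c] and hence [v]. *)
Lemma first_power_range f F dF al K v w : brep theta f F dF al K ->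
  on_bisector theta (fun z => F z = rbis z) -> calc_N0_bisector omega theta T f v w ->
  exists c d, [/\ T c w, T w d & v = plus c d].
Proof.
move=> hf hF hw; have hJ := sphere_gen (Ordinal hn); set J := gen _ in hJ.
have ew := first_power_value hf hF hw hJ.
have [g1 g2] := good_Ci hT.
set a := res J T Ci v in ew; pose c := res J T (- Ci)%C a.
have Ta := res_T hn hJ hT v g1; rewrite -/a in Ta.
have Tc := res_T hn hJ hT a g2; rewrite -/c in Tc.
have rl := bis_rl hT.
have I2 : (Ci * Ci)%C = (- RtoC 1)%C by apply: injective_projections => /=; ring.
have eb : res J T (- Ci)%C v = plus (rm J c (2 * Ci)%C) a.
  symmetry; apply: (res_uniq hn hJ hT) => //.
  exists (plus (rm J (minus (rm J c (- Ci)%C) a) (2 * Ci)%C) (minus (rm J a Ci) v)); split.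
    by apply: (op_D rl) => //; exact: op_rm.
  rewrite -/(rm J _ (- Ci)%C); apply: (weak_eq (J := J)) => x.
  rewrite !(LamD, LamB hJ, LamM hJ); ring.
have ew2 : w = minus (rm J c (- Ci)%C) a.
  rewrite ew eb; apply: (weak_eq (J := J)) => x; rewrite !(LamZ hJ, LamD, LamB hJ, LamM hJ).
  have e2 : RtoC (- / 2) = (- / RtoC 2)%C by rewrite RtoC_opp RtoC_inv //; lra.
  by rewrite e2; field; move=> [q]; lra.
exists c, (minus v c); split.
- by rewrite ew2.
- have := op_B rl (op_rm J rl (- Ci)%C Tc) Ta; rewrite ew2.
  congr T; apply: (weak_eq (J := J)) => x; rewrite !(LamD, LamB hJ, LamM hJ).
  transitivity (Lam J x v + (Ci * Ci) * Lam J x c)%C; first by ring.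
  by rewrite I2; ring.
- by apply: (weak_eq (J := J)) => x; rewrite !(LamD, LamB hJ); ring.
Qed.

Lemma first_power_injective f F dF al K : op_injective T -> brep theta f F dF al K ->
  on_bisector theta (fun z => F z = rbis z) -> op_injective (calc_N0_bisector omega theta T f).
Proof.
move=> hinj hf hF v v' w h h'.
have [c [d [h1 h2 ->]]] := first_power_range hf hF h.
have [c' [d' [h1' h2' ->]]] := first_power_range hf hF h'.
have -> := hinj _ _ _ h1 h1'.
by rewrite (op_fun (bis_rl hT) h2 h2').
Qed.

End FirstPower.

(** * Substituting s^2 in the contour integral *)

Section SquareCalculus.
Variables (n : nat) (hn : (0 < n)%N) (V : rightHilbertModule n).
Variables (T : operator V) (omega theta : R).
Hypothesis hT : bisectorial omega T.
Hypothesis hth : omega < theta < PI / 2.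
Implicit Types (v x : V) (J : clifford n) (e : clifford n -> clifford n).

Let ho := omega_bounds hT.
Let hpi := PI_RGT_0.
Let rl := bis_rl hT.

Lemma good_opp z : good omega z -> good omega (- z)%C.
Proof. by rewrite /good Cmod_opp /= Rabs_Ropp. Qed.

Lemma pencil_zero J z : pencil (emb J z) T zero zero.
Proof.
exists zero; split; first by case: rl.
have -> : rmul (zero : V) (emb J z) = zero.
  apply: (weak_eq (J := J)) => x; rewrite -/(rm J zero z).
  have -> : rm J (zero : V) z = scal 0 (rm J zero z).
    have e0 : (zero : V) = scal 0 zero by rewrite scal_zero_l.
    by rewrite {1}e0 /rm -rmul_real -rmulM -scalerAl mul1r scale0r -{1}(scale0r (1 : clifford n)%R) rmul_real scal_zero_l scal_zero_l.
  by rewrite scal_zero_l.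
by rewrite minus_eq_zero.
Qed.

Lemma op_sq_resolvent J p v : sphere J -> good omega p ->
  rm J (resolvent (emb J (p * p)%C) (op_sq T) v) (2 * p)%C = minus (res J T p v) (res J T (- p)%C v).
Proof.
move=> hJ gp; have gm := good_opp gp; have p0 := good_neq0 gp.
have n2 : RtoC 2 <> 0%C by move=> [q]; lra.
set a := res J T p v; set b := res J T (- p)%C v.
pose X := rm J (minus a b) (/ (2 * p))%C.
have Ta := res_T hn hJ hT v gp; rewrite -/a in Ta.
have Tb := res_T hn hJ hT v gm; rewrite -/b in Tb.
have PX : pencil (emb J (p * p)%C) (op_sq T) X v.
  pose TX := rm J (minus (minus (rm J a p) v) (minus (rm J b (- p)%C) v)) (/ (2 * p))%C.
  have T1 : T X TX by apply: op_rm => //; exact: op_B.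
  have eTX : TX = rm J (plus a b) (/ 2)%C.
    apply: (weak_eq (J := J)) => x; rewrite /TX !(LamD, LamB hJ, LamM hJ); field; repeat split; auto.
  have T2 : T TX (rm J (plus (minus (rm J a p) v) (minus (rm J b (- p)%C) v)) (/ 2)%C).
    by rewrite eTX; apply: op_rm => //; exact: op_D.
  exists (rm J (plus (minus (rm J a p) v) (minus (rm J b (- p)%C) v)) (/ 2)%C).
  split; first by exists TX.
  rewrite -/(rm J _ (p * p)%C); apply: (weak_eq (J := J)) => x.
  rewrite /X !(LamD, LamB hJ, LamM hJ); field; repeat split; auto.
(* The difference [D] of two solutions satisfies [(- p - T) (p - T) D = 0], and the two factors are
   cancelled one after the other. *)
have puniq w w' : pencil (emb J (p * p)%C) (op_sq T) w v -> pencil (emb J (p * p)%C) (op_sq T) w' v -> w = w'.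
  move=> [u [[c [h1 h2]] e1]] [u' [[c' [h1' h2']] e1']].
  pose D := minus w w'; pose TD := minus c c'.
  have D1 : T D TD by exact: op_B.
  have D2 : T TD (rm J D (p * p)%C).
    have := op_B rl h2 h2'; congr T.
    have eu : u = minus (rm J w (p * p)%C) v.
      by rewrite e1; apply: (weak_eq (J := J)) => x; rewrite -!/(rm J _ _) !(LamB hJ, LamM hJ); ring.
    have eu' : u' = minus (rm J w' (p * p)%C) v.
      by rewrite e1'; apply: (weak_eq (J := J)) => x; rewrite -!/(rm J _ _) !(LamB hJ, LamM hJ); ring.
    by rewrite eu eu' /D; apply: (weak_eq (J := J)) => x; rewrite !(LamB hJ, LamM hJ); ring.
  pose B := minus (rm J D p) TD.
  have B1 : pencil (emb J (- p)%C) T B zero.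
    exists (minus (rm J TD p) (rm J D (p * p)%C)); split; first by apply: op_B => //; exact: op_rm.
    rewrite -/(rm J _ _); apply: (weak_eq (J := J)) => x; rewrite /B (Lam0 hJ) !(LamB hJ, LamM hJ); ring.
  have B0 := pencil_inj hJ hT gm B1 (pencil_zero J (- p)%C).
  have D3 : pencil (emb J p) T D zero.
    by exists TD; split=> //; rewrite -/(rm J _ _) -/B B0.
  have D0 := pencil_inj hJ hT gp D3 (pencil_zero J p).
  apply: (weak_eq (J := J)) => x; apply: Csub_eq0; rewrite -(LamB hJ) -/D D0; exact: Lam0.
have -> : resolvent (emb J (p * p)%C) (op_sq T) v = X.
  apply: (puniq _ _ _ PX); rewrite /resolvent.
  apply: (iota_correct (fun w => pencil (emb J (p * p)%C) (op_sq T) w v)).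
  exists X; split; first exact: PX.
  by move=> w' hw'; exact: puniq PX hw'.
by apply: (weak_eq (J := J)) => x; rewrite /X !(LamB hJ, LamM hJ); field; repeat split; auto.
Qed.

Lemma polar_sqr r t : (polar r t * polar r t)%C = polar (r * r) (2 * t).
Proof. by rewrite /polar cos_2a sin_2a; apply: injective_projections => /=; ring. Qed.

Lemma cis_sqr t : (cis t * cis t)%C = cis (2 * t).
Proof. by rewrite /cis cos_2a sin_2a; apply: injective_projections => /=; ring. Qed.

Section Regular.
Variables (e : clifford n -> clifford n) (E dE : C -> C) (al K : R).
Hypothesis hE : crep (@sector n (2 * theta)) e E dE.
Hypothesis hal : 0 < al.
Hypothesis hK : 0 <= K.
Hypothesis hb : forall J z, sphere J -> sector (2 * theta) (emb J z) ->
    Cmod (E z) <= K * (Rpower (Cmod z) al / (1 + Rpower (Cmod z) (2 * al))).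

Definition sqr_arg (s : clifford n) : clifford n := e (s * s)%R.

Lemma brep_sqr : brep theta sqr_arg (fun z => E (z * z)%C)
  (fun z => (dE (z * z) * (1 * z + z * 1))%C) (2 * al) K.
Proof.
have hth' : 0 < theta < PI / 2 by lra.
split=> //; [exact: crep_sqr|lra|].
move=> J z hJ hz; have := hb hJ (bisector_sqr hJ hth' hz).
have z0 : 0 < Cmod z.
  by apply/Cmod_gt_0 => e0; move/(bisector_emb hJ): hz => H; have [] := H (theta_le_PI hT hth).
have eP be : Rpower (Cmod (z * z)) be = Rpower (Cmod z) (2 * be).
  by rewrite Cmod_mult Rpower_2 Rpower_mult_distr.
by rewrite !eP.
Qed.

(** Squaring maps two opposite rays onto the same ray. Their opposite orientation produces the minus
    sign between the resolvents at [p] and [- p], and [r -> r^2] absorbs the factor [2 p]. *)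
Lemma ray_integral_sqr J t v I1 I2 : sphere J -> omega < t < theta \/ - theta < t < - omega ->
  is_ray_integral T sqr_arg J (cl_exp J t) v I1 ->
  is_ray_integral T sqr_arg J (- cl_exp J t)%R v I2 ->
  is_ray_integral (op_sq T) e J (cl_exp J (2 * t)) v (plus I1 I2).
Proof.
move=> hJ ht; have ht' : - theta < t < theta by lra.
have [hc _ _ _] := brep_sqr.
move/(ray_integral_right hT hth hJ v I1 hc ht') => h1 /(ray_integral_left hT hth hJ v I2 hc ht') h2.
set F := (fun z => E (z * z)%C) in h1 h2 hc.
pose g r := plus (vpt T J F v (polar r t) (- (cis t * Ci))%C) (vpt T J F v (- polar r t)%C (cis t * Ci)%C).
have hg : Ipos g (plus I1 I2) by exact: is_RInt_gen_plus.
have [phi [hphi hbd]] : exists phi, omega < phi < theta /\ forall r, bd phi r (polar r t) /\ bd phi r (- polar r t)%C.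
  case: ht => h; [exists t|exists (- t)]; (split; first lra) => r; split.
  - exact: Or42.
  - exact: Or44.
  - by apply: Or41; rewrite Ropp_involutive.
  - by apply: Or43; rewrite Ropp_involutive.
have [u1 u2] := Cmod_unit t.
have cg : cont_pos g.
  have [|c1 _] := vpt_exists hn hT hth hJ v brep_sqr hphi u1 (Z := fun r => polar r t).
    by move=> r hr; split; [case: (hbd r)|exact: continuous_polar_r].
  have [|c2 _] := vpt_exists hn hT hth hJ v brep_sqr hphi u2 (Z := fun r => (- polar r t)%C).
    by move=> r hr; split; [case: (hbd r)|apply: cC_opp; exact: continuous_polar_r].
  by move=> r hr; apply: (continuous_plus (V := V)); [exact: c1|exact: c2].
(* Chosen such that [2 r f2(r^2) = g r]; once its integral is known, [f2] is identified pointwise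
   with the integrand for [T^2]. *)
pose f2 r := scal (/ (2 * sqrt r)) (g (sqrt r)).
have cf2 : cont_pos f2.
  move=> r hr; have hs := sqrt_lt_R0 r hr.
  apply: (continuous_scal (V := V)).
    apply: cR_inv; last by lra.
    by apply: cR_mult; [exact: continuous_const|exact: continuous_sqrt].
  by apply: (continuous_comp sqrt g); [exact: continuous_sqrt|exact: cg].
have h3 : Ipos f2 (plus I1 I2).
  apply: (Ipos_subst_sqr cf2); apply: Ipos_ext hg => r hr; rewrite /f2 sqrt_square; last lra.
  rewrite scal_assoc /mult /=; have -> : 2 * r * / (2 * r) = 1 by field; lra.
  by rewrite (scal_one (V := V)).
apply: Ipos_ext h3 => r hr; rewrite /f2 /g.
have hs := sqrt_lt_R0 r hr; set rho := sqrt r in hs *.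
have er : r = rho * rho by rewrite /rho sqrt_sqrt; lra.
set p := polar rho t.
have gp : good omega p by exact: (bd_good hT hth hphi hs (proj1 (hbd rho))).
have epp : (p * p)%C = polar r (2 * t) by rewrite er /p polar_sqr.
have e1 : cl_exp J (2 * t) = emb J (cis (2 * t)) by [].
have hU : sector (2 * theta) (emb J (p * p)%C).
  by rewrite epp; apply: sector_polar => //; lra.
rewrite e1 -embZ -polarE -epp; have [-> _ _] := hE hJ hU.
have e3 : (emb J (cis (2 * t)) * J)%R = emb J (cis (2 * t) * Ci)%C by rewrite embM // embCi.
rewrite e3 -embN -!/(rm J _ _).
set X := resolvent _ _ _.
have eX := op_sq_resolvent v hJ gp; rewrite -/X in eX.
have rr0 : RtoC rho <> 0%C by move=> [q]; lra.
have n2 : RtoC 2 <> 0%C by move=> [q]; lra.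
have c0 : cis t <> 0%C by move=> q; have := Cmod_cis t; rewrite q Cmod_0; lra.
have epm : (- p * - p)%C = (p * p)%C by ring.
apply: (weak_eq (J := J)) => x; rewrite !(LamZ hJ, LamD) /vpt !(LamM hJ) /F epm.
have eL := congr1 (Lam J x) eX; rewrite (LamM hJ) (LamB hJ) in eL.
rewrite -cis_sqr RtoC_inv; last lra.
rewrite RtoC_mult.
transitivity (/ (RtoC 2 * RtoC rho) * ((Lam J x (res J T p v) - Lam J x (res J T (- p)%C v)) * (E (p * p)%C * - (cis t * Ci))))%C; first by ring.
rewrite -eL /p polarE; field; repeat split; auto.
Qed.

(** Convergence of the integral for [T^2] does not by itself give convergence on the single rays for
    [T]. That comes from [four_rays], and uniqueness of limits identifies the sums. *)
Lemma calc_sector_bisector v w :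
  calc_N0_sector (2 * omega) (2 * theta) (op_sq T) e v w <->
  calc_N0_bisector omega theta T sqr_arg v w.
Proof.
have two t : - (2 * t) = 2 * - t by ring.
have algebra (I1 I2 I3 I4 : V) :
  minus (plus I1 I3) (plus I2 I4) = plus (minus I1 I2) (minus I3 I4).
  have hJ := sphere_gen (Ordinal hn).
  by apply: (weak_eq (J := gen (Ordinal hn))) => x; rewrite !(LamD, LamB hJ); ring.
split.
- move=> [phi' [J [I [hphi' hJ [S1 [S2 [s1 s2 ->]]] ->]]]].
  pose phi := phi' / 2; have hphi : omega < phi < theta by rewrite /phi; lra.
  have ephi : phi' = 2 * phi by rewrite /phi; field.
  rewrite ephi two in s1 s2.
  have [I1 [I2 [I3 [I4 [h1 h2 h3 h4]]]]] := four_rays hn hT hth hJ v brep_sqr hphi.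
  have t1 : omega < - phi < theta \/ - theta < - phi < - omega by lra.
  have t2 : omega < phi < theta \/ - theta < phi < - omega by lra.
  have E1 := Ipos_unique s1 (ray_integral_sqr hJ t1 h1 h3).
  have E2 := Ipos_unique s2 (ray_integral_sqr hJ t2 h2 h4).
  exists phi, J, (minus S1 S2); split=> //.
  exists (minus I1 I2), I3, I4; split=> //; first by exists I1, I2.
  by rewrite E1 E2 algebra.
- move=> [phi [J [I [hphi hJ [I0 [I3 [I4 [[I1 [I2 [h1 h2 ->]]] h3 h4 ->]]]] ->]]]].
  have t1 : omega < - phi < theta \/ - theta < - phi < - omega by lra.
  have t2 : omega < phi < theta \/ - theta < phi < - omega by lra.
  exists (2 * phi), J, (plus (minus I1 I2) (minus I3 I4)); split=> //; first lra.
  exists (plus I1 I3), (plus I2 I4); split; last by rewrite algebra.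
    by rewrite two; exact: ray_integral_sqr h1 h3.
  exact: ray_integral_sqr h2 h4.
Qed.

End Regular.
End SquareCalculus.

(** * Regularizers for functions of polynomial growth *)

Section Rational.
Variable n : nat.
Implicit Types (U : clifford n -> Prop) (f g : clifford n -> clifford n) (J s : clifford n).

(* An inverse on the slices C_J only, not on all of R_n. *)
Definition cl_inv s : clifford n := (/ (cl_norm s * cl_norm s) *: conj s)%R.

Lemma cl_inv_emb J z : sphere J -> z <> 0%C -> cl_inv (emb J z) = emb J (/ z)%C.
Proof.
move=> hJ z0; have hp := proj1 (Cmod_gt_0 z) z0.
rewrite /cl_inv cl_norm_emb // emb_conj // -embZ; congr (emb J).
have e : RtoC (Cmod z * Cmod z) = (z * Cconj z)%C.
  by rewrite Cmod_sqr; apply: injective_projections; rewrite /Re /Im /=; ring.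
have c0 : Cconj z <> 0%C by move=> q; have := Cmod_conj z; rewrite q Cmod_0; lra.
rewrite RtoC_inv; last by apply: Rgt_not_eq; nra.
by rewrite e; field; split.
Qed.

Lemma crep_id U : crep U (fun s => s) (fun z => z) (fun _ => 1%C).
Proof. by move=> J z hJ hU; split=> //; exact: hol1_id. Qed.

Lemma crep_one U : crep U (fun _ => 1%R) (fun _ => 1%C) (fun _ => 0%C).
Proof.
move=> J z hJ hU; split; [by rewrite emb1|exact: hol1_const|].
by apply: injective_projections => /=; ring.
Qed.

Lemma crep_add U f F dF g G dG : crep U f F dF -> crep U g G dG ->
  crep U (fun s => f s + g s)%R (fun z => (F z + G z)%C) (fun z => (dF z + dG z)%C).
Proof.
move=> hf hg J z hJ hU; have [e1 h1 c1] := hf J z hJ hU; have [e2 h2 c2] := hg J z hJ hU.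
split; [by rewrite e1 e2 embD|exact: hol1_plus|by rewrite c1 c2 Cplus_conj].
Qed.

Lemma crep_inv U f F dF : crep U f F dF -> (forall J z, sphere J -> U (emb J z) -> F z <> 0%C) ->
  crep U (fun s => cl_inv (f s)) (fun z => (/ F z)%C) (fun z => (- dF z / (F z * F z))%C).
Proof.
move=> hf h0 J z hJ hU; have [e1 h1 c1] := hf J z hJ hU; have F0 := h0 J z hJ hU.
split; [by rewrite e1 cl_inv_emb|exact: hol1_inv|by rewrite c1 Cinv_conj].
Qed.

Lemma crep_pow U f F dF m : crep U f F dF ->
  exists d, crep U (fun s => f s ^+ m)%R (fun z => (F z ^ m)%C) d.
Proof.
move=> hf; elim: m => [|m [d IH]]; first by eexists; exact: crep_one.
eexists => J z hJ hU; have [a b c] := crep_mult hf IH hJ hU.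
by split; [rewrite exprS|exact: b|].
Qed.

End Rational.

(** As [q <= 1], one factor [q] carries the decay and the remaining ones are dropped. *)
Lemma pow_bound (a M q : R) m : 0 <= a -> 0 <= q <= 1 -> 0 <= M -> a <= M * q -> a ^ m.+1 <= M ^ m.+1 * q.
Proof.
move=> ha hq hM h; apply: (Rle_trans _ ((M * q) ^ m.+1)); first by apply: pow_incr.
rewrite Rpow_mult_distr; apply: Rmult_le_compat_l; first exact: pow_le.
rewrite -[X in _ <= X]Rmult_1_r /=; apply: Rmult_le_compat_l; first lra.
by rewrite -[X in _ <= X](pow1 m); apply: pow_incr.
Qed.

(** [x^k <= (1 + x)^N], and [x / (1 + x)^2] times [1 + x] is at most 1. The quotient is invariant
    under [x -> 1/x], which gives the negative exponent. *)
Lemma power_absorbed (x k : R) N : 0 < x -> 0 <= k <= INR N ->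
  (x / ((1 + x) * (1 + x))) ^ N * (Rpower x k + Rpower x (- k)) <= 2.
Proof.
have one y : 0 < y -> 0 <= k <= INR N -> (y / ((1 + y) * (1 + y))) ^ N * Rpower y k <= 1.
  move=> hy hk.
  have h1 : Rpower y k <= (1 + y) ^ N.
    rewrite -Rpower_pow; last lra.
    apply: (Rle_trans _ (Rpower (1 + y) k)); first by apply: Rle_Rpower_l; lra.
    by apply: Rle_Rpower; lra.
  have h2 : 0 <= y / ((1 + y) * (1 + y)) by apply: Rlt_le; apply: Rdiv_lt_0_compat; nra.
  apply: (Rle_trans _ ((y / ((1 + y) * (1 + y))) ^ N * (1 + y) ^ N)).
    by apply: Rmult_le_compat_l => //; exact: pow_le.
  rewrite -Rpow_mult_distr -[X in _ <= X](pow1 N); apply: pow_incr.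
  have -> : y / ((1 + y) * (1 + y)) * (1 + y) = y / (1 + y) by field; lra.
  split; first by apply: Rlt_le; apply: Rdiv_lt_0_compat; lra.
  by apply/Rle_div_l; lra.
move=> hx hk; have a := one x hx hk; have := one (/ x) (Rinv_0_lt_compat _ hx) hk.
have -> : / x / ((1 + / x) * (1 + / x)) = x / ((1 + x) * (1 + x)) by field; lra.
have -> : Rpower (/ x) k = Rpower x (- k) by rewrite Rpower_Ropp /Rpower ln_Rinv // -exp_Ropp; congr exp; ring.
lra.
Qed.

Section Regularizer.
Variables (n : nat) (hn : (0 < n)%N) (V : rightHilbertModule n).
Variables (T : operator V) (omega theta : R).
Hypothesis hT : bisectorial omega T.
Hypothesis hth : omega < theta < PI / 2.
Implicit Types (v w x : V) (J : clifford n) (f e : clifford n -> clifford n).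

Let ho := omega_bounds hT.
Let hpi := PI_RGT_0.

Let hc : 0 < cos theta.
Proof. by apply: cos_gt_0; lra. Qed.

Lemma one_plus_sector J z : sphere J -> sector (2 * theta) (emb J z) ->
  0 < Cmod z /\ cos theta * (1 + Cmod z) <= Cmod (1 + z).
Proof.
move=> hJ /(sector_emb hJ) H; have {H} [|z0 h] := H _; first lra.
by split; [apply/Cmod_gt_0|apply: one_plus_lower; lra].
Qed.

Lemma one_plus_sector_neq0 J z : sphere J -> sector (2 * theta) (emb J z) -> (1 + z)%C <> 0%C.
Proof.
move=> hJ hz e; have [z0 h] := one_plus_sector hJ hz; rewrite e Cmod_0 in h.
by have := Rmult_lt_0_compat _ _ hc (Rplus_lt_0_compat _ _ Rlt_0_1 z0); lra.
Qed.

Definition rsec z : C := (z * (/ (1 + z) * / (1 + z)))%C.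

Lemma rsec_rep : exists e d, crep (@sector n (2 * theta)) e rsec d.
Proof.
have h1 := @crep_inv n (@sector n (2 * theta)) _ _ _ (crep_add (@crep_one n _) (@crep_id n _)) one_plus_sector_neq0.
by do 2 eexists; exact: crep_mult (@crep_id n _) (crep_mult h1 h1).
Qed.

Lemma rsec_bound J z : sphere J -> sector (2 * theta) (emb J z) ->
  Cmod (rsec z) <= / (cos theta * cos theta) * (Cmod z / ((1 + Cmod z) * (1 + Cmod z))).
Proof.
move=> hJ hz; have [z0 h] := one_plus_sector hJ hz; have n0 := one_plus_sector_neq0 hJ hz.
rewrite /rsec !Cmod_mult Cmod_inv //.
have p : 0 < cos theta * (1 + Cmod z) by nra.
have i : / Cmod (1 + z) <= / (cos theta * (1 + Cmod z)) by apply: Rinv_le_contravar.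
have i0 : 0 < / Cmod (1 + z) by apply: Rinv_0_lt_compat; lra.
have -> : / (cos theta * cos theta) * (Cmod z / ((1 + Cmod z) * (1 + Cmod z))) =
   Cmod z * (/ (cos theta * (1 + Cmod z)) * / (cos theta * (1 + Cmod z))) by field; lra.
by apply: Rmult_le_compat_l; [lra|nra].
Qed.

Lemma rsec_rbis J z : sphere J -> bisector theta (emb J z) -> rsec (z * z)%C = (rbis z * rbis z)%C.
Proof.
move=> hJ hz; have hth' : 0 < theta < PI / 2 by lra.
by have := one_plus_sector_neq0 hJ (bisector_sqr hJ hth' hz); rewrite /rsec /rbis => h; field.
Qed.

Lemma rbis_rep j : exists f d K, brep theta f (fun z => (rbis z ^ j.+1)%C) d 1 K.
Proof.
have hth' : 0 < theta < PI / 2 by lra.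
have nz J z : sphere J -> bisector theta (emb J z) -> (1 + z * z)%C <> 0%C.
  by move=> hJ hz; apply: (one_plus_sector_neq0 hJ); exact: bisector_sqr.
have id := @crep_id n (@bisector n theta).
have h1 := @crep_inv n _ _ _ _ (crep_add (@crep_one n _) (crep_mult id id)) nz.
have [d h2] := crep_pow j.+1 (crep_mult id h1).
eexists; exists d, ((/ cos theta) ^ j.+1); split; [exact: h2|lra| |].
  by apply: pow_le; apply: Rlt_le; exact: Rinv_0_lt_compat.
move=> J z hJ hz; have [_ h] := one_plus_sector hJ (bisector_sqr hJ hth' hz).
have z0 : 0 < Cmod z.
  by apply/Cmod_gt_0 => e0; move/(bisector_emb hJ): hz => H; have [] := H (theta_le_PI hT hth).
rewrite Cmod_pow; have -> : Rpower (Cmod z) 1 = Cmod z by rewrite Rpower_1.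
have -> : Rpower (Cmod z) (2 * 1) = Cmod z * Cmod z by rewrite Rpower_2 Rpower_1 //; nra.
rewrite Cmod_mult in h; have y0 : 0 < Cmod z * Cmod z by nra.
apply: pow_bound; first exact: Cmod_ge_0.
- split; first by apply: Rlt_le; apply: Rdiv_lt_0_compat; lra.
  by apply/Rle_div_l; nra.
- by apply: Rlt_le; exact: Rinv_0_lt_compat.
rewrite /rbis Cmod_div; last exact: nz hJ hz.
have p : 0 < cos theta * (1 + Cmod z * Cmod z) by nra.
have -> : / cos theta * (Cmod z / (1 + Cmod z * Cmod z)) = Cmod z * / (cos theta * (1 + Cmod z * Cmod z)) by field; lra.
by apply: Rmult_le_compat_l; [lra|apply: Rinv_le_contravar].
Qed.

(** Multiplicativity writes the operator of a power as a composition of operators of smaller powers,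
    injective by induction. *)
Lemma power_injective j f F dF al K : op_injective T -> brep theta f F dF al K ->
  on_bisector theta (fun z => F z = (rbis z ^ j.+1)%C) -> op_injective (calc_N0_bisector omega theta T f).
Proof.
move=> hinj; elim: j f F dF al K => [|j IH] f F dF al K hf hF.
  apply: (first_power_injective hn hT hth hinj hf) => r t hr ht.
  by have [-> ->] := hF r t hr ht; rewrite !Cpow_1_r.
have [g [dG [K' hg]]] := rbis_rep 0; have [h [dH [K'' hh]]] := rbis_rep j.
have hm : on_bisector theta (fun z => F z = (rbis z ^ j.+1 * rbis z ^ 1)%C).
  move=> r t hr ht; have [-> ->] := hF r t hr ht.
  by rewrite !(Cpow_S _ j.+1) !Cpow_1_r; split; ring.
move=> v v' w hv hv'.
have step u : calc_N0_bisector omega theta T f u w ->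
    exists y, calc_N0_bisector omega theta T g u y /\ calc_N0_bisector omega theta T h y w.
  move=> hu; have [y hy] := calc_bisector_total hn hT hth u hg.
  have [c hcc] := calc_bisector_total hn hT hth y hh.
  have := calc_bisector_mult hn hT hth hh hg hf hm hy hcc.
  by move/(calc_bisector_fun hn hT hth hf hu) => ->; exists y.
have [y [a b]] := step v hv; have [y' [a' b']] := step v' hv'.
have triv k : on_bisector theta (fun z => (rbis z ^ k)%C = (rbis z ^ k)%C) by [].
have ey := IH _ _ _ _ _ hh (triv _) _ _ _ b b'; rewrite -ey in a'.
apply: (first_power_injective hn hT hth hinj hg _ a a') => r t hr ht.
by rewrite !Cpow_1_r.
Qed.

End Regularizer.

Lemma ratio_le1 y b : Rpower y b / (1 + Rpower y (2 * b)) <= 1.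
Proof.
have p := Rpower_pos y b; rewrite Rpower_2.
by apply/Rle_div_l; nra.
Qed.

(** The exponent [1/2] turns the denominator of the N^0 bound into [1 + x]; what remains is
    [sqrt x <= 1 + x]. *)
Lemma ratio_half x : 0 < x ->
  0 <= x / ((1 + x) * (1 + x)) <= 1 /\
  x / ((1 + x) * (1 + x)) <= Rpower x (1 / 2) / (1 + Rpower x (2 * (1 / 2))).
Proof.
move=> hx; have hs := sqrt_lt_R0 x hx; have e := sqrt_sqrt x (Rlt_le _ _ hx).
have -> : 1 / 2 = / 2 by field.
have -> : 2 * / 2 = 1 by field.
rewrite Rpower_sqrt // Rpower_1 //.
have p : 0 < (1 + x) * (1 + x) by nra.
split.
  split; first by apply: Rlt_le; apply: Rdiv_lt_0_compat.
  by apply/Rle_div_l => //; nra.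
have -> : x / ((1 + x) * (1 + x)) = (x / (1 + x)) / (1 + x) by field; lra.
rewrite /Rdiv; apply: Rmult_le_compat_r; first by apply: Rlt_le; apply: Rinv_0_lt_compat; lra.
by apply/Rle_div_l; nra.
Qed.

(** * Comparison of the two calculi *)

Section Main.
Variables (n : nat) (hn : (0 < n)%N) (V : rightHilbertModule n).
Variables (T : operator V) (omega theta : R).
Hypothesis hT : bisectorial omega T.
Hypothesis hth : omega < theta < PI / 2.
Implicit Types (v w x : V) (J : clifford n) (f g e : clifford n -> clifford n).

Let ho := omega_bounds hT.
Let hpi := PI_RGT_0.

Let hth' : 0 < theta < PI / 2.
Proof. lra. Qed.

Lemma brep_N0 f F dF al K : brep theta f F dF al K -> Defs.N0 (@bisector n theta) f.
Proof. by move=> [h1 h2 h3 h4]; exact: (N0_of_rep hn (@bisector_paravector n theta) h1 h2 h3 h4). Qed.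

Lemma N0_brep f F dF : Defs.N0 (@bisector n theta) f -> crep (@bisector n theta) f F dF ->
  exists al K, brep theta f F dF al K.
Proof.
move=> [_ [al [K [h1 [h2 h3]]]]] hF; exists al, K; split=> // J z hJ hz.
by have [e _ _] := hF J z hJ hz; have := h3 _ hz; rewrite e !cl_norm_emb.
Qed.

Lemma brep_mult f F dF al K g G dG be K' : brep theta f F dF al K -> brep theta g G dG be K' ->
  brep theta (fun s => f s * g s)%R (fun z => (F z * G z)%C)
    (fun z => (dF z * G z + F z * dG z)%C) al (K * K').
Proof.
move=> [f1 f2 f3 f4] [g1 g2 g3 g4]; split=> //; [exact: crep_mult|exact: Rmult_le_pos|].
move=> J z hJ hz; have a := f4 J z hJ hz; have b := g4 J z hJ hz.
have r := ratio_le1 (Cmod z) be.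
rewrite Cmod_mult; set A := Rpower _ _ / _ in a *.
have -> : K * K' * A = (K * A) * K' by ring.
apply: Rmult_le_compat => //; try exact: Cmod_ge_0.
apply: Rle_trans b _; rewrite -[X in _ <= X]Rmult_1_r; exact: Rmult_le_compat_l.
Qed.

Lemma N0_sqr e : Defs.N0 (@sector n (2 * theta)) e -> Defs.N0 (@bisector n theta) (sqr_arg e).
Proof.
move=> he; have [E [dE [al [K [h1 h2 h3 h4]]]]] := rep_of_N0 he.
exact: brep_N0 (brep_sqr hT hth h1 h2 h3 h4).
Qed.

Lemma calc_N0_sqr e v w : Defs.N0 (@sector n (2 * theta)) e ->
  calc_N0_sector (2 * omega) (2 * theta) (op_sq T) e v w <->
  calc_N0_bisector omega theta T (sqr_arg e) v w.
Proof.
move=> he; have [E [dE [al [K [h1 h2 h3 h4]]]]] := rep_of_N0 he.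
exact: (calc_sector_bisector hn hT hth h1 h2 h3 h4).
Qed.

Lemma Npoly_sqr f : Npoly (@sector n (2 * theta)) f -> Npoly (@bisector n theta) (fun s => f (s * s)%R).
Proof.
move=> /rep_of_Npoly [F [dF [k [K [hF hk hK hb]]]]].
apply: (Npoly_of_rep hn (@bisector_paravector n theta) (crep_sqr hth' hF) (k := 2 * k) (K := K)) => //; first lra.
move=> J z hJ hz; have := hb J _ hJ (bisector_sqr hJ hth' hz).
have z0 : 0 < Cmod z.
  by apply/Cmod_gt_0 => e0; move/(bisector_emb hJ): hz => H; have [] := H (theta_le_PI hT hth).
have eP be : Rpower (Cmod (z * z)) be = Rpower (Cmod z) (2 * be).
  by rewrite Cmod_mult Rpower_2 Rpower_mult_distr.
by rewrite !eP; have -> : 2 * - k = - (2 * k) by ring.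
Qed.

(** For [k <= N] take the power [N + 1] of [s / (1 + s)^2]: [N] factors absorb the growth of [f],
    and the last one leaves the decay of N^0 with exponent [1/2]. *)
Lemma sector_regularizer f : op_injective T -> Npoly (@sector n (2 * theta)) f ->
  exists e, [/\ Defs.N0 (@sector n (2 * theta)) e, Defs.N0 (@sector n (2 * theta)) (fun s => e s * f s)%R &
    op_injective (calc_N0_bisector omega theta T (sqr_arg e))].
Proof.
move=> hinj /rep_of_Npoly [F [dF [k [K [hF hk hK hb]]]]].
have [e1 [d1 h1]] := rsec_rep hT hth.
have [N hN] : exists N, k <= INR N.
  by case: (nfloor_ex k hk) => N [_ hN]; exists N.+1; rewrite S_INR; lra.
have [d2 h2] := crep_pow N.+1 h1.
pose M := / (cos theta * cos theta).
have hc : 0 < cos theta by apply: cos_gt_0; lra.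
have hM : 0 <= M by apply: Rlt_le; apply: Rinv_0_lt_compat; nra.
have hMN : 0 <= M ^ N.+1 by exact: pow_le.
have b1 J z : sphere J -> sector (2 * theta) (emb J z) ->
    Cmod (rsec z ^ N.+1) <= M ^ N.+1 * (Rpower (Cmod z) (1 / 2) / (1 + Rpower (Cmod z) (2 * (1 / 2)))).
  move=> hJ hz; have [z0 _] := one_plus_sector hT hth hJ hz.
  have [r1 r2] := ratio_half z0; rewrite Cmod_pow.
  have b := pow_bound N (Cmod_ge_0 (rsec z)) r1 hM (rsec_bound hT hth hJ hz).
  by apply: Rle_trans b _; exact: Rmult_le_compat_l.
have half : 0 < 1 / 2 by lra.
exists (fun s => e1 s ^+ N.+1)%R; split.
- exact: (N0_of_rep hn (@sector_paravector n _) h2 half hMN b1).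
- have hK2 : 0 <= M ^ N.+1 * (2 * K) by apply: Rmult_le_pos => //; lra.
  apply: (N0_of_rep hn (@sector_paravector n _) (crep_mult h2 hF) half hK2) => J z hJ hz.
  have [z0 _] := one_plus_sector hT hth hJ hz; have [r1 r2] := ratio_half z0.
  have bF := hb J z hJ hz; have kk : 0 <= k <= INR N by [].
  have ab := power_absorbed z0 kk.
  set X := Cmod z / _ in r1 r2 ab; set Y := Rpower _ (1 / 2) / _ in r2 *; set P := Rpower _ k + _ in bF ab.
  have p0 : 0 <= P by have := Rpower_pos (Cmod z) k; have := Rpower_pos (Cmod z) (- k); rewrite /P; lra.
  rewrite Cmod_mult Cmod_pow.
  apply: (Rle_trans _ ((M * X) ^ N.+1 * (K * P))).
    apply: Rmult_le_compat => //; [apply: pow_le; exact: Cmod_ge_0|exact: Cmod_ge_0|].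
    by apply: pow_incr; split; [exact: Cmod_ge_0|exact: (rsec_bound hT hth hJ hz)].
  rewrite Rpow_mult_distr.
  have -> : M ^ N.+1 * X ^ N.+1 * (K * P) = M ^ N.+1 * (K * (X * (X ^ N * P))) by rewrite /=; ring.
  rewrite Rmult_assoc; apply: Rmult_le_compat_l => //.
  have -> : 2 * K * Y = K * (Y * 2) by ring.
  apply: Rmult_le_compat_l => //; apply: Rmult_le_compat => //; first lra.
  by apply: Rmult_le_pos => //; apply: pow_le; lra.
- have hs := brep_sqr hT hth h2 half hMN b1.
  (* [rsec (z^2)] is the square of [rbis z], so the exponent is [2 (N + 1)]; [power_injective]
     counts it from 1. *)
  apply: (power_injective hn hT hth (j := N + N.+1) hinj hs) => r t hr ht.
  have hJ := sphere_gen (Ordinal hn).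
  have [p1 p2] := bisector_polar hJ (theta_le_PI hT hth) hr ht.
  have H z : bisector theta (emb (gen (Ordinal hn)) z) -> (rsec (z * z) ^ N.+1)%C = (rbis z ^ (N + N.+1).+1)%C.
    move=> hz; rewrite (rsec_rbis hT hth hJ hz) Cpow_mult_l -Cpow_add_r; congr Cpow.
  by split; exact: H.
Qed.

Lemma Hinf_sqr f v w : op_injective T -> Npoly (@sector n (2 * theta)) f ->
  Hinf_sector (2 * omega) (2 * theta) (op_sq T) f v w <->
  Hinf_bisector omega theta T (fun s => f (s * s)%R) v w.
Proof.
move=> hinj hf; split.
  move=> [e [he hef ie [u [hu hw]]]]; exists (sqr_arg e); split.
  - exact: N0_sqr.
  - exact: (N0_sqr hef).
  - move=> x x' y /(calc_N0_sqr _ _ he) h /(calc_N0_sqr _ _ he) h'; exact: ie h h'.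
  - by exists u; split; [apply/(calc_N0_sqr v u hef)|apply/calc_N0_sqr].
move=> [e [he hef ie [u [hu hw]]]].
have [e' [he' hef' ie']] := sector_regularizer hinj hf.
have [F [dF [_ [_ [hF _ _ _]]]]] := rep_of_Npoly hf; have hF2 := crep_sqr hth' hF.
have [E [dE [al [K [h1 h2 h3 h4]]]]] := rep_of_N0 he; have bE : brep theta e E dE al K by [].
have [E' [dE' [al' [K' [k1 k2 k3 k4]]]]] := rep_of_N0 (N0_sqr he').
have bE' : brep theta (sqr_arg e') E' dE' al' K' by [].
have [be [L bEF]] := N0_brep hef (crep_mult h1 hF2).
have [be' [L' bEF']] := N0_brep (N0_sqr hef') (crep_mult k1 hF2).
(* With [g = f(s^2)] and [e'] read at [s^2]: [a = (e' g)(T) v], [b = e'(T) w], and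
   [u = (e g)(T) v = e(T) w] by hypothesis. Products in both orders give
   [e(T) a = e'(T) u = e(T) b], whence [a = b]. *)
have [a ha] := calc_bisector_total hn hT hth v bEF'.
have [c hc] := calc_bisector_total hn hT hth a bE.
have [b hb] := calc_bisector_total hn hT hth w bE'.
have [c' hc'] := calc_bisector_total hn hT hth b bE.
have [c1 hc1] := calc_bisector_total hn hT hth u bE'.
have p1 := brep_mult bE bEF'; have p2 := brep_mult bE bE'.
have q1 := calc_bisector_mult hn hT hth bE bEF' p1 _ ha hc.
have q2 := calc_bisector_mult hn hT hth bE' bEF p1 _ hu hc1.
have q3 := calc_bisector_mult hn hT hth bE bE' p2 _ hb hc'.
have q4 := calc_bisector_mult hn hT hth bE' bE p2 _ hw hc1.
have ec : c = c1 by apply: (calc_bisector_fun hn hT hth p1); [apply: q1|apply: q2] => r t hr ht; split; ring.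
have ec' : c' = c1 by apply: (calc_bisector_fun hn hT hth p2); [apply: q3|apply: q4] => r t hr ht; split; ring.
have eab : a = b by apply: (ie _ _ c1); [rewrite -ec|rewrite -ec'].
exists e'; split=> //.
- move=> x x' y /(calc_N0_sqr _ _ he') h /(calc_N0_sqr _ _ he') h'; exact: ie' h h'.
- exists a; split; first by apply/calc_N0_sqr.
  by apply/calc_N0_sqr => //; rewrite eab.
Qed.

End Main.

Theorem lemma3p1 (n : nat) (hn : (0 < n)%N) (V : rightHilbertModule n)
    (T : operator V) (omega : R)
    (hinj : op_injective T) (hT : bisectorial omega T) :
  [/\ op_injective (op_sq T),
      sectorial (2 * omega) (op_sq T) &
      forall (theta : R) (f : clifford n -> clifford n),
        omega < theta < PI / 2 ->
        Npoly (@sector n (2 * theta)) f ->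
        Npoly (@bisector n theta) (fun s => f (s * s)%R) /\
        forall v w : V,
          Hinf_sector (2 * omega) (2 * theta) (op_sq T) f v w <->
          Hinf_bisector omega theta T (fun s => f (s * s)%R) v w].
Proof.
split; [exact: op_sq_injective|exact: op_sq_sectorial|].
move=> theta f hth hf; split; first exact: (Npoly_sqr hn hT hth hf).
by move=> v w; exact: Hinf_sqr.
Qed.
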